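(* Let $m\ge2$ be an integer, $0<r<1$, $G=\{z\in\mathbb{C}:|z^m-1|<r^m\}$, let $p_n(z)=z^n+\cdots$ be the monic Bergman polynomials of $G$, and let $$\tau:=2-\frac2m-\frac{2s}m,\quad s=0,1,\ldots,m-1.$$ Then for $|z^m-1|\ge r^{2m}$, $z^m-1\ne-r^{2m}$, the monic Bergman polynomials satisfy, for each $s=0,1,\ldots,m-1$, $$\lim_{k\to\infty}\frac{p_{km+s}(z)}{z^s(z^m-1)^k}=\left(\frac{z^m-1+r^{2m}}{z^m-1}\right)^{\tau/2},$$ where the branch of the power function on the right-hand side is taken to equal one at infinity, and the convergence is uniform on compact subsets. Furthermore, for each $j=1,2,\ldots,m$ and $z\in G_j$ with $|z^m-1|<r^{2m}$, we have $$\lim_{k\to\infty}\frac{(-1)^{k+1}k^{2+\tau/2}}{r^{m(2k+4)}}\,p_{km+s}(z)=\frac{e^{2\pi ij(s+1)/m}\,z^{m-1}\,\tau\,\Gamma(\tau/2)\,\sin(\tau\pi/2)}{2\pi(1-r^{2m})^{\tau/2}(z^m-1+r^{2m})^2}$$ for each $s=0,1,\ldots,m-2$, the convergence being uniform on compact subsets (of $\{z\in G_j:|z^m-1|<r^{2m}\}$).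
   Context: $G$ has $m$ connected components $G_1,\dots,G_m$, labelled so that $G_j$ contains $e^{2\pi ij/m}$. The Bergman polynomials $P_n(z)=\lambda_nz^n+\cdots$, $\lambda_n>0$, of $G$ are the orthonormalization of $1,z,z^2,\ldots$ with respect to $\int_Gf\,\overline{g}\,dA$ ($dA$ is area measure), and $p_n=P_n/\lambda_n$. For $0\le s\le m-1$, $p_{km+s}(z)=z^sq_{k,s}(z^m)$ with $q_{k,s}$ a monic polynomial of degree $k$, so $p_{km+s}(z)/z^s$ is a polynomial (this interprets the quotient at $z=0$). $\Gamma(\cdot)$ in the formula is the Gamma function. *)

(* Defs.v *)
From HB Require Import structures.
From mathcomp Require Import all_boot all_order all_algebra.
From mathcomp Require Import complex.
From mathcomp Require Import all_classical all_reals all_analysis.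

Set Implicit Arguments.
Unset Strict Implicit.
Unset Printing Implicit Defensive.

Import Order.TTheory GRing.Theory Num.Theory.
Import numFieldNormedType.Exports.

Local Open Scope classical_set_scope.
Local Open Scope complex_scope.
Local Open Scope ring_scope.

(* The modulus topology on R[i]: [^o] carries it for every numFieldType. *)
HB.instance Definition _ (R : realType) := NormedModule.copy R[i] R[i]^o.

Definition cexp (R : realType) (z : R[i]) : R[i] :=
  (expR (complex.Re z))%:C * (cos (complex.Im z) +i* sin (complex.Im z)).

(* Euler's integral; it is the Gamma function for x > 0 only. *)
Definition Gamma (R : realType) (x : R) : R :=
  \int[lebesgue_measure]_(t in `]0, +oo[) (t `^ (x - 1) * expR (- t)).

Definition area_integral (R : realType) (A : set R[i]) (f : R[i] -> R[i]) :
    R[i] :=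
  let mu := (@lebesgue_measure R \x @lebesgue_measure R)%E in
  let D := [set p : R * R | A (p.1 +i* p.2)] in
  (\int[mu]_(p in D) complex.Re (f (p.1 +i* p.2)))
  +i* (\int[mu]_(p in D) complex.Im (f (p.1 +i* p.2))).

(* P is the orthonormalization of 1, z, z^2, ... in L^2(A, dA): since P i has
   degree exactly i, the triangularity of Gram-Schmidt is built in. In R[i],
   [0 < lead_coef (P n)] says that the leading coefficient is real and
   positive. *)
Definition bergman_polynomials (R : realType) (A : set R[i])
    (P : nat -> {poly R[i]}) : Prop :=
  [/\ forall n, size (P n) = n.+1,
      forall n, 0 < lead_coef (P n) &
      forall i j,
        area_integral A (fun z => (P i).[z] * ((P j).[z])^*) = (i == j)%:R].

Definition monic_part (R : realType) (p : {poly R[i]}) : {poly R[i]} :=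
  (lead_coef p)^-1 *: p.

(* F is a branch on D of the (multivalued) power u ^ a: it is obtained from a
   continuous logarithm L of u on D. *)
Definition power_branch (R : realType) (D : set R[i]) (u : R[i] -> R[i])
    (a : R) (F : R[i] -> R[i]) : Prop :=
  exists L : R[i] -> R[i],
    {within D, continuous L} /\
    (forall z, D z -> cexp (L z) = u z /\ F z = cexp (a%:C * L z)).

Definition tends_to_at_infinity (R : realType) (F : R[i] -> R[i]) (l : R[i]) :
    Prop :=
  forall e : R, 0 < e -> exists M : R,
    forall z : R[i], M%:C < `|z| -> `|F z - l| < e%:C.

(* Taking K to be a singleton gives pointwise convergence on D. *)
Definition cvg_uniformly_on_compacts (R : realType) (D : set R[i])
    (f : nat -> R[i] -> R[i]) (F : R[i] -> R[i]) : Prop :=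
  forall K : set R[i], compact K -> K `<=` D -> {uniform K, f @ \oo --> F}.

Definition lemniscate (R : realType) (m : nat) (r : R) : set R[i] :=
  [set z | `|z ^+ m - 1| < (r ^+ m)%:C].

(* e^{2 pi i j / m} *)
Definition unit_root (R : realType) (m j : nat) : R[i] :=
  cexp ((2 * pi * j%:R / m%:R) *i).

Definition lemniscate_component (R : realType) (m : nat) (r : R) (j : nat) :
    set R[i] :=
  connected_component (lemniscate m r) (unit_root R m j).

Definition tau (R : realType) (m s : nat) : R :=
  2 - 2 / m%:R - 2 * s%:R / m%:R.

(* { z : |z^m - 1| >= r^{2m}, z^m - 1 <> - r^{2m} }. This set is connected and
   contains a neighbourhood of infinity, so a power branch on it that tends to
   one at infinity is unique. *)
Definition outer_domain (R : realType) (m : nat) (r : R) : set R[i] :=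
  [set z | (r ^+ (2 * m))%:C <= `|z ^+ m - 1|
           /\ z ^+ m - 1 <> - (r ^+ (2 * m))%:C].

Definition inner_domain (R : realType) (m : nat) (r : R) (j : nat) :
    set R[i] :=
  [set z | lemniscate_component m r j z
           /\ `|z ^+ m - 1| < (r ^+ (2 * m))%:C].

(* Main.v *)
(** Put u = z^m - 1, rho = r^m and al = tau / 2 = 1 - (s + 1) / m, so that G is
    the set |u| < rho. Stokes' formula for the weight (rho^2 - |u|^2)^2, which
    vanishes to second order on the boundary of G, shows that the functions
    u' u^n are orthogonal on G, with squared norms proportional to
    rho^(2 n) / (n + 1). Rotation by 2 pi / m preserves area, hence z^a and z^b
    are orthogonal unless a = b mod m; therefore p_{km+s} = z^s q(u) with q
    monic of degree k. Since |z|^s = |z^(m-1) (1 + u)^(-al)| on G, in the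
    variable x = u / rho the Gram matrix of the functions z^s u^a is, up to a
    constant and powers of rho, the product of the Toeplitz matrix of
    h(x) = (1 + rho x)^(-al), of diag(1 / (n + 1)), and of the transposed
    Toeplitz matrix. Inverting the three factors (the inverse symbol is
    g = 1 / h) expresses the coefficients c_n of q through a system which,
    shifted by k, is within O(1 / k) of the one for a weight without the factor
    1 / (n + 1), which is solved explicitly. Read from the top, the c_n tend to
    the coefficients of g; this gives (1 + rho^2 / u)^al outside the critical
    circle |u| = rho^2. Read from the bottom, they are governed by the binomial
    coefficient of (al, k), of size k^(-1-al), whose constant
    al Gamma(al) sin(pi al) / pi comes from Gauss' product for Gamma and from
    Euler's product for the sine. Branches of powers are identified by the fact
    that two of them differ by a continuous m-th root of unity, which is constant
    on a connected set. *)
Require Import Defs.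
From HB Require Import structures.
From mathcomp Require Import all_boot all_order all_algebra.
From mathcomp Require Import complex.
From mathcomp Require Import all_classical all_reals all_analysis.
From mathcomp Require Import measurable_realfun.
From mathcomp Require Import ring lra zify.

Set Implicit Arguments.
Unset Strict Implicit.
Unset Printing Implicit Defensive.

Import Order.TTheory GRing.Theory Num.Theory.
Import numFieldNormedType.Exports.

Local Open Scope classical_set_scope.
Local Open Scope complex_scope.
Local Open Scope ring_scope.

(** * Absolutely convergent complex series *)

Section ComplexSeries.
Context {R : realType}.
Implicit Types (z w : R[i]) (a b : nat -> R[i]).

(** No contour integral and no analytic continuation occurs: every limit is a dominated limit in a
    weighted l^1 space of coefficients. The outer limit reaches the circle |u| = rho^2 because the
    binomial coefficients of al are absolutely summable for 0 <= al <= 1, and c_(k-n) is at most a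
    constant times |binomial (al, n)| rho^n; the inner limit loses powers of the index and so lives
    strictly inside. The obstacle is uniformity in k: the bound available at once for the rescaled
    Gram data of q involves the unknown coefficients of q. The O(1 / k) comparison is therefore
    first used to absorb half of the supremum of these data, and only then to compute them. Branches
    are controlled algebraically because m al is an integer: the m-th power of the series (1 + u)^al
    is a polynomial in u. Stokes' formula governs the moments weighted by powers of rho^2 - |u|^2;
    the unweighted ones follow from them up to a constant, which the decay of (|u| / rho)^n on G
    removes. *)

Definition cnorm z : R := complex.Re `|z|.

Lemma cnormE z : `|z| = (cnorm z)%:C.
Proof. by rewrite /cnorm normc_def. Qed.

Lemma cnorm_ge0 z : 0 <= cnorm z.
Proof. by rewrite -ler0c -cnormE. Qed.

Lemma cnormM z w : cnorm (z * w) = cnorm z * cnorm w.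
Proof. by apply: complexI; rewrite rmorphM /= -!cnormE normrM. Qed.

Lemma cnormX z n : cnorm (z ^+ n) = cnorm z ^+ n.
Proof. by apply: complexI; rewrite rmorphXn /= -!cnormE normrX. Qed.

Lemma cnormV z : cnorm z^-1 = (cnorm z)^-1.
Proof. by apply: complexI; rewrite fmorphV /= -!cnormE normfV. Qed.

Lemma cnormJ z : cnorm z^* = cnorm z.
Proof. by rewrite /cnorm normcJ. Qed.

Lemma cnormN z : cnorm (- z) = cnorm z.
Proof. by rewrite /cnorm normrN. Qed.

Lemma cnormB z w : cnorm (z - w) = cnorm (w - z).
Proof. by rewrite /cnorm distrC. Qed.

Lemma cnorm0 : cnorm 0 = 0.
Proof. by rewrite /cnorm normr0. Qed.

Lemma cnorm1 : cnorm 1 = 1.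
Proof. by rewrite /cnorm normr1. Qed.

Lemma cnorm_real (x : R) : cnorm x%:C = `|x|.
Proof. by rewrite /cnorm normc_def /= expr0n addr0 sqrtr_sqr. Qed.

Lemma cnorm_eq0 z : (cnorm z == 0) = (z == 0).
Proof. by rewrite -(inj_eq (@complexI R)) -cnormE normr_eq0. Qed.

Lemma cnorm_gt0 z : (0 < cnorm z) = (z != 0).
Proof. by rewrite lt0r cnorm_ge0 andbT cnorm_eq0. Qed.

Lemma cnormD z w : cnorm (z + w) <= cnorm z + cnorm w.
Proof. by rewrite -lecR rmorphD /= -!cnormE ler_normD. Qed.

Lemma cnorm_sub z w : cnorm (z - w) <= cnorm z + cnorm w.
Proof. by rewrite -(cnormN w) cnormD. Qed.

Lemma cnorm_dist z w : `|cnorm z - cnorm w| <= cnorm (z - w).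
Proof.
rewrite ler_norml; apply/andP; split.
  have := cnormD (w - z) z; rewrite subrK (cnormB w); lra.
have := cnormD (z - w) w; rewrite subrK; lra.
Qed.

Lemma cnorm_sum (I : Type) (s : seq I) (P : pred I) (F : I -> R[i]) :
  cnorm (\sum_(i <- s | P i) F i) <= \sum_(i <- s | P i) cnorm (F i).
Proof.
elim/big_ind2 : _ => [|x1 x2 y1 y2 h1 h2|//]; first by rewrite cnorm0.
exact: le_trans (cnormD _ _) (lerD h1 h2).
Qed.

Lemma cnorm_sqr z : cnorm z ^+ 2 = complex.Re z ^+ 2 + complex.Im z ^+ 2.
Proof. by apply: complexI; rewrite add_Re2_Im2 cnormE rmorphXn. Qed.

Lemma cReD z w : complex.Re (z + w) = complex.Re z + complex.Re w.
Proof. by case: z w => [? ?] [? ?]. Qed.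
Lemma cImD z w : complex.Im (z + w) = complex.Im z + complex.Im w.
Proof. by case: z w => [? ?] [? ?]. Qed.
Lemma cReN z : complex.Re (- z) = - complex.Re z.
Proof. by case: z. Qed.
Lemma cImN z : complex.Im (- z) = - complex.Im z.
Proof. by case: z. Qed.
Lemma cReM z w : complex.Re (z * w) =
  complex.Re z * complex.Re w - complex.Im z * complex.Im w.
Proof. by case: z w => [? ?] [? ?]. Qed.
Lemma cImM z w : complex.Im (z * w) =
  complex.Re z * complex.Im w + complex.Im z * complex.Re w.
Proof. by case: z w => [? ?] [? ?]. Qed.

Lemma Re_le_cnorm z : `|complex.Re z| <= cnorm z.
Proof. by rewrite -lecR -cnormE normc_ge_Re. Qed.

Lemma Im_le_cnorm z : `|complex.Im z| <= cnorm z.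
Proof.
rewrite -(@ler_pXn2r _ 2) ?nnegrE ?cnorm_ge0// cnorm_sqr real_normK ?num_real//.
by rewrite lerDr sqr_ge0.
Qed.

Lemma cnorm_le_ReIm z : cnorm z <= `|complex.Re z| + `|complex.Im z|.
Proof.
rewrite -(@ler_pXn2r _ 2) ?nnegrE ?cnorm_ge0 ?addr_ge0// cnorm_sqr sqrrD.
rewrite !real_normK ?num_real// addrAC lerDl mulrn_wge0//.
Qed.

Lemma Re_sum (I : Type) (s : seq I) (P : pred I) (F : I -> R[i]) :
  complex.Re (\sum_(i <- s | P i) F i) = \sum_(i <- s | P i) complex.Re (F i).
Proof. by elim/big_rec2: _ => // i x y _ <-; rewrite cReD. Qed.

Lemma Im_sum (I : Type) (s : seq I) (P : pred I) (F : I -> R[i]) :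
  complex.Im (\sum_(i <- s | P i) F i) = \sum_(i <- s | P i) complex.Im (F i).
Proof. by elim/big_rec2: _ => // i x y _ <-; rewrite cImD. Qed.

Lemma big_ord_cat (V : nmodType) (F : nat -> V) n N : (n <= N)%N ->
  \sum_(i < N) F i = \sum_(i < n) F i + \sum_(n <= i < N) F i.
Proof. by move=> nN; rewrite -!(big_mkord xpredT F) (big_cat_nat _ nN). Qed.

(** The norm of [R[i]] takes values in [R[i]]; stating limits through the real-valued [cnorm] with a
    real [e] keeps every estimate in the ordered field [R]. *)
Definition ctends (u : nat -> R[i]) (l : R[i]) :=
  forall e : R, 0 < e ->
    exists N, forall n, (N <= n)%N -> cnorm (u n - l) <= e.

Lemma ctends_cst l : ctends (fun=> l) l.
Proof. by move=> e e0; exists 0%N => n _; rewrite subrr cnorm0 ltW. Qed.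

Lemma ctends_ext (u v : nat -> R[i]) l : (forall n, u n = v n) ->
  ctends u l -> ctends v l.
Proof. by move=> uv ul e /ul[N h]; exists N => n /h; rewrite uv. Qed.

Lemma ctends_near (u v : nat -> R[i]) l K :
  (forall n, (K <= n)%N -> u n = v n) -> ctends u l -> ctends v l.
Proof.
move=> uv ul e /ul[N h]; exists (maxn K N) => n; rewrite geq_max => /andP[Kn Nn].
by rewrite -uv// h.
Qed.

Lemma ctendsD u v l m : ctends u l -> ctends v m ->
  ctends (fun n => u n + v n) (l + m).
Proof.
move=> ul vm e e0; have e2 : 0 < e / 2 by lra.
have [N hN] := ul _ e2; have [M hM] := vm _ e2.
exists (maxn N M) => n; rewrite geq_max => /andP[/hN h1 /hM h2].
rewrite (_ : _ - _ = (u n - l) + (v n - m)); last by ring.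
have := cnormD (u n - l) (v n - m); lra.
Qed.

Lemma ctendsM u v l m : ctends u l -> ctends v m ->
  ctends (fun n => u n * v n) (l * m).
Proof.
move=> ul vm e e0.
pose c := cnorm l + cnorm m + 1; have c0 : 0 < c.
  by rewrite /c; have := cnorm_ge0 l; have := cnorm_ge0 m; lra.
pose d := Num.min 1 (e / c); have d0 : 0 < d by rewrite lt_min ltr01 divr_gt0.
have d1 : d <= 1 by rewrite ge_min lexx.
have dc : d * c <= e by rewrite -ler_pdivlMr// ge_min lexx orbT.
have [N hN] := ul _ d0; have [M hM] := vm _ d0.
exists (maxn N M) => n; rewrite geq_max => /andP[/hN h1 /hM h2].
rewrite (_ : _ - _ = (u n - l) * (v n - m) + (l * (v n - m) + (u n - l) * m));
  last by ring.
apply: le_trans dc; apply: le_trans (cnormD _ _) _.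
apply: le_trans (lerD (lexx _) (cnormD _ _)) _; rewrite !cnormM.
have k1 : cnorm (u n - l) * cnorm (v n - m) <= d * 1.
  by apply: ler_pM; rewrite ?cnorm_ge0//; exact: le_trans h2 d1.
have k2 : cnorm l * cnorm (v n - m) <= cnorm l * d by rewrite ler_wpM2l ?cnorm_ge0.
have k3 : cnorm (u n - l) * cnorm m <= d * cnorm m by rewrite ler_wpM2r ?cnorm_ge0.
rewrite /c; lra.
Qed.

Lemma ctends_sum (I : Type) (s : seq I) (u : I -> nat -> R[i]) l :
  (forall i, ctends (u i) (l i)) ->
  ctends (fun n => \sum_(i <- s) u i n) (\sum_(i <- s) l i).
Proof.
move=> h; elim: s => [|i s ih].
  by rewrite big_nil; apply: (ctends_ext _ (ctends_cst 0)) => n; rewrite big_nil.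
rewrite big_cons; apply: ctends_ext (ctendsD (h i) ih) => n.
by rewrite big_cons.
Qed.

Lemma ctends_le u l (B : R) : ctends u l -> (forall n, cnorm (u n) <= B) ->
  cnorm l <= B.
Proof.
move=> ul uB; rewrite leNgt; apply/negP => Bl.
have e0 : 0 < (cnorm l - B) / 2 by lra.
have [N /(_ N (leqnn _)) h] := ul _ e0.
have := cnorm_sub (u N) (u N - l); rewrite opprB addrC subrK.
have := uB N; lra.
Qed.

Lemma ctends_uniq u l m : ctends u l -> ctends u m -> l = m.
Proof.
move=> ul um; apply/eqP; rewrite -subr_eq0 -cnorm_eq0 eq_le cnorm_ge0 andbT.
have h : ctends (fun n => u n + (-1) * u n) (l + (-1) * m).
  by apply: ctendsD ul (ctendsM (ctends_cst _) um).
rewrite (_ : l - m = l + (-1) * m); last by ring.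
by apply: ctends_le h _ => n; rewrite mulN1r subrr cnorm0.
Qed.

(** [N] is chosen so that its partial sum lies within [e] of the supremum of all of them: the Cauchy
    criterion in the form used below to cut off tails. *)
Lemma real_tail (b : nat -> R) (B : R) :
  (forall n, \sum_(i < n) b i <= B) -> (forall i, 0 <= b i) ->
  forall e, 0 < e ->
    exists N, forall n, \sum_(i < n) b i <= \sum_(i < N) b i + e.
Proof.
move=> bB b0 e e0; pose E := [set \sum_(i < n) b i | n in [set: nat]].
have hE : has_sup E.
  split; first by exists (\sum_(i < 0) b i), 0%N.
  by exists B => _ [n _ <-].
have [_ [N _ <-] hN] := sup_adherent e0 hE; exists N => n.
have : \sum_(i < n) b i <= sup E.
  by apply: ub_le_sup; [case: hE|exists n].
lra.
Qed.

Lemma ctends_real (u : nat -> R) (l : R) :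
  (u n @[n --> \oo] --> l) <-> ctends (fun n => (u n)%:C) l%:C.
Proof.
split.
  move=> /cvgrPdist_le ul e /ul[N _ h]; exists N => n Nn.
  by rewrite -rmorphB /= cnorm_real distrC; exact: h.
move=> h; apply/cvgrPdist_le => e /h[N hN]; exists N => // n /= Nn.
by rewrite distrC -cnorm_real rmorphB; exact: hN.
Qed.

Lemma ctends_ReIm (u : nat -> R[i]) (x y : R) :
  complex.Re (u n) @[n --> \oo] --> x -> complex.Im (u n) @[n --> \oo] --> y ->
  ctends u (x +i* y).
Proof.
move=> /cvgrPdist_le hx /cvgrPdist_le hy e e0.
have e2 : 0 < e / 2 by lra.
have [N _ h1] := hx _ e2; have [M _ h2] := hy _ e2.
exists (maxn N M) => n; rewrite geq_max => /andP[/h1 /= k1 /h2 /= k2].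
apply: le_trans (cnorm_le_ReIm _) _.
rewrite cReD cImD cReN cImN /= distrC (distrC (complex.Im _)); lra.
Qed.

Definition asum (a : nat -> R[i]) :=
  exists B, forall n, \sum_(i < n) cnorm (a i) <= B.

(** Componentwise real limits, with a default value for divergent series. *)
Definition tsum (a : nat -> R[i]) : R[i] :=
  limn (series (fun i => complex.Re (a i)))
  +i* limn (series (fun i => complex.Im (a i))).

Lemma cvg_series_dom (v : nat -> R) (B : R) :
  (forall n, \sum_(i < n) `|v i| <= B) -> cvgn (series v).
Proof.
move=> vB; apply: normed_cvg; apply: nondecreasing_is_cvgn.
  apply/nondecreasing_seqP => n.
  by rewrite /normed_series_of /series /= big_nat_recr //= lerDl.
by exists B => _ [n _ <-]; rewrite /normed_series_of /series /= big_mkord.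
Qed.

Lemma tsum_cvg a : asum a -> ctends (fun n => \sum_(i < n) a i) (tsum a).
Proof.
move=> [B hB]; apply: ctends_ReIm.
  have : cvgn (series (fun i => complex.Re (a i))).
    apply: (@cvg_series_dom _ B) => n; apply: le_trans (hB n).
    by apply: ler_sum => i _; exact: Re_le_cnorm.
  apply: cvg_trans; apply: near_eq_cvg; near=> n.
  by rewrite Re_sum seriesEord.
have : cvgn (series (fun i => complex.Im (a i))).
  apply: (@cvg_series_dom _ B) => n; apply: le_trans (hB n).
  by apply: ler_sum => i _; exact: Im_le_cnorm.
apply: cvg_trans; apply: near_eq_cvg; near=> n.
by rewrite Im_sum seriesEord.
Unshelve. all: by end_near. Qed.

Lemma tsum_uniq a l : asum a -> ctends (fun n => \sum_(i < n) a i) l ->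
  tsum a = l.
Proof. by move=> /tsum_cvg; exact: ctends_uniq. Qed.

Lemma tsum_le a (B : R) : (forall n, \sum_(i < n) cnorm (a i) <= B) ->
  cnorm (tsum a) <= B.
Proof.
move=> h; apply: (@ctends_le (fun n => \sum_(i < n) a i)).
  by apply: tsum_cvg; exists B.
by move=> n; apply: le_trans (h n); exact: cnorm_sum.
Qed.

Lemma eq_tsum a b : (forall i, a i = b i) -> tsum a = tsum b.
Proof. by move=> /funext ->. Qed.

Lemma asum_le (a : nat -> R[i]) (b : nat -> R) (B : R) :
  (forall i, cnorm (a i) <= b i) ->
  (forall n, \sum_(i < n) b i <= B) -> asum a.
Proof.
by move=> ab bB; exists B => n; apply: le_trans (bB n); apply: ler_sum => i _.
Qed.

Lemma asumD a b : asum a -> asum b -> asum (fun i => a i + b i).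
Proof.
move=> [A hA] [B hB]; exists (A + B) => n.
apply: le_trans (lerD (hA n) (hB n)); rewrite -big_split /=.
by apply: ler_sum => i _; exact: cnormD.
Qed.

Lemma asumZ c a : asum a -> asum (fun i => c * a i).
Proof.
move=> [A hA]; exists (cnorm c * A) => n.
under eq_bigr do rewrite cnormM.
by rewrite -mulr_sumr ler_wpM2l ?cnorm_ge0.
Qed.

Lemma asum_sum (I : Type) (s : seq I) (F : I -> nat -> R[i]) :
  (forall i, asum (F i)) -> asum (fun j => \sum_(i <- s) F i j).
Proof.
move=> h; elim: s => [|i s ih].
  by exists 0 => n; rewrite big1// => j _; rewrite big_nil cnorm0.
rewrite (_ : (fun j => _) = (fun j => F i j + \sum_(i <- s) F i j)).
  exact: asumD.
by apply/funext => j; rewrite big_cons.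
Qed.

Lemma tsumD a b : asum a -> asum b ->
  tsum (fun i => a i + b i) = tsum a + tsum b.
Proof.
move=> sa sb; apply: tsum_uniq; first exact: asumD.
apply: ctends_ext (ctendsD (tsum_cvg sa) (tsum_cvg sb)) => n.
by rewrite big_split.
Qed.

Lemma tsumZ c a : asum a -> tsum (fun i => c * a i) = c * tsum a.
Proof.
move=> sa; apply: tsum_uniq; first exact: asumZ.
apply: ctends_ext (ctendsM (ctends_cst c) (tsum_cvg sa)) => n.
by rewrite mulr_sumr.
Qed.

Lemma tsumB a b : asum a -> asum b ->
  tsum (fun i => a i - b i) = tsum a - tsum b.
Proof.
move=> sa sb; rewrite -mulN1r -tsumZ// -tsumD//; last exact: asumZ.
by apply: eq_tsum => i; rewrite mulN1r.
Qed.

Lemma tsum_sum (I : Type) (s : seq I) (F : I -> nat -> R[i]) :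
  (forall i, asum (F i)) ->
  tsum (fun j => \sum_(i <- s) F i j) = \sum_(i <- s) tsum (F i).
Proof.
move=> h; apply: tsum_uniq; first exact: asum_sum.
apply: (ctends_ext (u := fun n => \sum_(i <- s) \sum_(j < n) F i j)) => [n|].
  by rewrite exchange_big.
by apply: ctends_sum => i; exact: tsum_cvg.
Qed.

Lemma asum_fin a N : (forall i, (N <= i)%N -> a i = 0) -> asum a.
Proof.
move=> h; exists (\sum_(i < N) cnorm (a i)) => n.
have [nN|Nn] := leqP n N.
  rewrite [leRHS](big_ord_cat (fun i => cnorm (a i)) nN) lerDl.
  by apply: sumr_ge0 => i _; exact: cnorm_ge0.
rewrite (big_ord_cat (fun i => cnorm (a i)) (ltnW Nn)) gerDl big_nat_cond big1//.
by move=> i; rewrite andbT => /andP[/h -> _]; rewrite cnorm0.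
Qed.

Lemma tsum_fin a N : (forall i, (N <= i)%N -> a i = 0) ->
  tsum a = \sum_(i < N) a i.
Proof.
move=> h; apply: tsum_uniq; first exact: asum_fin h.
move=> e e0; exists N => n Nn.
rewrite (big_ord_cat _ Nn) [X in _ + X - _]big1_seq ?addr0 ?subrr ?cnorm0 ?ltW//.
by move=> i /andP[_]; rewrite mem_index_iota => /andP[/h].
Qed.

Lemma uniform_ord (N : nat) (P : nat -> nat -> Prop) :
  (forall i, exists K, forall k, (K <= k)%N -> P k i) ->
  exists K, forall k, (K <= k)%N -> forall i, (i < N)%N -> P k i.
Proof.
move=> h; elim: N => [|N [K hK]]; first by exists 0%N.
have [L hL] := h N; exists (maxn K L) => k; rewrite geq_max => /andP[Kk Lk] i.
by rewrite ltnS leq_eqVlt => /predU1P[->|]; [exact: hL|exact: hK].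
Qed.

(** Dominated convergence for series. The majorant makes the terms beyond [N] cost at most twice e /
    4, and the first [N] terms are each brought below [d], together at most e / 2. The l^1 distance
    is bounded, not only the difference of the sums: this is what gives convergence of power series
    uniformly on closed discs. *)
Lemma tannery (f : nat -> nat -> R[i]) (g : nat -> R[i]) (b : nat -> R)
    (B : R) (K0 : nat) :
  (forall k i, (K0 <= k)%N -> cnorm (f k i) <= b i) ->
  (forall n, \sum_(i < n) b i <= B) ->
  (forall i, ctends (f^~ i) (g i)) ->
  forall e, 0 < e -> exists K, forall k, (K <= k)%N ->
    forall n, \sum_(i < n) cnorm (f k i - g i) <= e.
Proof.
move=> fb bB fg e e0.
have b0 i : 0 <= b i by apply: le_trans (fb K0 i (leqnn _)); exact: cnorm_ge0.
have gb i : cnorm (g i) <= b i.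
  apply: (@ctends_le (fun k => f (K0 + k)%N i)) => [d d0|n].
    have [N hN] := fg i _ d0; exists N => n Nn; apply: hN.
    by rewrite (leq_trans Nn)// leq_addl.
  by apply: fb; rewrite leq_addr.
have e4 : 0 < e / 4 by lra.
have [N hN] := real_tail bB b0 e4.
pose d := e / 2 / N.+1%:R; have d0 : 0 < d by rewrite !divr_gt0.
have [K hK] := @uniform_ord N (fun k i => cnorm (f k i - g i) <= d)
  (fun i => fg i d d0).
exists (maxn K0 K) => k; rewrite geq_max => /andP[K0k /hK h] n.
have hs : forall n, (N <= n)%N -> \sum_(i < n) cnorm (f k i - g i) <= e.
  move=> {}n Nn; rewrite (big_ord_cat (fun i => cnorm (f k i - g i)) Nn).
  have h1 : \sum_(i < N) cnorm (f k i - g i) <= e / 2.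
    apply: (@le_trans _ _ (\sum_(i < N) d)).
      by apply: ler_sum => i _; apply: h.
    rewrite sumr_const card_ord -[leLHS]mulr_natr /d mulrAC ler_pdivrMr//.
    by apply: ler_wpM2l; [lra|rewrite ler_nat].
  have h2 : \sum_(N <= i < n) cnorm (f k i - g i) <= \sum_(N <= i < n) 2 * b i.
    apply: ler_sum => i _; apply: le_trans (cnorm_sub _ _) _.
    by have := fb k i K0k; have := gb i; lra.
  have h3 : \sum_(N <= i < n) b i <= e / 4.
    by have := hN n; rewrite (big_ord_cat b Nn) lerD2l.
  rewrite -mulr_sumr in h2; lra.
have [nN|/ltnW//] := leqP n N; last exact: hs.
apply: le_trans (hs N (leqnn _)).
rewrite [leRHS](big_ord_cat (fun i => cnorm (f k i - g i)) nN) lerDl.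
by apply: sumr_ge0 => i _; exact: cnorm_ge0.
Qed.

Lemma tsum_tannery (f : nat -> nat -> R[i]) (g : nat -> R[i]) (b : nat -> R)
    (B : R) (K0 : nat) :
  (forall k i, (K0 <= k)%N -> cnorm (f k i) <= b i) ->
  (forall n, \sum_(i < n) b i <= B) ->
  (forall i, ctends (f^~ i) (g i)) ->
  ctends (fun k => tsum (f k)) (tsum g).
Proof.
move=> fb bB fg e e0; have [K hK] := tannery fb bB fg e0.
have sf k : (K0 <= k)%N -> asum (f k).
  by move=> kK; apply: (asum_le (fun i => fb k i kK) bB).
have sg : asum g.
  apply: (@asum_le _ b B) => // i.
  apply: (@ctends_le (fun k => f (K0 + k)%N i)) => [d d0|n].
    have [N hN] := fg i _ d0; exists N => n Nn; apply: hN.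
    by rewrite (leq_trans Nn)// leq_addl.
  by apply: fb; rewrite leq_addr.
exists (maxn K0 K) => k; rewrite geq_max => /andP[K0k /hK h].
by rewrite -tsumB//; [exact: tsum_le|exact: sf].
Qed.

Lemma partial_le_tsum (v : nat -> R) (B : R) : (forall i, 0 <= v i) ->
  (forall n, \sum_(i < n) v i <= B) ->
  forall n, \sum_(i < n) v i <= complex.Re (tsum (fun i => (v i)%:C)).
Proof.
move=> v0 vB n; rewrite /tsum /= -(big_mkord xpredT v).
apply: (@nondecreasing_cvgn_le _ (series v)).
  apply/nondecreasing_seqP => k; rewrite !seriesEord /= big_ord_recr /=.
  by rewrite lerDl.
apply: (@cvg_series_dom _ B) => k.
by under eq_bigr do rewrite ger0_norm//.
Qed.

(** Truncating the inner sum at [M] and letting [M] grow is a dominated limit with the absolute row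
    sums [b F] as majorant; what remains is to exchange a finite with an infinite sum. *)
Lemma tsum_exchange (F : nat -> nat -> R[i]) (B : R) :
  (forall N M, \sum_(i < N) \sum_(j < M) cnorm (F i j) <= B) ->
  tsum (fun i => tsum (F i)) = tsum (fun j => tsum (F^~ j)).
Proof.
move=> FB.
have rowB (G : nat -> nat -> R[i]) :
    (forall N M, \sum_(i < N) \sum_(j < M) cnorm (G i j) <= B) ->
    forall i M, \sum_(j < M) cnorm (G i j) <= B.
  move=> GB i M; apply: le_trans (GB i.+1 M); rewrite big_ord_recr /= lerDr.
  by apply: sumr_ge0 => j _; apply: sumr_ge0 => l _; exact: cnorm_ge0.
have FB' N M : \sum_(i < N) \sum_(j < M) cnorm (F j i) <= B.
  by rewrite exchange_big.
have sF i : asum (F i) by exists B => M; exact: rowB.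
have sF' j : asum (F^~ j) by exists B => M; exact: (rowB (fun j i => F i j)).
pose b (G : nat -> nat -> R[i]) i :=
  complex.Re (tsum (fun j => (cnorm (G i j))%:C)).
have bsum (G : nat -> nat -> R[i]) :
    (forall N M, \sum_(i < N) \sum_(j < M) cnorm (G i j) <= B) ->
    forall N, \sum_(i < N) b G i <= B.
  move=> GB N; rewrite -Re_sum -tsum_sum; last first.
    move=> i; exists B => M; apply: le_trans (rowB _ GB i M).
    by apply: ler_sum => j _; rewrite cnorm_real ger0_norm// cnorm_ge0.
  apply: le_trans (ler_norm _) _; apply: le_trans (Re_le_cnorm _) _.
  apply: tsum_le => M; apply: le_trans (GB N M); rewrite [leRHS]exchange_big /=.
  apply: ler_sum => j _; apply: le_trans (cnorm_sum _ _ _) _.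
  by apply: ler_sum => i _; rewrite cnorm_real ger0_norm// cnorm_ge0.
have bpart (G : nat -> nat -> R[i]) :
    (forall N M, \sum_(i < N) \sum_(j < M) cnorm (G i j) <= B) ->
    forall i M, \sum_(j < M) cnorm (G i j) <= b G i.
  move=> GB i M; apply: (@partial_le_tsum (fun j => cnorm (G i j)) B).
    by move=> j; exact: cnorm_ge0.
  exact: rowB.
apply: (@ctends_uniq (fun M => tsum (fun i => \sum_(j < M) F i j))).
  apply: (@tsum_tannery _ _ (b F) B 0%N) => [k i _||i].
  - by apply: le_trans (cnorm_sum _ _ _) _; exact: bpart.
  - exact: bsum.
  - exact: tsum_cvg.
apply: (ctends_ext (u := fun M => \sum_(j < M) tsum (F^~ j))) => [M|].
  by rewrite (@tsum_sum _ _ (fun (j : 'I_M) i => F i j)).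
apply: tsum_cvg; apply: (@asum_le _ (b (fun j i => F i j)) B) => [j|].
  by apply: tsum_le => N; exact: (bpart (fun j i => F i j)).
exact: bsum.
Qed.

(* Entry (n, i) of the lower triangular Toeplitz matrix with symbol a. *)
Definition toep (a : nat -> R[i]) (i n : nat) : R[i] :=
  if (i <= n)%N then a (n - i)%N else 0.

Lemma toep_sum_le (a : nat -> R[i]) (B : R) i N :
  (forall n, \sum_(j < n) cnorm (a j) <= B) ->
  \sum_(n < N) cnorm (toep a i n) <= B.
Proof.
move=> aB; have [Ni|iN] := leqP N i.
  rewrite big1 ?(le_trans _ (aB 0%N)) ?big_ord0// => n _.
  by rewrite /toep leqNgt (leq_trans (ltn_ord n) Ni) cnorm0.
rewrite (big_ord_cat (fun n => cnorm (toep a i n)) (ltnW iN)) big1 ?add0r.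
  rewrite -{1}(add0n i) big_addn big_mkord; apply: le_trans (aB (N - i)%N).
  by apply: ler_sum => j _; rewrite /toep leq_addl addnK.
by move=> n _; rewrite /toep leqNgt ltn_ord cnorm0.
Qed.

Lemma asum_toep a i : asum a -> asum (toep a i).
Proof. by move=> [B aB]; exists B => n; exact: toep_sum_le. Qed.

Lemma tsum_toep a i : asum a -> tsum (toep a i) = tsum a.
Proof.
move=> sa; apply: tsum_uniq; first exact: asum_toep.
move=> e e0; have [N hN] := tsum_cvg sa e0; exists (N + i)%N => n Nn.
have iN : (i <= n)%N by rewrite (leq_trans _ Nn)// leq_addl.
rewrite (big_ord_cat (toep a i) iN) big1 ?add0r; last first.
  by move=> k _; rewrite /toep leqNgt ltn_ord.
rewrite -{1}(add0n i) big_addn big_mkord.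
rewrite (eq_bigr (fun k : 'I__ => a k)); last first.
  by move=> k _; rewrite /toep leq_addl addnK.
by apply: hN; rewrite leq_subRL// addnC.
Qed.

Definition cprod a b (n : nat) : R[i] := \sum_(i < n.+1) a i * b (n - i)%N.

Lemma toep_cprod a b n : \sum_(i < n.+1) a i * toep b i n = cprod a b n.
Proof.
by apply: eq_bigr => i _; rewrite /toep -ltnS ltn_ord.
Qed.

Lemma asum_cprod a b : asum a -> asum b -> asum (cprod a b).
Proof.
move=> [A aA] [B bB]; exists (A * B) => N.
apply: (@le_trans _ _ (\sum_(n < N) \sum_(i < N) cnorm (a i) * cnorm (toep b i n))).
  apply: ler_sum => n _; rewrite -toep_cprod; apply: le_trans (cnorm_sum _ _ _) _.
  under eq_bigr do rewrite cnormM.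
  rewrite [leRHS](big_ord_cat (fun i => cnorm (a i) * cnorm (toep b i n))
    (ltn_ord n)) lerDl.
  by apply: sumr_ge0 => i _; rewrite mulr_ge0// cnorm_ge0.
rewrite exchange_big /=; have B0 : 0 <= B by apply: le_trans (bB 0%N); rewrite big_ord0.
apply: (@le_trans _ _ (\sum_(i < N) cnorm (a i) * B)).
  apply: ler_sum => i _; rewrite -mulr_sumr ler_wpM2l ?cnorm_ge0//.
  exact: toep_sum_le.
by rewrite -mulr_suml ler_wpM2r.
Qed.

(** The array [a i * toep b i n] has row sums [a i * tsum b], since shifting a series does not
    change its sum, and column sums [cprod a b n]; both orders of summation agree. *)
Lemma tsum_cprod a b : asum a -> asum b -> tsum a * tsum b = tsum (cprod a b).
Proof.
move=> sa sb; have [A aA] := sa; have [B bB] := sb.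
transitivity (tsum (fun i => tsum (fun n => a i * toep b i n))).
  rewrite mulrC -tsumZ//; apply: eq_tsum => i.
  by rewrite tsumZ ?tsum_toep 1?mulrC//; exact: asum_toep.
rewrite (@tsum_exchange _ (A * B)) => [|N M].
  apply: eq_tsum => n; rewrite -toep_cprod; apply: tsum_fin => i ni.
  by rewrite /toep leqNgt ni mulr0.
have B0 : 0 <= B by apply: le_trans (bB 0%N); rewrite big_ord0.
apply: (@le_trans _ _ (\sum_(i < N) cnorm (a i) * B)).
  apply: ler_sum => i _; under eq_bigr do rewrite cnormM.
  by rewrite -mulr_sumr ler_wpM2l ?cnorm_ge0//; exact: toep_sum_le.
by rewrite -mulr_suml ler_wpM2r.
Qed.

End ComplexSeries.

(** * The binomial series *)

Section BinomialSeries.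
Context {R : realType}.
Implicit Types (a b al : R) (z : R[i]).

(** The generalized binomial coefficient of [a] over [n]. *)
Definition ch a (n : nat) : R := \prod_(i < n) ((a - i%:R) / i.+1%:R).

Lemma ch0 a : ch a 0 = 1.
Proof. by rewrite /ch big_ord0. Qed.

Lemma chS a n : ch a n.+1 = ch a n * ((a - n%:R) / n.+1%:R).
Proof. by rewrite /ch big_ord_recr. Qed.

Lemma chSM a n : n.+1%:R * ch a n.+1 = (a - n%:R) * ch a n.
Proof. by rewrite chS; field; rewrite nat1r pnatr_eq0. Qed.

(** Induction after multiplication by n + 1 = i + (n + 1 - i): by [chSM] both parts shift down to
    degree n, where the factors a - i and b - (n - i) add up to a + b - n. *)
Lemma ch_vandermonde a b n :
  \sum_(i < n.+1) ch a i * ch b (n - i) = ch (a + b) n.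
Proof.
elim: n => [|n ih]; first by rewrite big_ord_recr big_ord0 /= !ch0 add0r mulr1.
apply: (@mulfI _ n.+1%:R); first by rewrite pnatr_eq0.
rewrite chSM -ih mulr_sumr.
have -> : \sum_(i < n.+2) n.+1%:R * (ch a i * ch b (n.+1 - i)) =
    \sum_(i < n.+2) (i%:R * ch a i) * ch b (n.+1 - i) +
    \sum_(i < n.+2) ch a i * ((n.+1 - i)%:R * ch b (n.+1 - i)).
  rewrite -big_split /=; apply: eq_bigr => i _.
  by rewrite natrB; [ring|rewrite -ltnS].
rewrite big_ord_recl /= !mul0r add0r [X in _ + X]big_ord_recr /= subnn mul0r.
rewrite mulr0 addr0 -big_split mulr_sumr /=; apply: eq_bigr => i _.
rewrite subSS /bump /= add1n chSM subSn; last by rewrite -ltnS.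
rewrite chSM natrB; last by rewrite -ltnS.
ring.
Qed.

Lemma norm_ch_decr a n : `|a| <= 1 -> `|ch a n.+1| <= `|ch a n|.
Proof.
move=> a1; rewrite chS normrM ler_piMr//.
rewrite normrM normfV (ger0_norm (ler0n _ _)) ler_pdivrMr ?ltr0n// mul1r.
by apply: le_trans (ler_normB _ _) _; rewrite (ger0_norm (ler0n _ n)) -natr1 addrC lerD2l.
Qed.

Lemma norm_ch_anti a n k : `|a| <= 1 -> (n <= k)%N -> `|ch a k| <= `|ch a n|.
Proof.
move=> a1 /subnK <-; elim: (k - n)%N => [|i ih]; first by rewrite add0n.
by rewrite addSn; apply: le_trans ih; exact: norm_ch_decr.
Qed.

Lemma norm_ch_le1 a n : `|a| <= 1 -> `|ch a n| <= 1.
Proof. by move=> a1; apply: le_trans (norm_ch_anti a1 (leq0n n)) _; rewrite ch0 normr1. Qed.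

Lemma ch_neg_sign a n : a <= 0 -> 0 <= (-1) ^+ n * ch a n.
Proof.
move=> a0; elim: n => [|n ih]; first by rewrite ch0 expr0 mul1r.
rewrite chS exprS.
have -> : -1 * (-1) ^+ n * (ch a n * ((a - n%:R) / n.+1%:R)) =
  ((-1) ^+ n * ch a n) * ((n%:R - a) / n.+1%:R) by ring.
rewrite mulr_ge0// divr_ge0// subr_ge0.
by apply: le_trans a0 _.
Qed.

Lemma ch_sign al n : 0 <= al <= 1 -> 0 <= (-1) ^+ n * ch al n.+1.
Proof.
move=> /andP[al0 al1]; elim: n => [|n ih].
  by rewrite chS ch0 expr0 !mul1r subr0 divr_ge0.
rewrite chS exprS.
have -> : -1 * (-1) ^+ n * (ch al n.+1 * ((al - n.+1%:R) / n.+2%:R)) =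
  ((-1) ^+ n * ch al n.+1) * ((n.+1%:R - al) / n.+2%:R) by ring.
rewrite mulr_ge0// divr_ge0// subr_ge0.
by apply: le_trans al1 _; rewrite ler1n.
Qed.

Lemma norm_ch al n : 0 <= al <= 1 -> `|ch al n.+1| = (-1) ^+ n * ch al n.+1.
Proof.
move=> h; rewrite -[RHS]ger0_norm ?ch_sign// normrM normrX normrN normr1 expr1n.
by rewrite mul1r.
Qed.

(** Pascal's rule, itself Vandermonde's identity with [1] as one exponent, makes the alternating
    sums telescope. *)
Lemma ch_alt_sum a n : \sum_(i < n.+1) (-1) ^+ i * ch a i = (-1) ^+ n * ch (a - 1) n.
Proof.
elim: n => [|n ih]; first by rewrite big_ord_recr big_ord0 /= !ch0 !expr0 add0r.
rewrite big_ord_recr /= ih exprS.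
have -> : ch a n.+1 = ch (a - 1) n + ch (a - 1) n.+1.
  have := ch_vandermonde 1 (a - 1) n.+1.
  rewrite [1 + _]addrC subrK => <-; rewrite !big_ord_recl /= big1 => [|i _].
    by rewrite /bump /= add1n subSS !subn0 (chS 1 0) !ch0; field.
  rewrite /bump /= !add1n.
  suff -> : ch 1 i.+2 = 0 by rewrite mul0r.
  elim: (nat_of_ord i) => [|k ihk]; first by rewrite !chS; ring.
  by rewrite chS ihk mul0r.
ring.
Qed.

(** From index 1 on the coefficients alternate in sign, so the absolute values sum to 1 plus (1
    minus a nonnegative alternating sum). The resulting convergence on the closed unit disc lets the
    outer limit include the circle |u| = rho^2. *)
Lemma sum_norm_ch al n : 0 <= al <= 1 -> \sum_(i < n) `|ch al i| <= 2.
Proof.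
move=> h; case: n => [|n]; first by rewrite big_ord0.
rewrite big_ord_recl ch0 normr1 /=.
have := ch_alt_sum al n; rewrite big_ord_recl /= ch0 expr0 mul1r.
rewrite (eq_bigr (fun i : 'I_n => - `|ch al i.+1|)) => [|i _]; last first.
  by rewrite norm_ch// /bump /= add1n exprS; ring.
rewrite sumrN => e.
have : 0 <= (-1) ^+ n * ch (al - 1) n.
  by apply: ch_neg_sign; have /andP[] := h; lra.
rewrite (eq_bigr (fun i : 'I_n => `|ch al i.+1|)) => [|i _]; last first.
  by rewrite /bump /= add1n.
lra.
Qed.

Definition bterm a z (n : nat) : R[i] := (ch a n)%:C * z ^+ n.

(* The binomial series of (1 + z)^a; a junk value if it diverges. *)
Definition bpow a z : R[i] := tsum (bterm a z).

Lemma cnorm_bterm a z n : cnorm (bterm a z n) = `|ch a n| * cnorm z ^+ n.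
Proof. by rewrite cnormM cnorm_real cnormX. Qed.

Lemma cprod_bterm a b z n : cprod (bterm a z) (bterm b z) n = bterm (a + b) z n.
Proof.
rewrite /cprod /bterm -ch_vandermonde rmorph_sum mulr_suml; apply: eq_bigr => i _.
have -> : z ^+ n = z ^+ i * z ^+ (n - i) by rewrite -exprD subnKC// -ltnS.
rewrite rmorphM /=; ring.
Qed.

Lemma asum_btermD a b z : asum (bterm a z) -> asum (bterm b z) ->
  asum (bterm (a + b) z).
Proof.
move=> sa sb; rewrite (_ : bterm _ _ = cprod (bterm a z) (bterm b z)).
  exact: asum_cprod.
by apply/funext => n; rewrite cprod_bterm.
Qed.

Lemma bpowD a b z : asum (bterm a z) -> asum (bterm b z) ->
  bpow (a + b) z = bpow a z * bpow b z.
Proof.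
by move=> sa sb; rewrite /bpow tsum_cprod//; apply: eq_tsum => n; rewrite cprod_bterm.
Qed.

Lemma ch0S n : ch 0 n.+1 = 0.
Proof. by elim: n => [|n ih]; rewrite chS ?ih ?mul0r// subrr mul0r mulr0. Qed.

Lemma ch1SS n : ch 1 n.+2 = 0.
Proof. by elim: n => [|n ih]; rewrite chS ?ih ?mul0r// subrr mul0r mulr0. Qed.

Lemma asum_bterm0 z : asum (bterm 0 z).
Proof. by apply: (@asum_fin _ _ 1) => -[//|n _]; rewrite /bterm ch0S mul0r. Qed.

Lemma bpow0 z : bpow 0 z = 1.
Proof.
rewrite /bpow (@tsum_fin _ _ 1); last by move=> [//|n _]; rewrite /bterm ch0S mul0r.
by rewrite big_ord_recl big_ord0 /bterm ch0 mulr1 addr0.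
Qed.

Lemma asum_bterm1 z : asum (bterm 1 z).
Proof. by apply: (@asum_fin _ _ 2) => -[|[|n]]// _; rewrite /bterm ch1SS mul0r. Qed.

Lemma bpow1 z : bpow 1 z = 1 + z.
Proof.
rewrite /bpow (@tsum_fin _ _ 2).
  rewrite !big_ord_recl big_ord0 /bterm /= /bump /= !chS ch0 !subr0 divr1 !mul1r.
  by rewrite expr0 expr1 addr0.
by move=> [|[|n]]// _; rewrite /bterm ch1SS mul0r.
Qed.

Lemma bpow_mulrn a z n : asum (bterm a z) ->
  asum (bterm (n%:R * a) z) /\ bpow (n%:R * a) z = bpow a z ^+ n.
Proof.
move=> sa; elim: n => [|n [ih1 ih2]].
  by rewrite mul0r expr0 bpow0; split => //; exact: asum_bterm0.
rewrite -natr1 mulrDl mul1r; split; first exact: asum_btermD.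
by rewrite bpowD// ih2 exprSr.
Qed.

(** The link between series and powers: when the exponent has denominator [m], the m-th power of the
    series is a polynomial, which determines its value up to an m-th root of unity. *)
Lemma bpow_root a z m n : asum (bterm a z) -> m%:R * a = n%:R ->
  bpow a z ^+ m = (1 + z) ^+ n.
Proof.
move=> sa man; have [_ <-] := bpow_mulrn m sa.
have [_] := bpow_mulrn n (asum_bterm1 z).
by rewrite mulr1 bpow1 man.
Qed.

Lemma bpowN a z : asum (bterm a z) -> asum (bterm (- a) z) ->
  bpow a z * bpow (- a) z = 1.
Proof. by move=> sa sb; rewrite -bpowD// subrr bpow0. Qed.

Lemma sum_geometric (x : R) n : 0 <= x < 1 -> \sum_(i < n) x ^+ i <= (1 - x)^-1.
Proof.
move=> /andP[x0 x1]; have x1' : 0 < 1 - x by lra.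
rewrite -[(1 - x)^-1]mul1r ler_pdivlMr// mulrC.
rewrite (_ : (1 - x) * _ = - ((x - 1) * \sum_(i < n) x ^+ i)); last by ring.
by rewrite -subrX1; have := exprn_ge0 n x0; lra.
Qed.

Lemma asum_bterm_lt1 a z : `|a| <= 1 -> cnorm z < 1 -> asum (bterm a z).
Proof.
move=> a1 z1; apply: (@asum_le _ _ (fun n => cnorm z ^+ n) (1 - cnorm z)^-1).
  by move=> n; rewrite cnorm_bterm ler_piMl ?exprn_ge0 ?cnorm_ge0 ?norm_ch_le1.
by move=> n; rewrite sum_geometric// cnorm_ge0.
Qed.

Lemma asum_bterm_le1 al z : 0 <= al <= 1 -> cnorm z <= 1 -> asum (bterm al z).
Proof.
move=> a1 z1; apply: (@asum_le _ _ (fun n => `|ch al n|) 2).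
  by move=> n; rewrite cnorm_bterm ler_piMr// exprn_ile1// cnorm_ge0.
by move=> n; rewrite sum_norm_ch.
Qed.

Lemma cnorm_subX_le (z w : R[i]) n : cnorm z <= 1 -> cnorm w <= 1 ->
  cnorm (z ^+ n - w ^+ n) <= n%:R * cnorm (z - w).
Proof.
move=> z1 w1; elim: n => [|n ih]; first by rewrite !expr0 subrr cnorm0 mul0r.
rewrite (_ : _ - _ = z * (z ^+ n - w ^+ n) + (z - w) * w ^+ n); last first.
  by rewrite !exprS; ring.
apply: le_trans (cnormD _ _) _; rewrite !cnormM cnormX -natr1 mulrDl mul1r lerD//.
  by apply: le_trans ih; rewrite ler_piMl ?cnorm_ge0.
by rewrite ler_piMr ?cnorm_ge0// exprn_ile1// cnorm_ge0.
Qed.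

(** On the unit disc z^n is Lipschitz with constant n, which settles the first [N] terms; the others
    are dominated by the summable |ch al n|, whatever the point. *)
Lemma bpow_unif_continuous al : 0 <= al <= 1 -> forall e : R, 0 < e ->
  exists2 d : R, 0 < d & forall z w, cnorm z <= 1 -> cnorm w <= 1 ->
    cnorm (z - w) <= d -> cnorm (bpow al z - bpow al w) <= e.
Proof.
move=> hal e e0; have e4 : 0 < e / 4 by lra.
have [N hN] := real_tail (fun n => sum_norm_ch n hal)
  (fun i => normr_ge0 (ch al i)) e4.
(* There are [N] terms, each with Lipschitz constant at most [N]: hence the square. *)
pose d := e / 2 / (N.+1%:R ^+ 2).
have d0 : 0 < d by rewrite divr_gt0 ?exprn_gt0//; lra.
exists d => // z w z1 w1 zw.
have sz := asum_bterm_le1 hal z1; have sw := asum_bterm_le1 hal w1.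
rewrite /bpow -tsumB//; apply: tsum_le => n.
have key n' : (N <= n')%N ->
    \sum_(i < n') cnorm (bterm al z i - bterm al w i) <= e.
  move=> Nn; rewrite (big_ord_cat (fun i => cnorm (bterm al z i - bterm al w i)) Nn).
  have h1 : \sum_(i < N) cnorm (bterm al z i - bterm al w i) <= e / 2.
    apply: (@le_trans _ _ (\sum_(i < N) N%:R * d)).
      apply: ler_sum => i _; rewrite /bterm -mulrBr cnormM cnorm_real.
      apply: (@le_trans _ _ (1 * (N%:R * d))); last by rewrite mul1r.
      apply: ler_pM; rewrite ?cnorm_ge0//.
        by apply: norm_ch_le1; have /andP[] := hal; move=> *; rewrite ger0_norm.
      apply: le_trans (cnorm_subX_le _ _ _) _ => //.
      apply: ler_pM; rewrite ?cnorm_ge0 ?ler_nat//; exact: ltnW.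
    rewrite sumr_const card_ord -[leLHS]mulr_natr /d mulrAC mulrA.
    rewrite ler_pdivrMr ?exprn_gt0//.
    rewrite mulrC.
    by apply: ler_wpM2l; [lra|rewrite -expr2 ler_pXn2r ?nnegrE// ler_nat].
  have h2 : \sum_(N <= i < n') cnorm (bterm al z i - bterm al w i) <=
      \sum_(N <= i < n') 2 * `|ch al i|.
    apply: ler_sum => i _; apply: le_trans (cnorm_sub _ _) _.
    rewrite !cnorm_bterm.
    have k1 : `|ch al i| * cnorm z ^+ i <= `|ch al i|.
      by rewrite ler_piMr// exprn_ile1// cnorm_ge0.
    have k2 : `|ch al i| * cnorm w ^+ i <= `|ch al i|.
      by rewrite ler_piMr// exprn_ile1// cnorm_ge0.
    lra.
  have h3 := hN n'; rewrite (big_ord_cat (fun i => `|ch al i|) Nn) lerD2l in h3.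
  rewrite -mulr_sumr in h2; lra.
have [nN|/ltnW//] := leqP n N; last exact: key.
apply: le_trans (key N (leqnn _)).
rewrite [leRHS](big_ord_cat (fun i => cnorm (bterm al z i - bterm al w i)) nN).
by rewrite lerDl; apply: sumr_ge0 => i _; exact: cnorm_ge0.
Qed.

Lemma bpow_at0 a : bpow a 0 = 1.
Proof.
rewrite /bpow (@tsum_fin _ _ 1).
  by rewrite big_ord_recl big_ord0 /bterm ch0 mulr1 addr0.
by move=> [//|n _]; rewrite /bterm exprS mul0r mulr0.
Qed.

End BinomialSeries.

(** * Gauss' product for Gamma and the sine product *)

Section GammaFunction.
Context {R : realType}.
Local Notation leb := (@lebesgue_measure R).

Let gint (x t : R) : R := t `^ (x - 1) * expR (- t).

Let Ge (x : R) : \bar R := (\int[leb]_(t in `]0%R, +oo[) (gint x t)%:E)%E.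

(** A compact exhaustion of the half line, on which the fundamental theorem of calculus applies
    despite the singularity at 0. With n + 2 the intervals are nondegenerate from n = 0 on. *)
Let box (n : nat) : set R := `[n.+2%:R^-1, n.+2%:R]%classic.

Let gint_ge0 x t : 0 <= gint x t.
Proof. by rewrite mulr_ge0 ?powR_ge0 ?expR_ge0. Qed.

Let prim (x t : R) : R := t `^ x * expR (- t).

Let prim_der (x t : R) : 0 < t ->
  is_derive t 1 (prim x) (x * gint x t - gint (x + 1) t).
Proof.
move=> t0; have h1 : is_derive t 1 (fun t : R => expR (- t)) (- expR (- t)).
  have h := is_derive1_comp (is_derive_expR (- t)) (is_deriveN (is_derive_id t (1 : R))).
  by apply: (is_derive_eq h); rewrite /GRing.scale /= mulrN1.
have := is_deriveM (is_derive1_powR x t0) h1; rewrite /prim => h.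
apply: (is_derive_eq h); rewrite /GRing.scale /= /gint addrK; ring.
Qed.

Let gint_cont x t : 0 < t -> {for t, continuous (gint x)}.
Proof.
move=> t0; have -> : gint x = prim (x - 1) by [].
by apply/differentiable_continuous/derivable1_diffP; have h := prim_der (x - 1) t0; exact: ex_derive.
Qed.

Let box_gt0 n t : box n t -> 0 < t.
Proof. by rewrite /box /= in_itv /= => /andP[+ _]; apply: lt_le_trans; rewrite invr_gt0. Qed.

Let box_cont x n : {within box n, continuous (gint x)}.
Proof.
apply: continuous_in_subspaceT => t; rewrite inE => /box_gt0; exact: gint_cont.
Qed.

Let mbox n : measurable (box n). Proof. exact: measurable_itv. Qed.

Let box_int x n : leb.-integrable (box n) (EFin \o gint x).
Proof. by apply: continuous_compact_integrable; [exact: segment_compact|exact: box_cont]. Qed.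

Let A x n : R := \int[leb]_(t in box n) gint x t.

(** Integration by parts on a box: the derivative of [prim x] is [x * gint x - gint (x + 1)]. *)
Let box_rec x n : A (x + 1) n = x * A x n - (prim x n.+2%:R - prim x n.+2%:R^-1).
Proof.
have n1 : n.+2%:R^-1 < n.+2%:R :> R.
  apply: (@lt_trans _ _ 1); last by rewrite ltr1n.
  by rewrite invf_lt1 ?ltr1n ?ltr0n.
have nb : 0 < n.+2%:R^-1 :> R by rewrite invr_gt0.
have prc t : 0 < t -> {for t, continuous (prim x)}.
  by move=> t0; apply/differentiable_continuous/derivable1_diffP; have h := prim_der x t0; exact: ex_derive.
have : \int[leb]_(t in box n) (x * gint x t - gint (x + 1) t) =
    prim x n.+2%:R - prim x n.+2%:R^-1.
  rewrite /Rintegral (@continuous_FTC2 _ _ (prim x))//.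
  - have -> : (fun t => x * gint x t - gint (x + 1) t) =
        (fun t => x * gint x t) \- gint (x + 1) by [].
    move=> t; apply: cvgB; last exact: box_cont.
    by apply: cvgM; [exact: cvg_cst|exact: box_cont].
  - split.
    + move=> t; rewrite in_itv /= => /andP[t1 _].
      have h := prim_der x (lt_trans nb t1); exact: ex_derive.
    + by apply: cvg_at_right_filter; exact: prc.
    + by apply: cvg_at_left_filter; apply: prc.
  - move=> t; rewrite in_itv /= => /andP[t1 _]; have h := prim_der x (lt_trans nb t1).
    by rewrite derive1E; exact: derive_val.
have iZ : leb.-integrable (box n) (EFin \o (fun t => x * gint x t)).
  apply: continuous_compact_integrable; first exact: segment_compact.
  by move=> t; apply: cvgM; [exact: cvg_cst|exact: box_cont].
rewrite RintegralB//.
rewrite RintegralZl//.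
    by move=> <-; rewrite /A; ring.
  exact: measurable_itv.
exact: measurable_itv.
Qed.

Let cupbox : \bigcup_n box n = `]0%R, +oo[%classic.
Proof.
apply/seteqP; split => t.
  by move=> [n _ /box_gt0 t0]; rewrite /= in_itv /= t0.
rewrite /= in_itv /= andbT => t0.
pose N := maxn (Num.trunc t) (Num.trunc t^-1); exists N => //.
rewrite /box /= in_itv /=; apply/andP; split.
  rewrite -[leRHS]invrK lef_pV2 ?posrE ?invr_gt0//.
  apply: ltW; apply: lt_le_trans (truncnS_gt _) _; rewrite ler_nat.
  by rewrite ltnS leqW// leq_maxr.
apply: ltW; apply: lt_le_trans (truncnS_gt _) _; rewrite ler_nat.
by rewrite ltnS leqW// leq_maxl.
Qed.

Let gint_meas x : measurable_fun (`]0%R, +oo[%classic : set R) (gint x).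
Proof.
apply: open_continuous_measurable_fun; first exact: interval_open.
by move=> t; rewrite inE /= in_itv /= andbT; exact: gint_cont.
Qed.

Let A_cvg x : ((A x n)%:E @[n --> \oo] --> Ge x)%E.
Proof.
rewrite /Ge -cupbox.
have -> : (fun n => (A x n)%:E) = (fun n => (\int[leb]_(t in box n) (gint x t)%:E)%E).
  by apply/funext => n; rewrite /A /Rintegral fineK//; by apply: integrable_fin_num; [exact: mbox|exact: box_int].
apply: ge0_nondecreasing_set_cvg_integral => //.
- move=> i j ij; rewrite subsetEset => t; rewrite /box /= !in_itv /= => /andP[h1 h2].
  apply/andP; split.
    by apply: le_trans h1; rewrite lef_pV2 ?posrE// ler_nat.
  by apply: le_trans h2 _; rewrite ler_nat.
- move=> n; apply/measurable_EFinP; apply: measurable_funS (gint_meas x) => //.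
  by move=> t /box_gt0 t0; rewrite /= in_itv /= t0.
- by move=> n t _; rewrite lee_fin.
Qed.

Let prim_inf x : prim x n.+2%:R @[n --> \oo] --> (0 : R).
Proof.
pose N := (Num.trunc x).+1; have xN : x <= N%:R by exact: ltW (truncnS_gt _).
have key n : 0 <= prim x n.+2%:R <= N.+1`!%:R * n.+2%:R^-1.
  rewrite /prim mulr_ge0 ?powR_ge0 ?expR_ge0//=.
  have h := @expR_ge1Dxn R n.+2%:R N (ler0n _ _).
  have f0 : 0 < N.+1`!%:R :> R by rewrite ltr0n fact_gt0.
  have n0 : 0 < n.+2%:R :> R by [].
  have h2 : n.+2%:R `^ x <= n.+2%:R ^+ N :> R.
    by rewrite -powR_mulrn//; apply: ler_powR => //; rewrite ler1n.
  rewrite expRN ler_pdivrMr ?expR_gt0// mulrAC ler_pdivlMr//.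
  apply: le_trans (ler_wpM2r (ltW n0) h2) _; rewrite -exprSr.
  rewrite -ler_pdivrMl// mulrC; apply: le_trans h; by rewrite lerDr.
apply: (@squeeze_cvgr _ _ _ _ (fun=> 0) (fun n => N.+1`!%:R * n.+2%:R^-1)).
- by apply: nearW => n; exact: key.
- exact: cvg_cst.
- rewrite -(mulr0 N.+1`!%:R); apply: cvgMr.
  by have := @cvg_harmonic R; rewrite -cvg_shiftS; apply: cvg_trans.
Qed.

Let prim_zero (x : R) : 0 < x -> prim x n.+2%:R^-1 @[n --> \oo] --> (0 : R).
Proof.
move=> x0; have h : (n.+2%:R^-1 : R) `^ x @[n --> \oo] --> (0 : R).
  have h0 : n.+2%:R^-1 @[n --> \oo] --> (0 : R).
    by have := @cvg_harmonic R; rewrite -cvg_shiftS; apply: cvg_trans.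
  move/cvgrPdist_le : (powR_cvg0 x0) => hp; apply/cvgrPdist_le => e e0.
  have := hp e e0; rewrite near_withinE nearE => -[d /= d0 hd].
  move/cvgrPdist_lt : h0 => /(_ d d0); apply: filterS => n hn.
  by apply: hd => //=; rewrite invr_gt0.
apply: (@squeeze_cvgr _ _ _ _ (fun=> 0) (fun n => (n.+2%:R^-1 : R) `^ x)) h => //.
  apply: nearW => n; rewrite /prim mulr_ge0 ?powR_ge0 ?expR_ge0//=.
  by rewrite ler_piMr ?powR_ge0// -expR0 ler_expR oppr_le0 invr_ge0.
exact: cvg_cst.
Qed.

(** The functional equation is proved in the extended reals, where the monotone limits over the
    boxes exist before finiteness is known. *)
Let Ge_rec (x : R) : 0 < x -> (Ge (x + 1) = x%:E * Ge x)%E.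
Proof.
move=> x0; have h1 := @A_cvg (x + 1).
have h2 : (x%:E * (A x n)%:E - (prim x n.+2%:R - prim x n.+2%:R^-1)%:E @[n --> \oo]
    --> x%:E * Ge x - 0%:E)%E.
  apply: cvgeB; first by rewrite fin_num_adde_defl.
    by apply: cvgeZl => //; exact: A_cvg.
  apply: cvg_EFin; first by near=> n.
  by have h := cvgB (prim_inf x) (prim_zero x0); rewrite subr0 in h; exact: h.
rewrite sube0 in h2; apply: cvg_unique h1 _ => //.
suff <- : (fun n => x%:E * (A x n)%:E - (prim x n.+2%:R - prim x n.+2%:R^-1)%:E)%E =
  (fun n => (A (x + 1) n)%:E) by exact: h2.
by apply/funext => n; rewrite box_rec.
Unshelve. all: by end_near. Qed.

Let Ge_ge0 x : (0 <= Ge x)%E.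
Proof. by apply: integral_ge0 => t _; rewrite lee_fin. Qed.

Let Ge1 : Ge 1 = 1%E.
Proof.
have h : (\int[leb]_(t in `[0%R, +oo[) (expR (- t))%:E = 0%:E - (- expR (- 0))%:E)%E.
  apply: (@ge0_continuous_FTC2y _ _ (fun t => - expR (- t))) => //.
  - apply: continuous_subspaceT => t; apply: continuous_comp; first exact: opp_continuous.
    exact: continuous_expR.
  - by rewrite -oppr0; apply: cvgN; exact: cvgr_expR.
  - apply: cvgN; apply: cvg_at_right_filter; apply: continuous_comp; first exact: opp_continuous.
    exact: continuous_expR.
  - move=> t _; have h1 := is_derive1_comp (is_derive_expR (- t)) (is_deriveN (is_derive_id t (1 : R))).
    have h2 := is_deriveN h1.
    by rewrite derive1E; rewrite (derive_val (is_derive := h2)) /GRing.scale /= mulrN1 opprK.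
rewrite oppr0 expR0 in h.
rewrite -integral_itv_obnd_cbnd in h; last first.
  apply/measurable_EFinP; apply: open_continuous_measurable_fun; first exact: interval_open.
  by move=> t _; apply: continuous_comp; [exact: opp_continuous|exact: continuous_expR].
transitivity (\int[leb]_(t in `]0%R, +oo[) (expR (- t))%:E)%E.
  apply: eq_integral => t; rewrite inE /= in_itv /= andbT => t0.
  by rewrite /gint subrr powRr0 mul1r.
by rewrite h -EFinN opprK add0e.
Qed.

Let Ge_nat n : Ge n.+1%:R = n`!%:R%:E.
Proof.
elim: n => [|n ih]; first exact: Ge1.
by rewrite -natr1 Ge_rec// ih -EFinM factS natrM.
Qed.

(** t^(x - 1) is at most 1 for t <= 1 and at most t^N for t >= 1; the integrals of these two
    majorants are factorials. *)
Let Ge_fin_ge1 (x : R) : 1 <= x -> (Ge x < +oo)%E.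
Proof.
move=> x1; pose N := (Num.trunc x).+1; have xN : x <= N.+1%:R.
  by apply: le_trans (ltW (truncnS_gt _)) _; rewrite ler_nat.
have key : (Ge x <= Ge 1 + Ge N.+1%:R)%E.
  rewrite /Ge -ge0_integralD//=.
  - apply: ge0_le_integral => //.
    + by move=> t _; rewrite lee_fin.
    + by apply/measurable_EFinP; exact: gint_meas.
    + by apply/measurable_EFinP; apply: measurable_funD; exact: gint_meas.
    + move=> t; rewrite /= in_itv /= andbT => t0; rewrite -EFinD lee_fin -mulrDl.
      apply: ler_wpM2r; first exact: expR_ge0.
      rewrite subrr powRr0; have [t1|t1] := leP t 1.
        apply: (@le_trans _ _ 1); last by rewrite lerDl powR_ge0.
        apply: (@le_trans _ _ (1 `^ (x - 1))); last by rewrite powR1.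
        by apply: ge0_ler_powR; rewrite ?nnegrE ?subr_ge0 ?(ltW t0).
      apply: (@le_trans _ _ (t `^ (N.+1%:R - 1))); last by rewrite lerDr.
      by apply: ler_powR; [exact: ltW|rewrite lerD2r].
  - by move=> t _; rewrite lee_fin.
  - by apply/measurable_EFinP; exact: gint_meas.
  - by move=> t _; rewrite lee_fin.
  - by apply/measurable_EFinP; exact: gint_meas.
by apply: le_lt_trans key _; rewrite Ge1 Ge_nat -EFinD ltry.
Qed.

(** The functional equation carries finiteness down from x + 1 >= 1, which takes care of the
    singularity at 0 when x < 1. *)
Let Ge_fin (x : R) : 0 < x -> Ge x \is a fin_num.
Proof.
move=> x0; rewrite ge0_fin_numE//.
have : (Ge (x + 1) < +oo)%E by apply: Ge_fin_ge1; rewrite lerDr ltW.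
rewrite Ge_rec//; case: (Ge x) (Ge_ge0 x) => [y|//|//] _; first by move=> _; rewrite ltry.
by rewrite gt0_muley ?lte_fin.
Qed.

Let GammaE x : Gamma x = fine (Ge x). Proof. by []. Qed.

Lemma GammaS (x : R) : 0 < x -> Gamma (x + 1) = x * Gamma x.
Proof. by move=> x0; rewrite !GammaE Ge_rec// fineM// Ge_fin. Qed.

Lemma Gamma_nat n : Gamma n.+1%:R = n`!%:R :> R.
Proof. by rewrite GammaE Ge_nat. Qed.

Let Gamma_int (x : R) : 0 < x -> leb.-integrable `]0%R, +oo[%classic (EFin \o gint x).
Proof.
move=> x0; apply/integrableP; split; first by apply/measurable_EFinP; exact: gint_meas.
under eq_integral do rewrite /= ger0_norm//.
by have := Ge_fin x0; rewrite ge0_fin_numE.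
Qed.

(* Young's inequality [t^b <= 1 - b + b t], applied to [t / x]. *)
Lemma Gamma_interp (x b : R) : 0 < x -> 0 <= b <= 1 ->
  Gamma (x + b) <= x `^ b * Gamma x.
Proof.
move=> x0 /andP[b0 b1].
have young (t : R) : 0 < t -> t `^ b <= 1 - b + b * t.
  move=> t0; have [->|bn0] := eqVneq b 0; first by rewrite powRr0 subr0 mul0r addr0.
  have [->|bn1] := eqVneq b 1; first by rewrite powRr1 ?subrr ?add0r ?mul1r// ltW.
  have bp : 0 < b by rewrite lt_neqAle eq_sym bn0.
  have bp1 : 0 < 1 - b by rewrite subr_gt0 lt_neqAle bn1.
  have := @conjugate_powR R (t `^ b) 1 b^-1 (1 - b)^-1 (powR_ge0 _ _) ler01.
  rewrite !invr_gt0 !invrK mulr1 powR1 -powRrM divff// powRr1 ?(ltW t0)//.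
  rewrite mul1r [t * b]mulrC [b * t + _]addrC => h.
  by apply: h => //; rewrite addrC subrK.
have -> : x `^ b * Gamma x = x `^ b * (1 - b) * Gamma x + x `^ b * b / x * Gamma (x + 1).
  by rewrite GammaS//; field; rewrite gt_eqF.
have x10 : 0 < x + 1 by rewrite addr_gt0.
have xb0 : 0 < x + b by rewrite ltr_pwDl.
have iZ c y : 0 < y -> leb.-integrable `]0%R, +oo[%classic (EFin \o (fun t => c * gint y t)).
  move=> y0; have := @integrableZl _ _ R leb _ (measurable_itv _) c _ (Gamma_int y0).
  by congr (_.-integrable _ _).
rewrite /Gamma -!RintegralZl//; try exact: Gamma_int.
rewrite -RintegralD//; try exact: iZ.
apply: le_Rintegral => //; first exact: Gamma_int.
  suff : leb.-integrable `]0%R, +oo[%classic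
    ((EFin \o (fun t => (x `^ b * (1 - b) * gint x t)%R)) \+
     (EFin \o (fun t => (x `^ b * b / x * gint (x + 1) t)%R)))%E by [].
  by apply: integrableD => //; exact: iZ.
move=> t; rewrite /= in_itv /= andbT => t0.
have tx : t `^ b <= x `^ b * (1 - b + b * (t / x)).
  rewrite -{1}[t](@divfK _ x) ?gt_eqF// mulrC powRM ?divr_ge0 ?(ltW x0) ?(ltW t0)//.
  by apply: ler_wpM2l; [exact: powR_ge0|apply: young; rewrite divr_gt0].
have tE y c : t `^ (y + c - 1) = t `^ (y - 1) * t `^ c.
  by rewrite -powRD; [congr (_ `^ _); ring|rewrite (gt_eqF t0) implybT].
have -> : x `^ b * (1 - b) * (t `^ (x - 1) * expR (- t)) +
    x `^ b * b / x * (t `^ (x + 1 - 1) * expR (- t)) =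
    (t `^ (x - 1) * expR (- t)) * (x `^ b * (1 - b + b * (t / x))).
  by rewrite tE powRr1 ?ltW//; ring.
rewrite tE mulrAC; apply: ler_wpM2l => //.
by rewrite mulr_ge0 ?powR_ge0 ?expR_ge0.
Qed.

Lemma Gamma_prod (x : R) n : 0 < x ->
  Gamma (x + n%:R) = Gamma x * \prod_(i < n) (x + i%:R).
Proof.
move=> x0; elim: n => [|n ih]; first by rewrite big_ord0 addr0 mulr1.
rewrite -natr1 addrA GammaS ?ltr_wpDr// ih big_ord_recr /=; ring.
Qed.

(* Gauss' product, by squeezing [Gamma (k + al)] with [Gamma_interp]. *)
Lemma gauss_product (al : R) : 0 < al < 1 ->
  (k.+1%:R `^ al / \prod_(i < k) (1 + al / i.+1%:R)) @[k --> \oo] --> Gamma (1 + al).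
Proof.
move=> /andP[al0 al1]; have a10 : 0 < 1 + al by rewrite addr_gt0.
pose u k := \prod_(i < k) (1 + al / i.+1%:R) / k.+1%:R `^ al.
have prod_gt0 k : 0 < \prod_(i < k) (1 + al / i.+1%:R).
  by apply: prodr_gt0 => i _; rewrite ltr_pwDl// divr_ge0// ltW.
have pw k : 0 < k.+1%:R `^ al by rewrite powR_gt0.
have Gk k : Gamma (k.+1%:R + al) = Gamma (1 + al) * \prod_(i < k) (1 + al / i.+1%:R) * k`!%:R.
  have -> : k.+1%:R + al = (1 + al) + k%:R by rewrite -natr1; ring.
  rewrite Gamma_prod// -mulrA; congr (_ * _).
  elim: k => [|k ih]; first by rewrite !big_ord0 mulr1.
  rewrite !big_ord_recr /= ih factS natrM.
  have n0 : k.+1%:R != 0 :> R by rewrite pnatr_eq0.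
  rewrite -[1 + al + k%:R]addrAC -natr1 in n0 *.
  rewrite [1 + _]addrC; move: n0 (\prod_(i < k) _) (k`!%:R : R) => n0 p q; by field.
have ub k : Gamma (1 + al) * u k <= 1.
  have := @Gamma_interp k.+1%:R al; rewrite Gk Gamma_nat (ltW al0) (ltW al1).
  have f0 : 0 < k`!%:R :> R by rewrite ltr0n fact_gt0.
  by move=> /(_ (ltr0Sn _ _) isT); rewrite ler_pM2r// /u mulrA ler_pdivrMr// mul1r.
(* The second use of [Gamma_interp], from k + 1 + al up to k + 2: it bounds (k + 1)! by (k + 1 +
   al)^(1 - al) Gamma (k + 1 + al), which is the lower half of the squeeze. *)
have lb k : k.+1%:R / (k.+1%:R + al) <= Gamma (1 + al) * u k.
  have ka0 : 0 < k.+1%:R + al by rewrite addr_gt0.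
  have := @Gamma_interp (k.+1%:R + al) (1 - al) ka0.
  rewrite subr_ge0 (ltW al1) gerBl (ltW al0) => /(_ isT).
  have -> : k.+1%:R + al + (1 - al) = k.+2%:R by rewrite -[k.+2%:R]natr1; ring.
  rewrite Gamma_nat Gk factS natrM mulrA.
  have f0 : 0 < k`!%:R :> R by rewrite ltr0n fact_gt0.
  rewrite ler_pM2r// => h.
  rewrite /u mulrA ler_pdivlMr// mulrAC ler_pdivrMr//.
  apply: le_trans (ler_wpM2r (ltW (pw k)) h) _.
  rewrite mulrAC mulrC; apply: ler_wpM2l.
    rewrite mulr_ge0 ?(ltW (prod_gt0 k))// GammaE fine_ge0//.
  apply: (@le_trans _ _ ((k.+1%:R + al) `^ (1 - al) * (k.+1%:R + al) `^ al)).
    apply: ler_wpM2l; first exact: powR_ge0.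
    by apply: ge0_ler_powR; rewrite ?nnegrE ?ltW// ltrDl.
  rewrite -powRD; last by rewrite (gt_eqF ka0) implybT.
  by rewrite subrK powRr1// ltW.
have lim1 : Gamma (1 + al) * u k @[k --> \oo] --> (1 : R).
  apply: (@squeeze_cvgr _ _ _ _ (fun k => 1 - al * k.+1%:R^-1) (fun=> 1)).
  - apply: nearW => k; rewrite ub andbT; apply: le_trans (lb k).
    rewrite ler_pdivlMr ?addr_gt0// mulrBl mul1r.
    have k0 : 0 < k.+1%:R :> R by [].
    have : al * k.+1%:R^-1 * k.+1%:R = al by rewrite mulfVK ?gt_eqF.
    have : 0 <= al * k.+1%:R^-1 * al by rewrite mulr_ge0 ?mulr_ge0 ?invr_ge0 ?ltW.
    rewrite mulrDr => e1 e2; rewrite e2; move: e1; set Q := al * _ * _; lra.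
  - rewrite -[X in _ --> X]subr0 -(mulr0 al); apply: cvgB; first exact: cvg_cst.
    by apply: cvgMr; exact: cvg_harmonic.
  - exact: cvg_cst.
have G0 : Gamma (1 + al) != 0.
  apply/eqP => h0; move: lim1; rewrite h0; under eq_fun do rewrite mul0r.
  move=> h; have e1 : limn (fun=> 0 : R) = 1 by apply: cvg_lim.
  have e2 : limn (fun=> 0 : R) = 0 by apply: cvg_lim => //; exact: cvg_cst.
  by move/eqP: e1; rewrite e2 eq_sym oner_eq0.
have h : (Gamma (1 + al) * u k)^-1 @[k --> \oo] --> (1 : R).
  by rewrite -[X in _ --> X]invr1; apply: cvgV lim1; exact: oner_neq0.
have : Gamma (1 + al) * (Gamma (1 + al) * u k)^-1 @[k --> \oo] --> Gamma (1 + al) * 1.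
  by apply: cvgM => //; exact: cvg_cst.
rewrite mulr1; suff <- : (fun k => Gamma (1 + al) * (Gamma (1 + al) * u k)^-1) =
  (fun k => k.+1%:R `^ al / \prod_(i < k) (1 + al / i.+1%:R)) by [].
by apply/funext => k; rewrite invfM mulrA divff// mul1r /u invf_div.
Qed.

End GammaFunction.

(** * Euler's product for the sine, from the integrals of cos (b t) cos^n t *)

Section SineProduct.
Context {R : realType}.
Local Notation leb := (@lebesgue_measure R).

Let ci (f : R -> R) : R := \int[leb]_(t in `[0, pi / 2]) f t.

Let pi2_gt0 : 0 < pi / 2 :> R. Proof. by rewrite divr_gt0 ?pi_gt0. Qed.

Let ci_int (f : R -> R) : continuous f -> leb.-integrable `[0, pi / 2] (EFin \o f).
Proof.
move=> cf; apply: continuous_compact_integrable; first exact: segment_compact.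
exact: continuous_subspaceT.
Qed.

Let ciB (f g : R -> R) : continuous f -> continuous g ->
  ci (fun t => f t - g t) = ci f - ci g.
Proof. by move=> cf cg; rewrite /ci RintegralB//; exact: ci_int. Qed.

Let ciZ (c : R) (f : R -> R) : continuous f -> ci (fun t => c * f t) = c * ci f.
Proof. by move=> cf; rewrite /ci RintegralZl//; exact: ci_int. Qed.

Let ci_le (f g : R -> R) : continuous f -> continuous g ->
  (forall t, 0 <= t <= pi / 2 -> f t <= g t) -> ci f <= ci g.
Proof.
move=> cf cg fg; apply: le_Rintegral => //; try exact: ci_int.
Qed.

Let ci_ftc (F f : R -> R) : (forall t : R, is_derive t (1 : R) F (f t)) ->
  continuous f -> ci f = F (pi / 2) - F 0.
Proof.
move=> dF cf; have cF t : {for t, continuous F}.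
  by apply/differentiable_continuous/derivable1_diffP; exact: ex_derive.
rewrite /ci /Rintegral (@continuous_FTC2 _ _ F)//.
- exact: continuous_subspaceT.
- split; [by move=> t _; exact: ex_derive| | ].
    by apply: cvg_at_right_filter; exact: cF.
  by apply: cvg_at_left_filter; exact: cF.
- by move=> t _; rewrite derive1E; exact: derive_val.
Qed.

Let cosX (b : R) n (t : R) : R := cos (b * t) * cos t ^+ n.

Let dlin (b t : R) : is_derive t (1 : R) (fun t => b * t) b.
Proof.
have h := is_deriveZ b (is_derive_id t (1 : R)).
by apply: (is_derive_eq h); rewrite /GRing.scale /= mulr1.
Qed.

Let dcos (b t : R) : is_derive t (1 : R) (fun t => cos (b * t)) (- (b * sin (b * t))).
Proof.
have h := is_derive1_comp (is_derive_cos (b * t)) (dlin b t).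
by apply: (is_derive_eq h); rewrite /GRing.scale /=; ring.
Qed.

Let dsin (b t : R) : is_derive t (1 : R) (fun t => sin (b * t)) (b * cos (b * t)).
Proof.
have h := is_derive1_comp (is_derive_sin (b * t)) (dlin b t).
by apply: (is_derive_eq h); rewrite /GRing.scale /=; ring.
Qed.

Let der_cont (f : R -> R) (f' : R -> R) : (forall t : R, is_derive t (1 : R) f (f' t)) -> continuous f.
Proof.
move=> h t; apply/differentiable_continuous/derivable1_diffP; have ht := h t.
exact: ex_derive.
Qed.

Let dcosX n (t : R) : is_derive t (1 : R) (fun t => cos t ^+ n) (- (n%:R * cos t ^+ n.-1 * sin t)).
Proof.
have h := is_deriveX n (is_derive_cos t).
rewrite (_ : (fun t => cos t ^+ n) = cos ^+ n); last by apply/funext => u; rewrite fctE.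
by apply: (is_derive_eq h); rewrite /GRing.scale /=; ring.
Qed.

Let cosX_cont b n : continuous (cosX b n).
Proof. by move=> t; apply: cvgM; [exact: (der_cont (dcos b))|exact: (der_cont (dcosX n))]. Qed.

(** [I 0 n] is Wallis' integral; at even n, the quotient of [I (2 * al) n] by it is the reciprocal
    of a partial sine product, up to a constant. *)
Let I b n : R := ci (cosX b n).

(** Two integrations by parts in one: the function [F] of the proof vanishes at 0 and at pi / 2, and
    its derivative is the difference of the two integrands. *)
Let I_rec b n : (n.+2%:R ^+ 2 - b ^+ 2) * I b n.+2 = n.+2%:R * n.+1%:R * I b n.
Proof.
pose F (t : R) := n.+2%:R * (cos (b * t) * cos t ^+ n.+1 * sin t)
  - b * (sin (b * t) * cos t ^+ n.+2).
pose f (t : R) := (n.+2%:R ^+ 2 - b ^+ 2) * cosX b n.+2 t - n.+2%:R * n.+1%:R * cosX b n t.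
have dF (t : R) : is_derive t (1 : R) F (f t).
  have h1 := is_deriveM (is_deriveM (dcos b t) (dcosX n.+1 t)) (is_derive_sin t).
  have h2 := is_deriveM (dsin b t) (dcosX n.+2 t).
  have h := is_deriveB (is_deriveZ n.+2%:R h1) (is_deriveZ b h2).
  apply: (is_derive_eq h); rewrite mulrfctE /GRing.scale /= /f /cosX [cos t ^+ n.+2]exprS [cos t ^+ n.+1]exprS.
  apply/eqP; rewrite -subr_eq0 -[n.+2%:R]natr1.
  rewrite (_ : _ - _ = (n.+1%:R + 1) * n.+1%:R * (cos (b * t) * cos t ^+ n)
    * (1 - (cos t ^+ 2 + sin t ^+ 2))); first by rewrite cos2Dsin2 subrr mulr0.
  by move: (cos t ^+ n) (n.+1%:R : R) => X N; ring.
have cZ (c : R) k : continuous (fun t => c * cosX b k t).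
  by move=> t; apply: cvgM; [exact: cvg_cst|exact: cosX_cont].
have cf : continuous f by move=> t; apply: cvgB; exact: cZ.
have h : ci f = 0.
  by rewrite (ci_ftc dF cf) /F mulr0 sin0 cos_pihalf !expr0n /= !(mulr0, mul0r) !subrr.
have : ci f = (n.+2%:R ^+ 2 - b ^+ 2) * I b n.+2 - n.+2%:R * n.+1%:R * I b n.
  by rewrite /f ciB ?ciZ//; exact: cosX_cont.
by rewrite h => /esym/eqP; rewrite subr_eq0 => /eqP.
Qed.

Let nonneg_der (f f' : R -> R) (x : R) : (forall t : R, is_derive t (1 : R) f (f' t)) ->
  0 <= x -> (forall t, 0 <= t <= x -> 0 <= f' t) -> f 0 <= f x.
Proof.
move=> df x0 hf; have [|t xt e] := MVT_segment x0 (fun t _ => df t).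
  exact: continuous_subspaceT (der_cont df).
by rewrite -subr_ge0 e subr0 mulr_ge0// hf.
Qed.

Let sin_le (x : R) : 0 <= x -> sin x <= x.
Proof.
move=> x0; suff : 0 - sin 0 <= x - sin x by rewrite sin0 subrr subr_ge0.
apply: (@nonneg_der (fun t => t - sin t) (fun t => 1 - cos t)) => // t _.
Qed.

Let tcos_le_sin (x : R) : 0 <= x <= pi / 2 -> x * cos x <= sin x.
Proof.
move=> /andP[x0 x1].
suff : sin 0 - 0 * cos 0 <= sin x - x * cos x by rewrite sin0 mul0r subrr subr_ge0.
apply: (@nonneg_der (fun t => sin t - t * cos t) (fun t => t * sin t)) => //.
  move=> t; have h := is_deriveB (is_derive_sin t) (is_deriveM (is_derive_id t (1 : R)) (is_derive_cos t)).
  by apply: (is_derive_eq h); rewrite /GRing.scale /=; ring.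
move=> t /andP[t0 tx]; rewrite mulr_ge0// sin_ge0_pi// t0 /=.
apply: (le_trans tx); apply: (le_trans x1); have := pi_ge0 R; lra.
Qed.

Let I00 : I 0 0 = pi / 2.
Proof.
rewrite /I (_ : cosX 0 0 = fun=> 1); last first.
  by apply/funext => t; rewrite /cosX mul0r cos0 expr0 mulr1.
rewrite (@ci_ftc id) ?subr0// => t; exact: cvg_cst.
Qed.

Let I0_gt0 n : 0 < I 0 n.*2.
Proof.
elim: n => [|n ih]; first by rewrite I00.
have := I_rec 0 n.*2; rewrite expr0n subr0 doubleS => h.
have : 0 < n.*2.+2%:R ^+ 2 * I 0 n.*2.+2 by rewrite h !mulr_gt0.
by rewrite pmulr_rgt0// exprn_gt0.
Qed.

Let ratio_le (b : R) n : I b n <= I 0 n.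
Proof.
apply: ci_le; try exact: cosX_cont; move=> t /andP[t0 t1].
rewrite /cosX mul0r cos0 ler_wpM2r ?cos_le1// exprn_ge0// cos_ge0_pihalf// t1 andbT.
by apply: le_trans t0; rewrite oppr_le0 ltW.
Qed.

(** From 1 - cos (2 al t) = 2 sin (al t)^2 and sin (al t) cos t <= al t cos t <= al sin t, the loss
    is at most 2 al^2 times the integral of cos^n sin^2, which the recursion turns into
    [I 0 n.+2 / n.+1%:R]. *)
Let ratio_ge (al : R) n : 0 <= al <= 1 ->
  (1 - 2 * al ^+ 2 / n.+1%:R) * I 0 n.+2 <= I (2 * al) n.+2.
Proof.
move=> /andP[al0 al1].
have h : I 0 n.+2 - I (2 * al) n.+2 <= 2 * al ^+ 2 * (I 0 n - I 0 n.+2).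
  rewrite /I -!ciB; try exact: cosX_cont.
  rewrite -ciZ; last by move=> t; apply: cvgB; exact: cosX_cont.
  apply: ci_le.
  - by move=> t; apply: cvgB; exact: cosX_cont.
  - move=> t; apply: cvgM; first exact: cvg_cst.
    by apply: cvgB; exact: cosX_cont.
  move=> t /andP[t0 t1]; rewrite /cosX !mul0r !cos0 !mul1r.
  have c0 : 0 <= cos t.
    by rewrite cos_ge0_pihalf// t1 andbT; apply: le_trans t0; rewrite oppr_le0 ltW.
  have e1 : cos t ^+ n - cos t ^+ n.+2 = cos t ^+ n * sin t ^+ 2.
    by rewrite sin2cos2 !exprS expr0; ring.
  rewrite e1 -[X in X - _]mul1r -mulrBl.
  have e2 : 1 - cos (2 * al * t) = 2 * sin (al * t) ^+ 2.
    rewrite (_ : 2 * al * t = al * t + al * t); last by ring.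
    by rewrite cosD sin2cos2 -!expr2 sin2cos2; ring.
  rewrite e2 [cos t ^+ n.+2]exprS [cos t ^+ n.+1]exprS.
  have cn : 0 <= cos t ^+ n by rewrite exprn_ge0.
  have s1 : 0 <= sin (al * t).
    rewrite sin_ge0_pi// mulr_ge0//=; have := pi_ge0 R => p0.
    apply: (@le_trans _ _ (1 * t)); first by rewrite ler_wpM2r.
    rewrite mul1r; apply: (le_trans t1); lra.
  have s2 : sin (al * t) <= al * t by apply: sin_le; rewrite mulr_ge0.
  have s3 : t * cos t <= sin t by apply: tcos_le_sin; rewrite t0.
  have s4 : 0 <= sin (al * t) * cos t <= al * sin t.
    rewrite mulr_ge0//=; apply: (le_trans (ler_wpM2r c0 s2)).
    by rewrite -mulrA ler_wpM2l.
  have s5 : (sin (al * t) * cos t) ^+ 2 <= (al * sin t) ^+ 2.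
    by apply: lerXn2r; rewrite ?nnegrE; case/andP: s4 => // h1 /(le_trans h1).
  rewrite [leLHS](_ : _ = 2 * (sin (al * t) * cos t) ^+ 2 * cos t ^+ n); last by ring.
  rewrite [leRHS](_ : _ = 2 * (al * sin t) ^+ 2 * cos t ^+ n); last by ring.
  by apply: ler_wpM2r => //; apply: ler_wpM2l.
have h2 : I 0 n - I 0 n.+2 = I 0 n.+2 / n.+1%:R.
  have := I_rec 0 n; rewrite expr0n subr0 -[n.+2%:R]natr1.
  have n0 : n.+1%:R != 0 :> R by rewrite pnatr_eq0.
  have n1 : n.+1%:R + 1 != 0 :> R by rewrite natr1 pnatr_eq0.
  move: (n.+1%:R : R) n0 n1 => N n0 n1 e; apply: (@mulfI _ ((N + 1) * N)); first by rewrite mulf_neq0.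
  by rewrite mulrBr -e; field.
rewrite h2 in h; rewrite mulrBl mul1r.
rewrite (_ : _ / _ * _ = 2 * al ^+ 2 * (I 0 n.+2 / n.+1%:R)); last by ring.
by rewrite lerBlDr -lerBlDl.
Qed.

Theorem sine_product (al : R) : 0 < al < 1 ->
  \prod_(i < k) (1 - al ^+ 2 / i.+1%:R ^+ 2) @[k --> \oo] --> sin (pi * al) / (pi * al).
Proof.
move=> /andP[al0 al1].
have p0 : pi != 0 :> R by rewrite gt_eqF ?pi_gt0.
have a0 : al != 0 by rewrite gt_eqF.
pose q k := I (2 * al) k.*2 / I 0 k.*2.
have sS k : k.+1%:R ^+ 2 - al ^+ 2 != 0 :> R.
  rewrite subr_eq0 eqrXn2// ?ler0n ?(ltW al0)//; apply/eqP => e.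
  by move: al1; rewrite -e ltNge ler1n.
(* By [I_rec] the quotient q (k + 1) / q k is K^2 / (K^2 - al^2) with K = k + 1, so q times the
   partial product is constant; it remains that q tends to 1. *)
have qE k : q k * \prod_(i < k) (1 - al ^+ 2 / i.+1%:R ^+ 2) = sin (pi * al) / (pi * al).
  elim: k => [|k ih].
    rewrite big_ord0 mulr1 /q double0 I00 /I.
    have -> : ci (cosX (2 * al) 0) = sin (pi * al) / (2 * al).
      have h (t : R) : is_derive t (1 : R) (fun t => (2 * al)^-1 * sin (2 * al * t)) (cosX (2 * al) 0 t).
        have h1 := is_deriveZ (2 * al)^-1 (dsin (2 * al) t).
        apply: (is_derive_eq h1); rewrite /GRing.scale /= /cosX expr0; field.
        by rewrite gt_eqF.
      rewrite (ci_ftc h (@cosX_cont _ 0)) mulr0 sin0 mulr0 subr0 mulrC; congr (sin _ / _).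
      by field.
    move: (sin (pi * al)) (pi : R) p0 => S p p0; field.
    by rewrite p0 a0.
  rewrite -ih big_ord_recr /= mulrA [RHS]mulrC mulrAC [RHS]mulrC; congr (_ * _).
  rewrite /q doubleS; have e1 := I_rec (2 * al) k.*2; have e0 := I_rec 0 k.*2.
  have k2 : k.*2.+2%:R = 2 * k.+1%:R :> R by rewrite -doubleS -mul2n natrM.
  rewrite k2 expr0n subr0 in e0; rewrite k2 in e1.
  have K0 : k.+1%:R != 0 :> R by rewrite pnatr_eq0.
  have M0 : k.*2.+1%:R != 0 :> R by rewrite pnatr_eq0.
  have i0 := gt_eqF (I0_gt0 k); have i1 := gt_eqF (I0_gt0 k.+1); rewrite doubleS in i1.
  have := sS k.
  move: (k.+1%:R : R) (k.*2.+1%:R : R) K0 M0 e0 e1 i0 i1 => K M K0 M0 e0 e1 i0 i1 s0.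
  have -> : I 0 k.*2 = 2 * K / M * I 0 k.*2.+2.
    apply: (@mulfI _ (2 * K * M)); first by rewrite !mulf_neq0.
    by rewrite -e0; field.
  have -> : I (2 * al) k.*2 = 2 * (K ^+ 2 - al ^+ 2) / (K * M) * I (2 * al) k.*2.+2.
    apply: (@mulfI _ (2 * K * M)); first by rewrite !mulf_neq0.
    by rewrite -e1; field; rewrite K0 M0.
  by field; rewrite K0 M0 i1.
have qlim : q k @[k --> \oo] --> (1 : R).
  rewrite -cvg_shiftS.
  apply: (@squeeze_cvgr _ _ _ _ (fun k => 1 - 2 * al ^+ 2 * k.+1%:R^-1) (fun=> 1)).
  - apply: nearW => k; rewrite /q ler_pdivrMr ?I0_gt0// mul1r ratio_le andbT.
    rewrite ler_pdivlMr ?I0_gt0// doubleS.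
    apply: le_trans (ratio_ge k.*2 _); last by rewrite !ltW.
    apply: ler_wpM2r; first by rewrite -doubleS ltW// I0_gt0.
    rewrite lerD2l lerN2; apply: ler_wpM2l; first by rewrite mulr_ge0 ?sqr_ge0.
    by rewrite lef_pV2 ?posrE// ler_nat ltnS -addnn leq_addr.
  - rewrite -[X in _ --> X]subr0 -(mulr0 (2 * al ^+ 2)); apply: cvgB; first exact: cvg_cst.
    by apply: cvgMr; exact: cvg_harmonic.
  - exact: cvg_cst.
have qV : (q k)^-1 @[k --> \oo] --> (1 : R).
  by rewrite -[X in _ --> X]invr1; apply: cvgV qlim; exact: oner_neq0.
have : sin (pi * al) / (pi * al) * (q k)^-1 @[k --> \oo] --> sin (pi * al) / (pi * al) * 1.
  by apply: cvgM qV; exact: cvg_cst.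
rewrite mulr1; apply: cvg_trans; apply: near_eq_cvg.
move/cvgrPdist_lt : qlim => /(_ 1 ltr01); apply: filterS => k hk.
have q0 : q k != 0 by apply: contraTneq hk => ->; rewrite subr0 normr1 ltxx.
by rewrite -(qE k) mulrAC divff// mul1r.
Qed.

End SineProduct.

Section BinomialAsymptotics.
Context {R : realType}.

(** Up to sign, the coefficient of index k + 1 is al / (k + 1) times the product of 1 - al / i for 1
    <= i <= k, and 1 - al / i = (1 - al^2 / i^2) / (1 + al / i): the numerators form the sine
    product, and the denominators together with k^al form Gauss' product. *)
Theorem ch_asymptotics (al : R) : 0 < al < 1 ->
  k%:R `^ (1 + al) * ((-1) ^+ k.+1 * ch al k) @[k --> \oo] -->
  al * Gamma al * sin (pi * al) / pi.
Proof.
move=> al01; have /andP[al0 al1] := al01.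
have p0 : pi != 0 :> R by rewrite gt_eqF ?pi_gt0.
have a0 : al != 0 by rewrite gt_eqF.
have h1 := gauss_product al01; have h2 := sine_product al01.
have -> : al * Gamma al * sin (pi * al) / pi =
    al * (Gamma (1 + al) * (sin (pi * al) / (pi * al))).
  rewrite addrC GammaS//; move: (sin (pi * al)) (pi : R) p0 => S p p0; field.
  by rewrite p0 a0.
rewrite -cvg_shiftS.
have -> : (fun k => k.+1%:R `^ (1 + al) * ((-1) ^+ k.+2 * ch al k.+1)) =
    (fun k => al * ((k.+1%:R `^ al / \prod_(i < k) (1 + al / i.+1%:R)) *
      \prod_(i < k) (1 - al ^+ 2 / i.+1%:R ^+ 2))).
  apply/funext => k.
  have k0 : 0 < k.+1%:R :> R by [].
  rewrite powRD; last by rewrite (gt_eqF k0) implybT.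
  rewrite powRr1 ?ltW//.
  have prod_neq0 j : \prod_(i < j) (1 + al / i.+1%:R) != 0.
    by rewrite gt_eqF// prodr_gt0// => i _; rewrite ltr_pwDl// divr_ge0// ltW.
  suff e : k.+1%:R * ((-1) ^+ k.+2 * ch al k.+1) * \prod_(i < k) (1 + al / i.+1%:R) =
      al * \prod_(i < k) (1 - al ^+ 2 / i.+1%:R ^+ 2).
    transitivity (k.+1%:R `^ al / \prod_(i < k) (1 + al / i.+1%:R) *
      (k.+1%:R * ((-1) ^+ k.+2 * ch al k.+1) * \prod_(i < k) (1 + al / i.+1%:R))).
      by rewrite mulrA mulrAC mulrACA; field.
    by rewrite e; ring.
  elim: k {k0} => [|k ih].
    by rewrite !big_ord0 chS ch0 expr2 subr0; field.
  rewrite !big_ord_recr /= [RHS]mulrA -ih [ch al k.+2]chS [_ ^+ k.+3]exprS.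
  have n0 : k.+1%:R != 0 :> R by rewrite pnatr_eq0.
  have n1 : k.+1%:R + 1 != 0 :> R by rewrite natr1 pnatr_eq0.
  rewrite -[k.+2%:R]natr1; move: (\prod_(i < k) _) (ch al k.+1) ((-1) ^+ k.+2) (k.+1%:R : R) n0 n1.
  by move=> p c e N n0 n1; field; rewrite n0.
by apply: cvgMr; apply: cvgM.
Qed.

End BinomialAsymptotics.

(** * Inversion of the Gram matrix *)

Section ToeplitzInverse.
Context {R : realType}.
Implicit Types (a b X : nat -> R[i]).

Lemma toep_row_sum_le a (B : R) n N :
  (forall k, \sum_(j < k) cnorm (a j) <= B) ->
  \sum_(j < N) cnorm (toep a j n) <= B.
Proof.
move=> aB; have key : \sum_(j < n.+1) cnorm (toep a j n) <= B.
  apply: le_trans (aB n.+1); rewrite (reindex_inj rev_ord_inj) /=.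
  apply: ler_sum => j _; rewrite /toep subSS leq_subr subKn//.
  by rewrite -ltnS.
apply: le_trans key; have [Nn|nN] := leqP N n.+1.
  rewrite [leRHS](big_ord_cat (fun j => cnorm (toep a j n)) Nn) lerDl.
  by apply: sumr_ge0 => i _; exact: cnorm_ge0.
rewrite (big_ord_cat (fun j => cnorm (toep a j n)) (ltnW nN)) gerDl.
rewrite big1_seq// => j /andP[_]; rewrite mem_index_iota => /andP[nj _].
by rewrite /toep leqNgt nj cnorm0.
Qed.

Lemma toep_mul a b i n :
  \sum_(m < n.+1) toep a i m * toep b m n = toep (cprod a b) i n.
Proof.
rewrite {3}/toep; case: leqP => [le_in|ni]; last first.
  rewrite big1// => m _; rewrite /toep leqNgt.
  by rewrite (leq_trans (ltn_ord m) ni) mul0r.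
rewrite (big_ord_cat (fun m => toep a i m * toep b m n) (leqW le_in)).
rewrite big1 ?add0r => [|m _]; last by rewrite /toep leqNgt ltn_ord mul0r.
rewrite -{1}(add0n i) big_addn big_mkord subSn//; apply: eq_bigr => j _.
rewrite /toep leq_addl addnK -subnDA (addnC i j).
by case: leqP => //; have := ltn_ord j; lia.
Qed.

Lemma tsum_toepM a X l : asum (fun j => a j * X (l + j)%N) ->
  tsum (fun m => toep a l m * X m) = tsum (fun j => a j * X (l + j)%N).
Proof.
move=> s; rewrite -(tsum_toep l s); apply: eq_tsum => m; rewrite /toep.
by case: leqP => [lm|]; rewrite ?mul0r// subnKC.
Qed.

Lemma tsum_drop a k : asum (fun j => a (k + j)%N) ->
  (forall i, (i < k)%N -> a i = 0) -> tsum a = tsum (fun j => a (k + j)%N).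
Proof.
move=> s a0; rewrite -(tsum_toep k s); apply: eq_tsum => m; rewrite /toep.
by case: leqP => [lm|/a0//]; rewrite subnKC.
Qed.

Lemma asum_bounded a X (B : R) : asum a -> (forall n, cnorm (X n) <= B) ->
  asum (fun n => a n * X n).
Proof.
move=> [A aA] XB; have B0 : 0 <= B by apply: le_trans (XB 0%N); exact: cnorm_ge0.
exists (A * B) => n.
apply: (@le_trans _ _ (\sum_(i < n) cnorm (a i) * B)).
  by apply: ler_sum => i _; rewrite cnormM ler_wpM2l ?cnorm_ge0.
by rewrite -mulr_suml ler_wpM2r.
Qed.

Lemma tsum_mul_le a X (A B : R) : (forall n, \sum_(i < n) cnorm (a i) <= A) ->
  (forall n, cnorm (X n) <= B) -> cnorm (tsum (fun n => a n * X n)) <= A * B.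
Proof.
move=> aA XB; have B0 : 0 <= B by apply: le_trans (XB 0%N); exact: cnorm_ge0.
apply: tsum_le => n; apply: (@le_trans _ _ (\sum_(i < n) cnorm (a i) * B)).
  by apply: ler_sum => i _; rewrite cnormM ler_wpM2l ?cnorm_ge0.
by rewrite -mulr_suml ler_wpM2r.
Qed.

Lemma sum_mul_le a X (A B : R) n : (forall n, \sum_(i < n) cnorm (a i) <= A) ->
  (forall n, cnorm (X n) <= B) -> cnorm (\sum_(i < n) a i * X i) <= A * B.
Proof.
move=> aA XB; have B0 : 0 <= B by apply: le_trans (XB 0%N); exact: cnorm_ge0.
apply: le_trans (cnorm_sum _ _ _) _.
apply: (@le_trans _ _ (\sum_(i < n) cnorm (a i) * B)).
  by apply: ler_sum => i _; rewrite cnormM ler_wpM2l ?cnorm_ge0.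
by rewrite -mulr_suml ler_wpM2r.
Qed.

Lemma toepT_inv a b X (B : R) l : asum a -> asum b ->
  (forall n, cprod a b n = (n == 0)%:R) -> (forall n, cnorm (X n) <= B) ->
  tsum (fun m => toep a l m * tsum (fun n => toep b m n * X n)) = X l.
Proof.
move=> sa sb ab XB; have [A aA] := sa; have [C bC] := sb.
have B0 : 0 <= B by apply: le_trans (XB 0%N); exact: cnorm_ge0.
have C0 : 0 <= C by apply: le_trans (bC 0%N); rewrite big_ord0.
transitivity (tsum (fun m => tsum (fun n => toep a l m * (toep b m n * X n)))).
  apply: eq_tsum => m; rewrite tsumZ//.
  by apply: asum_bounded XB; exact: asum_toep.
rewrite (@tsum_exchange _ _ (A * (C * B))) => [|N M].
  rewrite (eq_tsum (b := fun n => toep (cprod a b) l n * X n)) => [|n].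
    rewrite (@tsum_fin _ _ l.+1) => [|i li].
      rewrite big_ord_recr /= big1 ?add0r => [|i _].
        by rewrite /toep leqnn subnn ab mul1r.
      by rewrite /toep leqNgt ltn_ord mul0r.
    by rewrite /toep ltnW// ab subn_eq0 leqNgt li mul0r.
  rewrite -toep_mul mulr_suml (@tsum_fin _ _ n.+1) => [|m nm].
    by apply: eq_bigr => m _; rewrite mulrA.
  by rewrite {2}/toep leqNgt nm mul0r mulr0.
apply: (@le_trans _ _ (\sum_(m < N) cnorm (toep a l m) * (C * B))).
  apply: ler_sum => m _; under eq_bigr do rewrite cnormM.
  rewrite -mulr_sumr ler_wpM2l ?cnorm_ge0//.
  apply: (@le_trans _ _ (\sum_(n < M) cnorm (toep b m n) * B)).
    by apply: ler_sum => n _; rewrite cnormM ler_wpM2l ?cnorm_ge0.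
  by rewrite -mulr_suml ler_wpM2r// toep_sum_le.
by rewrite -mulr_suml ler_wpM2r ?mulr_ge0//; exact: toep_sum_le.
Qed.

(** The lower triangular counterpart, where all sums are finite. *)
Lemma toep_inv a b X n : (forall n, cprod b a n = (n == 0)%:R) ->
  \sum_(m < n.+1) toep a m n * \sum_(i < m.+1) toep b i m * X i = X n.
Proof.
move=> ba.
transitivity (\sum_(m < n.+1) \sum_(i < n.+1) toep a m n * (toep b i m * X i)).
  apply: eq_bigr => m _; rewrite mulr_sumr.
  rewrite [RHS](big_ord_cat (fun i => toep a m n * (toep b i m * X i)) (ltn_ord m)).
  rewrite [X in _ + X]big1_seq ?addr0// => i /andP[_].
  rewrite mem_index_iota => /andP[mi _].
  by rewrite {2}/toep leqNgt mi mul0r mulr0.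
rewrite exchange_big /=.
rewrite (eq_bigr (fun i : 'I_n.+1 => toep (cprod b a) i n * X i)) => [|i _].
  rewrite big_ord_recr /= big1 ?add0r => [|i _].
    by rewrite /toep leqnn subnn ba mul1r.
  by rewrite /toep ltnW// ba subn_eq0 leqNgt ltn_ord mul0r.
by rewrite -toep_mul mulr_suml; apply: eq_bigr => m _; ring.
Qed.

End ToeplitzInverse.

(** * The orthogonality equations as a perturbed Wiener-Hopf system *)

Section WienerHopf.
Context {R : realType}.
Variables (g h : nat -> R[i]) (G G1 H : R).
Hypothesis gG : forall n, \sum_(i < n) cnorm (g i) <= G.
Hypothesis gG1 : forall n, \sum_(i < n) i%:R * cnorm (g i) <= G1.
Hypothesis hH : forall n, \sum_(i < n) cnorm (h i) <= H.
Hypothesis gh : forall n, cprod g h n = (n == 0)%:R.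
Hypothesis hg : forall n, cprod h g n = (n == 0)%:R.
Hypothesis h0 : h 0%N = 1.

(* The Gram matrix of z^s u^a, rescaled; see [class_moment]. *)
Definition gram (a l : nat) : R[i] :=
  tsum (fun n => toep h a n * (toep h l n / n.+1%:R)).

(** Inverting the three factors of [gram] gives as entry (n, m) the sum over l of g(n - l) (l + 1)
    g(m - l). Here column m is divided by m + 1: since l <= m wherever [toep g l m] is nonzero, this
    keeps the sums bounded, and the factor m + 1 moves into [Z]. *)
Definition invgram (n m : nat) : R[i] :=
  \sum_(l < n.+1) toep g l n * (toep g l m * (l.+1%:R / m.+1%:R)).

Let sg : asum g. Proof. by exists G. Qed.
Let sh : asum h. Proof. by exists H. Qed.
Let G0 : 0 <= G. Proof. by apply: le_trans (gG 0%N); rewrite big_ord0. Qed.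
Let H0 : 0 <= H. Proof. by apply: le_trans (hH 0%N); rewrite big_ord0. Qed.

Lemma cnorm_nat (n : nat) : cnorm (n%:R : R[i]) = n%:R.
Proof.
have -> : (n%:R : R[i]) = (n%:R : R)%:C by rewrite rmorph_nat.
by rewrite cnorm_real ger0_norm.
Qed.

Lemma toep_weight_le (l m : nat) (a : nat -> R[i]) :
  cnorm (toep a l m * (l.+1%:R / m.+1%:R)) <= cnorm (toep a l m).
Proof.
rewrite /toep; case: leqP => lm; last by rewrite mul0r.
rewrite cnormM ler_piMr ?cnorm_ge0// cnormM cnormV !cnorm_nat.
by rewrite ler_pdivrMr ?ltr0n// mul1r ler_nat.
Qed.

Lemma invgram_sum_le n N : \sum_(m < N) cnorm (invgram n m) <= G * G.
Proof.
apply: (@le_trans _ _ (\sum_(m < N) \sum_(l < n.+1)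
    cnorm (toep g l n) * cnorm (toep g l m))).
  apply: ler_sum => m _; apply: le_trans (cnorm_sum _ _ _) _.
  apply: ler_sum => l _; rewrite cnormM ler_wpM2l ?cnorm_ge0//.
  exact: toep_weight_le.
rewrite exchange_big /=.
apply: (@le_trans _ _ (\sum_(l < n.+1) cnorm (toep g l n) * G)).
  apply: ler_sum => l _; rewrite -mulr_sumr ler_wpM2l ?cnorm_ge0//.
  exact: toep_sum_le.
by rewrite -mulr_suml ler_wpM2r// toep_row_sum_le.
Qed.

Section OrthogonalPolynomial.
Variables (k : nat) (c : nat -> R[i]).
Hypothesis c_gt : forall n, (k < n)%N -> c n = 0.
Hypothesis c_monic : c k = 1.
Hypothesis c_orth : forall l, (l < k)%N -> \sum_(a < k.+1) c a * gram a l = 0.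

Let S n : R[i] := \sum_(a < n.+1) toep h a n * c a.
(** Up to the factor l + 1, the pairing of the polynomial with the l-th basis function;
    orthogonality makes it vanish below [k]. The factor compensates the decay of 1 / (n + 1), so
    that the shifted data [Y] have a nonzero limit. *)
Let Z l : R[i] := l.+1%:R * tsum (fun n => toep h l n * (S n / n.+1%:R)).
Let Y j : R[i] := Z (k + j)%N.

Let CB := \sum_(a < k.+1) cnorm (c a).

Let c_bound n : cnorm (c n) <= CB.
Proof.
have [nk|/c_gt ->] := leqP n k; last first.
  by rewrite cnorm0; apply: sumr_ge0 => i _; exact: cnorm_ge0.
rewrite /CB (bigD1 (Ordinal (nk : (n < k.+1)%N)))//= lerDl.
by apply: sumr_ge0 => i _; exact: cnorm_ge0.
Qed.

Let S_bound n : cnorm (S n) <= H * CB.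
Proof.
apply: (sum_mul_le (a := fun a => toep h a n)) => // N.
exact: toep_row_sum_le.
Qed.

Let S_extend n : S n = \sum_(a < k.+1) toep h a n * c a.
Proof.
rewrite /S; have [nk|kn] := leqP n k.
  rewrite [RHS](big_ord_cat (fun a => toep h a n * c a) (nk : (n.+1 <= k.+1)%N)).
  rewrite [X in _ + X]big1_seq ?addr0// => a /andP[_].
  by rewrite mem_index_iota => /andP[na _]; rewrite /toep leqNgt na mul0r.
rewrite (big_ord_cat (fun a => toep h a n * c a) (leqW kn : (k.+1 <= n.+1)%N)).
rewrite [X in _ + X]big1_seq ?addr0// => a /andP[_].
by rewrite mem_index_iota => /andP[ka _]; rewrite c_gt ?mulr0.
Qed.

Let S_div_bound n : cnorm (S n / n.+1%:R) <= H * CB.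
Proof.
apply: le_trans (S_bound n); rewrite cnormM ler_piMr ?cnorm_ge0//.
by rewrite cnormV cnorm_nat invf_le1 ?ltr0n// ler1n.
Qed.

Let Z_lt l : (l < k)%N -> Z l = 0.
Proof.
move=> lk; rewrite /Z.
rewrite (eq_tsum (b := fun n => \sum_(a < k.+1)
    c a * (toep h a n * (toep h l n / n.+1%:R)))) => [|n]; last first.
  by rewrite S_extend !mulr_suml mulr_sumr; apply: eq_bigr => a _; ring.
have s a : asum (fun n => toep h a n * (toep h l n / n.+1%:R)).
  apply: (@asum_bounded _ _ _ H); first exact: asum_toep.
  move=> n; rewrite cnormM cnormV cnorm_nat.
  apply: (@le_trans _ _ (cnorm (toep h l n))).
    by rewrite ler_piMr ?cnorm_ge0// invf_le1 ?ltr0n// ler1n.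
  have := @toep_sum_le _ h H l n.+1 hH; rewrite big_ord_recr /=.
  apply: le_trans; rewrite lerDr; apply: sumr_ge0 => i _; exact: cnorm_ge0.
rewrite (@tsum_sum _ _ _ (fun (a : 'I_k.+1) n =>
  c a * (toep h a n * (toep h l n / n.+1%:R)))) => [|a]; last exact: asumZ.
transitivity (l.+1%:R * \sum_(a < k.+1) c a * gram a l).
  by congr (_ * _); apply: eq_bigr => a _; rewrite tsumZ.
by rewrite c_orth// mulr0.
Qed.

Let Z_bound l : cnorm (Z l) <= H * (H * CB).
Proof.
rewrite /Z -tsumZ; last first.
  by apply: (@asum_bounded _ _ _ (H * CB)) => //; exact: asum_toep.
rewrite (eq_tsum (b := fun n => toep h l n * (l.+1%:R / n.+1%:R) * S n)).
  apply: tsum_mul_le => // N; apply: le_trans (@toep_sum_le _ h H l N hH).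
  by apply: ler_sum => n _; exact: toep_weight_le.
by move=> n; ring.
Qed.

Let S_inv l : S l = tsum (fun m => toep g l m * (l.+1%:R / m.+1%:R) * Z m).
Proof.
have := toepT_inv l sg sh gh S_div_bound => e.
rewrite (_ : S l = l.+1%:R * (S l / l.+1%:R)); last first.
  by rewrite mulrC divfK// pnatr_eq0.
rewrite -e -tsumZ; last first.
  apply: (@asum_bounded _ _ _ (H * (H * CB))); first exact: asum_toep.
  by move=> m; apply: tsum_mul_le => // N; exact: toep_sum_le.
apply: eq_tsum => m; rewrite /Z.
set t := tsum _; have m0 : m.+1%:R != 0 :> R[i] by rewrite pnatr_eq0.
by field; rewrite nat1r.
Qed.

Let c_inv n : c n = tsum (fun m => invgram n m * Z m).
Proof.
rewrite -[LHS](toep_inv c n hg).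
under eq_bigr do rewrite -/(S _) S_inv.
rewrite (eq_tsum (b := fun m => \sum_(l < n.+1)
    toep g l n * (toep g l m * (l.+1%:R / m.+1%:R) * Z m))) => [|m]; last first.
  by rewrite /invgram mulr_suml; apply: eq_bigr => l _; ring.
have s l : asum (fun m => toep g l m * (l.+1%:R / m.+1%:R) * Z m).
  apply: asum_bounded Z_bound; exists G => N.
  apply: le_trans (@toep_sum_le _ g G l N gG).
  by apply: ler_sum => m _; exact: toep_weight_le.
rewrite (@tsum_sum _ _ _ (fun (l : 'I_n.+1) m =>
    toep g l n * (toep g l m * (l.+1%:R / m.+1%:R) * Z m))) => [|l].
  by apply: eq_bigr => l _; rewrite tsumZ.
exact: asumZ.
Qed.

Let Y_bound j : cnorm (Y j) <= H * (H * CB).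
Proof. exact: Z_bound. Qed.

Let c_Y n : c n = tsum (fun j => invgram n (k + j) * Y j).
Proof.
rewrite c_inv (@tsum_drop _ (fun m => invgram n m * Z m) k)//.
  apply: (@asum_bounded _ (fun j => invgram n (k + j)) Y _ _ Y_bound).
  exists (G * G) => N; apply: le_trans (invgram_sum_le n (k + N)).
  rewrite big_split_ord /= lerDr.
  by apply: sumr_ge0 => i _; exact: cnorm_ge0.
by move=> i /Z_lt ->; rewrite mulr0.
Qed.

(* Truncated subtraction makes the weight vanish for p > a + j + k. *)
Let wt a j p : R[i] := ((a + j + k).+1 - p)%:R / (k + j).+1%:R.

(** The substitution p = a + j + k - l removes [k] from the Toeplitz entries; only the weight [wt]
    still depends on it, and it tends to 1. With weight 1 the matrix is the product of an upper and
    a lower triangular Toeplitz matrix. *)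
Let invgram_toeplitz a j : invgram (k + a) (k + j) =
  tsum (fun p => toep g a p * (toep g j p * wt a j p)).
Proof.
rewrite (@tsum_fin _ _ (a + j + k).+1) => [|p hp]; last first.
  by rewrite /wt (eqP (hp : _ - _ == 0)%N) mul0r !mulr0.
rewrite (reindex_inj rev_ord_inj) /= /invgram.
have le1 : ((k + a).+1 <= (a + j + k).+1)%N by lia.
rewrite [RHS](big_ord_cat (fun l => toep g a (a + j + k - l) *
   (toep g j (a + j + k - l) * wt a j (a + j + k - l))) le1).
rewrite [X in _ + X]big1_seq ?addr0 => [|l /andP[_]]; last first.
  rewrite mem_index_iota => /andP[l1 l2].
  by rewrite {2}/toep ifF ?mul0r ?mulr0//; lia.
apply: eq_bigr => l _; have lk := ltn_ord l; rewrite ltnS in lk.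
rewrite mulrCA /toep lk.
have -> : (l <= k + j)%N = (a <= a + j + k - l)%N by lia.
have -> : (j <= a + j + k - l)%N by lia.
rewrite /wt; have -> : ((a + j + k).+1 - (a + j + k - l) = l.+1)%N by lia.
have -> : (a + j + k - l - j = k + a - l)%N by lia.
case: leqP => // h1.
by have -> : (a + j + k - l - a = k + j - l)%N by lia.
Qed.

Let wt_le1 a j p : (a <= p)%N -> cnorm (wt a j p) <= 1.
Proof.
move=> ap; rewrite /wt cnormM cnormV !cnorm_nat ler_pdivrMr ?ltr0n// mul1r.
by rewrite ler_nat; lia.
Qed.

(** The price of replacing the weight by 1. The numerator p - a is absorbed by the first moment [G1]
    of [g], which leaves 1 / (k + 1). *)
Let wt_near1 a j p : (a <= p)%N ->
  cnorm (1 - wt a j p) <= (p - a)%:R / k.+1%:R.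
Proof.
move=> ap.
apply: (@le_trans _ _ ((p - a)%:R / (k + j).+1%:R)); last first.
  rewrite ler_wpM2l// lef_pV2 ?posrE ?ltr0n// ler_nat; lia.
have [hp|hp] := leqP p (a + j + k).
  have -> : 1 - wt a j p = (p - a)%:R / (k + j).+1%:R.
    rewrite /wt; apply: (@mulIf _ (k + j).+1%:R); first by rewrite pnatr_eq0.
    rewrite mulrBl mul1r !divfK ?pnatr_eq0// -natrB; last by lia.
    by congr (_%:R); lia.
  by rewrite cnormM cnormV !cnorm_nat.
rewrite /wt (_ : (_ - p = 0)%N); last by lia.
rewrite mul0r subr0 cnorm1 ler_pdivlMr ?ltr0n// mul1r ler_nat; lia.
Qed.

Let X p : R[i] := \sum_(j < p.+1) toep g j p * Y j.

Let X_bound p : cnorm (X p) <= G * (H * (H * CB)).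
Proof.
apply: (sum_mul_le (a := fun j => toep g j p)) => // N.
exact: toep_row_sum_le.
Qed.

Let E a := tsum (fun p => toep g a p *
  \sum_(j < p.+1) toep g j p * ((1 - wt a j p) * Y j)).

Let E_term a p (B : R) : (forall j, cnorm (Y j) <= B) ->
  cnorm (toep g a p * \sum_(j < p.+1) toep g j p * ((1 - wt a j p) * Y j)) <=
  cnorm (toep (fun i => i%:R * g i) a p) * (G * B / k.+1%:R).
Proof.
move=> YB; have B0 : 0 <= B by apply: le_trans (YB 0%N); exact: cnorm_ge0.
rewrite {1 3}/toep; case: leqP => ap; last by rewrite !mul0r cnorm0 mul0r.
rewrite cnormM (cnormM _ (g _)) cnorm_nat.
rewrite (_ : (p - a)%:R * _ * _ = cnorm (g (p - a)%N) *
  (G * ((p - a)%:R / k.+1%:R * B))); last by ring.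
rewrite ler_wpM2l ?cnorm_ge0//.
apply: le_trans (cnorm_sum _ _ _) _.
apply: (@le_trans _ _ (\sum_(j < p.+1) cnorm (toep g j p) *
   ((p - a)%:R / k.+1%:R * B))); last first.
  by rewrite -mulr_suml ler_wpM2r ?mulr_ge0// toep_row_sum_le.
apply: ler_sum => j _; rewrite cnormM ler_wpM2l ?cnorm_ge0// cnormM.
by apply: ler_pM; rewrite ?cnorm_ge0// wt_near1.
Qed.

Let g1_sum n : \sum_(i < n) cnorm (i%:R * g i) <= G1.
Proof. by under eq_bigr do rewrite cnormM cnorm_nat. Qed.

Let E_bound (B : R) a : (forall j, cnorm (Y j) <= B) ->
  cnorm (E a) <= G1 * (G * B / k.+1%:R).
Proof.
move=> YB; have B0 : 0 <= B by apply: le_trans (YB 0%N); exact: cnorm_ge0.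
apply: tsum_le => n.
apply: (@le_trans _ _ (\sum_(p < n) cnorm (toep (fun i => i%:R * g i) a p) *
   (G * B / k.+1%:R))).
  by apply: ler_sum => p _; exact: E_term.
by rewrite -mulr_suml ler_wpM2r ?divr_ge0 ?mulr_ge0// toep_sum_le.
Qed.

Let E_asum a : asum (fun p => toep g a p *
  \sum_(j < p.+1) toep g j p * ((1 - wt a j p) * Y j)).
Proof.
have [B YB] : exists B, forall j, cnorm (Y j) <= B by exists (H * (H * CB)).
have B0 : 0 <= B by apply: le_trans (YB 0%N); exact: cnorm_ge0.
apply: (@asum_le _ _ _ (G1 * (G * B / k.+1%:R)) (fun p => E_term a p YB)) => n.
by rewrite -mulr_suml ler_wpM2r ?divr_ge0 ?mulr_ge0// toep_sum_le.
Qed.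

(** These are the equations c k = 1 and c (k + a) = 0 for a > 0, written in terms of [Y]; [E]
    collects the error of replacing the weight by 1. *)
Let X_eq a : tsum (fun p => toep g a p * X p) = (a == 0)%:R + E a.
Proof.
have B0 : 0 <= H * (H * CB) by apply: le_trans (Y_bound 0%N); exact: cnorm_ge0.
have sX : asum (fun p => toep g a p * X p).
  by apply: asum_bounded X_bound; exact: asum_toep.
apply/eqP; rewrite -subr_eq /E -(tsumB sX (E_asum a)).
have -> : (a == 0)%:R = c (k + a) :> R[i].
  case: a {sX} => [|a]; first by rewrite addn0 c_monic.
  by rewrite c_gt// addnS ltnS leq_addr.
rewrite c_Y; apply/eqP.
transitivity (tsum (fun j => tsum (fun p =>
    toep g a p * (toep g j p * wt a j p) * Y j))); last first.
  apply: eq_tsum => j; rewrite invgram_toeplitz mulrC -tsumZ.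
    by apply: eq_tsum => p; rewrite mulrC.
  exists (G * G) => N.
  apply: (@le_trans _ _ (\sum_(p < N) cnorm (toep g a p) * G)); last first.
    by rewrite -mulr_suml ler_wpM2r// toep_sum_le.
  apply: ler_sum => p _; rewrite {1 3}/toep.
  case: leqP => ap; last by rewrite !mul0r cnorm0 mul0r.
  rewrite cnormM ler_wpM2l ?cnorm_ge0// cnormM.
  apply: (@le_trans _ _ (cnorm (toep g j p))).
    by rewrite ler_piMr ?cnorm_ge0// wt_le1.
  have := @toep_sum_le _ g G j p.+1 gG; rewrite big_ord_recr /=.
  by apply: le_trans; rewrite lerDr; apply: sumr_ge0 => i _; exact: cnorm_ge0.
rewrite -(@tsum_exchange _ (fun p j => toep g a p * (toep g j p * wt a j p) * Y j)
   (G * (G * (H * (H * CB))))) => [|N M].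
  apply: eq_tsum => p; rewrite (@tsum_fin _ _ p.+1) => [|j pj]; last first.
    by rewrite {2}/toep leqNgt pj mul0r mulr0 mul0r.
  rewrite /X -mulrBr -sumrB mulr_sumr; apply: eq_bigr => j _; ring.
apply: (@le_trans _ _ (\sum_(p < N) cnorm (toep g a p) * (G * (H * (H * CB))))).
  apply: ler_sum => p _; case: (leqP a p) => ap; last first.
    have -> : toep g a p = 0 by rewrite /toep leqNgt ap.
    by rewrite cnorm0 mul0r big1// => j _; rewrite !mul0r cnorm0.
  apply: (@le_trans _ _ (\sum_(j < M) cnorm (toep g a p) *
     (cnorm (toep g j p) * (H * (H * CB))))).
    apply: ler_sum => j _.
    rewrite (cnormM _ (Y j)) (cnormM _ (_ * wt a j p)) (cnormM _ (wt a j p)) -!mulrA.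
    rewrite ler_wpM2l ?cnorm_ge0// ler_wpM2l ?cnorm_ge0//.
    rewrite -[leRHS]mul1r; apply: ler_pM; rewrite ?cnorm_ge0//.
    exact: wt_le1.
  rewrite -mulr_sumr ler_wpM2l ?cnorm_ge0// -mulr_suml ler_wpM2r//.
  exact: toep_row_sum_le.
rewrite -mulr_suml; apply: ler_wpM2r; first exact: mulr_ge0.
exact: toep_sum_le.
Qed.

(** The two Toeplitz factors of the unperturbed system are inverted in turn. The inverse of the
    upper one fixes the first unit vector because [h 0 = 1]; the inverse of the lower one maps it to
    [h]. The rest is the image of [E]. *)
Let Y_near (B : R) j : (forall j, cnorm (Y j) <= B) ->
  cnorm (Y j - h j) <= H * (H * (G1 * (G * B / k.+1%:R))).
Proof.
move=> YB; have EB := fun a => E_bound a YB.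
pose W p := tsum (fun a => toep h p a * E a).
have WB p : cnorm (W p) <= H * (G1 * (G * B / k.+1%:R)).
  by apply: tsum_mul_le EB => n; exact: toep_sum_le.
have XW p : X p = toep h p 0 + W p.
  rewrite -(toepT_inv p sh sg hg X_bound).
  rewrite (eq_tsum (b := fun m => toep h p m * (m == 0)%:R + toep h p m * E m)).
    rewrite tsumD; first congr (_ + _).
    - rewrite (@tsum_fin _ _ 1) => [|[//|m _]]; last by rewrite mulr0.
      by rewrite big_ord_recr big_ord0 /= add0r mulr1.
    - by apply: (@asum_fin _ _ 1) => -[//|m _]; rewrite mulr0.
    - by apply: asum_bounded EB; exact: asum_toep.
  by move=> m; rewrite X_eq mulrDr.
rewrite -[Y j](toep_inv Y j gh).
rewrite (eq_bigr (fun p : 'I_j.+1 => toep h p j * toep h p 0 + toep h p j * W p)).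
  rewrite big_split big_ord_recl /= [X in cnorm (_ + X + _ - _)]big1 => [|p _].
    rewrite {1 2}/toep /= subn0 h0 mulr1 addr0 addrAC subrr add0r.
    apply: (sum_mul_le (a := fun p => toep h p j)) => // N.
    exact: toep_row_sum_le.
  by rewrite {2}/toep /= mulr0.
by move=> p _; rewrite -/(X p) XW mulrDr.
Qed.

(** [Y] is bounded, but a priori only by a constant involving [c]. For k this large the error in
    [Y_near] is at most half of the supremum of |Y|, so this supremum is at most H plus half of
    itself, hence at most 2 H; [Y_near] is then applied again with this bound. *)
Lemma orth_poly_coeffs : 2 * (H * (H * (G1 * G))) <= k.+1%:R ->
  exists Y : nat -> R[i],
    [/\ forall j, cnorm (Y j) <= 2 * H,
        forall j, cnorm (Y j - h j) <= H * (H * (G1 * (G * (2 * H)))) / k.+1%:R &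
        forall n, c n = tsum (fun j => invgram n (k + j) * Y j)].
Proof.
move=> hk; exists Y.
have hbd j : cnorm (h j) <= H.
  have := hH j.+1; rewrite big_ord_recr /=; apply: le_trans; rewrite lerDr.
  by apply: sumr_ge0 => i _; exact: cnorm_ge0.
have YB j : cnorm (Y j) <= 2 * H.
  pose T := [set cnorm (Y j) | j in [set: nat]].
  have hT : has_sup T.
    split; first by exists (cnorm (Y 0)), 0%N.
    by exists (H * (H * CB)) => _ [i _ <-]; exact: Y_bound.
  have Yle i : cnorm (Y i) <= sup T by apply: ub_le_sup; [case: hT|exists i].
  suff : sup T <= 2 * H by apply: le_trans.
  have s0 : 0 <= sup T by apply: le_trans (Yle 0%N); exact: cnorm_ge0.
  have : sup T <= H + sup T / 2; last by lra.
  apply: ge_sup; first by case: hT.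
  move=> _ [i _ <-]; have := Y_near i Yle => hi.
  have := cnormD (Y i - h i) (h i); rewrite subrK => hi2.
  have hi3 : H * (H * (G1 * (G * sup T / k.+1%:R))) <= sup T / 2.
    rewrite (_ : H * _ = sup T * (H * (H * (G1 * G))) / k.+1%:R); last by ring.
    rewrite ler_pdivrMr ?ltr0n// -mulrA ler_wpM2l//; lra.
  have := hbd i; move: hi hi2 hi3; set x := H * _; lra.
split => // j; apply: le_trans (Y_near j YB) _.
by rewrite le_eqVlt; apply/orP; left; apply/eqP; ring.
Qed.

End OrthogonalPolynomial.
End WienerHopf.

(** * Asymptotics of the coefficients *)

(* Discarding the real-valued hypotheses first keeps [lia] fast. *)
Ltac natlia := repeat match goal with
  | H : is_true (leq _ _) |- _ => revert H end; clear; intros; lia.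

Section CoefficientAsymptotics.
Context {R : realType}.
Variables (rho al : R).
Hypothesis rho01 : 0 < rho < 1.
Hypothesis al01 : 0 <= al < 1.

Let rho_gt0 : 0 < rho. Proof. by case/andP: rho01. Qed.
Let rho_ge0 : 0 <= rho. Proof. exact: ltW. Qed.
Let rho_lt1 : rho < 1. Proof. by case/andP: rho01. Qed.
Let al_ge0 : 0 <= al. Proof. by case/andP: al01. Qed.
Let al_lt1 : al < 1. Proof. by case/andP: al01. Qed.
Let al01' : 0 <= al <= 1. Proof. by rewrite al_ge0 ltW. Qed.
Let nal : `|al| <= 1. Proof. by rewrite ger0_norm//; exact: ltW. Qed.
Let nNal : `|- al| <= 1. Proof. by rewrite normrN; exact: nal. Qed.

Let g : nat -> R[i] := bterm al rho%:C.
Let h : nat -> R[i] := bterm (- al) rho%:C.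
Let H : R := (1 - rho)^-1.

(** With y the eighth root of x, x^i is (y^i)^7 times y^i, and each power of i + 1 is absorbed by
    one factor y^i because (i + 1) y^i <= 1 / (1 - y). Three square roots give the eighth root,
    hence p <= 7. *)
Lemma sum_poly_geometric (x : R) (p : nat) : 0 <= x < 1 -> (p <= 7)%N ->
  exists B, forall n, \sum_(i < n) i.+1%:R ^+ p * x ^+ i <= B.
Proof.
move=> /andP[x0 x1] p7.
pose y := Num.sqrt (Num.sqrt (Num.sqrt x)).
have yx : y ^+ 8 = x.
  by rewrite (exprM y 2 4) sqr_sqrtr// (exprM _ 2 2) sqr_sqrtr// sqr_sqrtr.
have y0 : 0 <= y by exact: sqrtr_ge0.
have y1 : y < 1.
  rewrite ltNge; apply/negP => y1; have := exprn_ege1 8 y1.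
  by rewrite yx; lra.
have key i : i.+1%:R * y ^+ i <= (1 - y)^-1.
  apply: (@le_trans _ _ (\sum_(j < i.+1) y ^+ j)); last first.
    by apply: sum_geometric; rewrite y0.
  apply: (@le_trans _ _ (\sum_(j < i.+1) y ^+ i)).
    by rewrite sumr_const card_ord mulr_natl.
  apply: ler_sum => j _; apply: ler_wiXn2l => //; first exact: ltW.
  by rewrite -ltnS.
have D0 : 0 < (1 - y)^-1 by rewrite invr_gt0 subr_gt0.
exists ((1 - y)^-1 ^+ 7 * (1 - y)^-1) => n.
apply: (@le_trans _ _ (\sum_(i < n) (1 - y)^-1 ^+ 7 * y ^+ i)).
  apply: ler_sum => i _.
  have -> : x ^+ i = (y ^+ i) ^+ 7 * y ^+ i
    by rewrite -yx -!exprM -exprD -mulnSr mulnC.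
  rewrite mulrA; apply: ler_wpM2r; first exact: exprn_ge0.
  apply: (@le_trans _ _ (i.+1%:R ^+ 7 * (y ^+ i) ^+ 7)).
    apply: ler_wpM2r; first by rewrite exprn_ge0// exprn_ge0.
    by rewrite ler_weXn2l// ler1n.
  rewrite -exprMn; apply: lerXn2r; rewrite ?nnegrE ?(ltW D0)//.
  by rewrite mulr_ge0// exprn_ge0.
rewrite -mulr_sumr; apply: ler_wpM2l; first by rewrite exprn_ge0// ltW.
by apply: sum_geometric; rewrite y0.
Qed.

Lemma cnorm_bterm_real a i : cnorm (bterm a rho%:C i) = `|ch a i| * rho ^+ i.
Proof. by rewrite cnorm_bterm cnorm_real (ger0_norm rho_ge0). Qed.

Lemma cnorm_bterm_le a i : `|a| <= 1 -> cnorm (bterm a rho%:C i) <= rho ^+ i.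
Proof.
by move=> a1; rewrite cnorm_bterm_real ler_piMl ?exprn_ge0// norm_ch_le1.
Qed.

Let sum_le a n : `|a| <= 1 -> \sum_(i < n) cnorm (bterm a rho%:C i) <= H.
Proof.
move=> a1; apply: (@le_trans _ _ (\sum_(i < n) rho ^+ i)).
  by apply: ler_sum => i _; exact: cnorm_bterm_le.
by apply: sum_geometric; rewrite rho_ge0.
Qed.

Let gH n : \sum_(i < n) cnorm (g i) <= H. Proof. exact: sum_le nal. Qed.
Let hH n : \sum_(i < n) cnorm (h i) <= H. Proof. exact: sum_le nNal. Qed.
Let H0 : 0 < H. Proof. by rewrite invr_gt0 subr_gt0. Qed.

Let gh n : cprod g h n = (n == 0)%:R.
Proof.
by rewrite cprod_bterm subrr /bterm; case: n => [|n]; rewrite ?ch0 ?ch0S ?mul0r// expr0 mulr1.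
Qed.

Let hg n : cprod h g n = (n == 0)%:R.
Proof.
by rewrite cprod_bterm addNr /bterm; case: n => [|n]; rewrite ?ch0 ?ch0S ?mul0r// expr0 mulr1.
Qed.

Let rhoC0 : rho%:C != 0 :> R[i].
Proof. by rewrite -cnorm_eq0 cnorm_real normr_eq0 gt_eqF. Qed.

Let h0 : h 0%N = 1. Proof. by rewrite /h /bterm ch0 expr0 mulr1. Qed.

Let sg : asum g. Proof. by exists H; exact: gH. Qed.
Let sh : asum h. Proof. by exists H; exact: hH. Qed.

Variable c : nat -> nat -> R[i].
Hypothesis c_gt : forall k n, (k < n)%N -> c k n = 0.
Hypothesis c_monic : forall k, c k k = 1.
Hypothesis c_orth : forall k l, (l < k)%N ->
  \sum_(a < k.+1) c k a * gram h a l = 0.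

Let dual_coeffs : exists (K : nat) (C : R) (Y : nat -> nat -> R[i]),
  forall k, (K <= k)%N ->
  [/\ forall j, cnorm (Y k j) <= 2 * H,
      forall j, cnorm (Y k j - h j) <= C / k.+1%:R &
      forall n, c k n = tsum (fun j => invgram g n (k + j) * Y k j)].
Proof.
have [G1 hG1] : exists G1, forall n, \sum_(i < n) i%:R * cnorm (g i) <= G1.
  have [B hB] := @sum_poly_geometric rho 1 (introT andP (conj rho_ge0 rho_lt1)) isT.
  exists B => n; apply: le_trans (hB n); apply: ler_sum => i _; rewrite expr1.
  by apply: ler_pM => //; [exact: cnorm_ge0|rewrite ler_nat|exact: cnorm_bterm_le nal].
pose C := H * (H * (G1 * (H * (2 * H)))).
have [K hK] : exists K : nat, 2 * (H * (H * (G1 * H))) <= K%:R.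
  by exists (Num.trunc (2 * (H * (H * (G1 * H))))).+1; apply/ltW/truncnS_gt.
pose P k Y := [/\ forall j, cnorm (Y j) <= 2 * H,
      forall j, cnorm (Y j - h j) <= C / k.+1%:R &
      forall n, c k n = tsum (fun j => invgram g n (k + j) * Y j)].
have /choice[Y hY] : forall k, exists Y, (K <= k)%N -> P k Y.
  move=> k; have [Kk|kK] := leqP K k; last by exists (fun=> 0).
  have hK' : 2 * (H * (H * (G1 * H))) <= k.+1%:R.
    by apply: le_trans hK _; rewrite ler_nat ltnW.
  have [Y hY] := orth_poly_coeffs gH hG1 hH gh hg h0 (@c_gt k) (c_monic k)
    (@c_orth k) hK'.
  by exists Y.
by exists K, C, Y.
Qed.

Let ctends_dual (K : nat) (C : R) (Y : nat -> nat -> R[i]) j :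
  (forall k, (K <= k)%N -> cnorm (Y k j - h j) <= C / k.+1%:R) ->
  ctends (fun k => Y k j) (h j).
Proof.
move=> hY e e0.
have C0 : 0 <= C.
  have := le_trans (cnorm_ge0 _) (hY K (leqnn K)).
  by rewrite pmulr_lge0// invr_gt0.
have [N hN] : exists N : nat, C / e <= N%:R.
  by exists (Num.trunc (C / e)).+1; apply/ltW/truncnS_gt.
exists (maxn K N) => k; rewrite geq_max => /andP[Kk Nk].
apply: le_trans (hY k Kk) _; rewrite ler_pdivrMr// mulrC -ler_pdivrMr//.
by apply: le_trans hN _; rewrite ler_nat ltnW// ltnS.
Qed.

Lemma cvg_ratio_shift (a b : R) :
  (a + k%:R) / (b + k%:R) @[k --> \oo] --> (1 : R).
Proof.
have key (x : R) : (x + k%:R) / k.+1%:R @[k --> \oo] --> (1 : R).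
  have : 1 + (x - 1) * harmonic k @[k --> \oo] --> 1 + (x - 1) * (0 : R).
    by apply: cvgD; [exact: cvg_cst|apply: cvgMr; exact: cvg_harmonic].
  rewrite mulr0 addr0; apply: cvg_trans; apply: near_eq_cvg; near=> k.
  by rewrite /harmonic /=; field; rewrite nat1r.
have h1 : ((a + k%:R) / k.+1%:R) / ((b + k%:R) / k.+1%:R) @[k --> \oo]
    --> (1 : R) / 1.
  by apply: cvgM (key a) _; apply: cvgV (key b); exact: oner_neq0.
rewrite divr1 in h1; apply: cvg_trans h1; apply: near_eq_cvg; near=> k.
by rewrite invf_div mulrA divfK.
Unshelve. all: by end_near. Qed.

(** Both |ch al n| and rho^n decrease in n, so the majorant splits into one factor per index.
    Keeping |ch al n| beside rho^n leaves something summable after the later division by rho^n. *)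
Let term_le n i j (w : R[i]) : cnorm w <= 1 ->
  cnorm (g i * (g (n + j + i)%N * w)) <=
  cnorm (g i) * (`|ch al n| * rho ^+ n * rho ^+ j).
Proof.
move=> w1; rewrite cnormM; apply: ler_wpM2l; first exact: cnorm_ge0.
rewrite cnormM -[leRHS]mulr1; apply: ler_pM; rewrite ?cnorm_ge0//.
rewrite cnorm_bterm_real -mulrA -exprD; apply: ler_pM => //.
- exact: exprn_ge0.
- by apply: norm_ch_anti => //; rewrite -addnA leq_addr.
- by apply: ler_wiXn2l; rewrite ?ltW// leq_addr.
Qed.

(** The inner sums are the transposed Toeplitz matrix of [g] applied to the vector [g]; pairing them
    with [h] inverts that matrix. *)
Let outer_lim n : tsum (fun j => tsum (fun i => g i * g (n + j + i)%N) * h j) = g n.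
Proof.
have gb i : cnorm (g i) <= 1.
  by apply: le_trans (cnorm_bterm_le i nal) _; rewrite exprn_ile1// ltW.
rewrite -[RHS](toepT_inv n sh sg hg gb).
rewrite tsum_toepM; last first.
  apply: (@asum_bounded _ _ _ (H * 1)) => // j; apply: tsum_mul_le => // N.
  exact: toep_sum_le.
apply: eq_tsum => j; rewrite mulrC; congr (_ * _).
by rewrite tsum_toepM//; exact: asum_bounded.
Qed.

(** The l^1 distance is taken after division by rho^i, which corresponds to evaluation on the circle
    |u| = rho^2 itself. The majorant is a multiple of |ch al i|, summable by [sum_norm_ch]. *)
Theorem outer_coeffs (e : R) : 0 < e -> exists K, forall k, (K <= k)%N ->
  forall N, \sum_(i < N)
    cnorm ((if (i <= k)%N then c k (k - i) else 0) / rho%:C ^+ i - (ch al i)%:C) <= e.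
Proof.
have [K0 [C [Y hY]]] := dual_coeffs.
(* The truncated difference vanishes once i exceeds k - n, so the infinite sum [T] is the finite one
   of [invgram], and [k] enters only through a weight that tends to 1. *)
pose wt k n j i : R[i] := ((k - n).+1 - i)%:R / (k + j).+1%:R.
have wt1 k n j i : cnorm (wt k n j i) <= 1.
  rewrite /wt cnormM cnormV !cnorm_nat ler_pdivrMr ?ltr0n// mul1r ler_nat; natlia.
pose T k n j := tsum (fun i => g i * (g (n + j + i)%N * wt k n j i)).
have cE k n : (K0 <= k)%N -> (n <= k)%N ->
    c k (k - n) = tsum (fun j => T k n j * Y k j).
  move=> Kk nk; have [_ _ ->] := hY k Kk; apply: eq_tsum => j; congr (_ * _).
  rewrite /T (@tsum_fin _ _ (k - n).+1) => [|i hi]; last first.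
    by rewrite /wt (eqP (hi : _ - _ == 0)%N) mul0r !mulr0.
  rewrite /invgram (reindex_inj rev_ord_inj) /=; apply: eq_bigr => i _.
  have hi := ltn_ord i; rewrite /toep subSS leq_subr.
  rewrite (_ : (k - n - (k - n - i) = i)%N); last by natlia.
  rewrite (_ : (k - n - i <= k + j)%N); last by natlia.
  rewrite (_ : (k + j - (k - n - i) = n + j + i)%N); last by natlia.
  by rewrite /wt (_ : ((k - n).+1 - i = (k - n - i).+1)%N); last by natlia.
have TB k n j : cnorm (T k n j) <= H * (`|ch al n| * rho ^+ n * rho ^+ j).
  apply: tsum_le => N; apply: (@le_trans _ _ (\sum_(i < N) cnorm (g i) *
     (`|ch al n| * rho ^+ n * rho ^+ j))).
    by apply: ler_sum => i _; exact: term_le.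
  rewrite -mulr_suml; apply: ler_wpM2r => //.
  by rewrite !mulr_ge0// exprn_ge0.
have TYB k n j : (K0 <= k)%N -> cnorm (T k n j * Y k j) <=
    H * (`|ch al n| * rho ^+ n) * (2 * H) * rho ^+ j.
  move=> Kk; have [Yb _ _] := hY k Kk; rewrite cnormM mulrAC.
  apply: ler_pM; rewrite ?cnorm_ge0//.
  by apply: le_trans (TB k n j) _; rewrite !mulrA.
have sumB n N : \sum_(j < N) H * (`|ch al n| * rho ^+ n) * (2 * H) * rho ^+ j <=
    H * (`|ch al n| * rho ^+ n) * (2 * H) * H.
  rewrite -mulr_sumr; apply: ler_wpM2l; last by apply: sum_geometric; rewrite rho_ge0.
  by rewrite !mulr_ge0// ?exprn_ge0// ltW.
have cB k n : (K0 <= k)%N -> (n <= k)%N ->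
    cnorm (c k (k - n)) <= H * (`|ch al n| * rho ^+ n) * (2 * H) * H.
  move=> Kk nk; rewrite cE//; apply: tsum_le => N; apply: le_trans (sumB n N).
  by apply: ler_sum => j _; exact: TYB.
have Tlim n j : ctends (fun k => T k n j) (tsum (fun i => g i * g (n + j + i)%N)).
  have D0 : 0 <= `|ch al n| * rho ^+ n * rho ^+ j by rewrite !mulr_ge0// exprn_ge0.
  apply: (@tsum_tannery _ _ _
    (fun i => cnorm (g i) * (`|ch al n| * rho ^+ n * rho ^+ j))
    (H * (`|ch al n| * rho ^+ n * rho ^+ j)) 0%N) => [k i _|N|i].
  - exact: term_le.
  - by rewrite -mulr_suml; apply: ler_wpM2r.
  rewrite -[X in ctends _ (_ * X)]mulr1.
  apply: ctendsM (ctends_cst _) (ctendsM (ctends_cst _) _).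
  have := @cvg_ratio_shift (1 - n%:R - i%:R) (j%:R + 1).
  move/ctends_real; apply: (@ctends_near _ _ _ _ (n + i)) => k hk.
  have -> : 1 - n%:R - i%:R + k%:R = ((k - n).+1 - i)%:R :> R.
    by rewrite natrB; [rewrite -natr1 natrB; [ring|natlia]|natlia].
  have -> : j%:R + 1 + k%:R = (k + j).+1%:R :> R by rewrite -natr1 natrD; ring.
  by rewrite rmorphM fmorphV /= !rmorph_nat.
have clim n : ctends (fun k => if (n <= k)%N then c k (k - n) else 0) (g n).
  apply: (@ctends_near _ (fun k => tsum (fun j => T k n j * Y k j)) _ _ (maxn K0 n)).
    by move=> k; rewrite geq_max => /andP[Kk nk]; rewrite nk cE.
  rewrite -outer_lim; apply: (@tsum_tannery _ _ _
    (fun j => H * (`|ch al n| * rho ^+ n) * (2 * H) * rho ^+ j) _ K0).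
  - by move=> k j Kk; exact: TYB.
  - exact: sumB.
  - move=> j; apply: ctendsM (Tlim n j) _.
    by apply: (@ctends_dual K0 C) => k /hY[].
move=> e0; apply: (@tannery _
  (fun k i => (if (i <= k)%N then c k (k - i) else 0) / rho%:C ^+ i)
  (fun i => (ch al i)%:C)
  (fun i => (H * (2 * H) * H) * `|ch al i|) ((H * (2 * H) * H) * 2) K0 _ _ _ e e0).
- move=> k i Kk; rewrite cnormM cnormV cnormX cnorm_real (ger0_norm rho_ge0).
  have r0 : 0 < rho ^+ i by rewrite exprn_gt0.
  rewrite ler_pdivrMr//; case: leqP => ik; last first.
    by rewrite cnorm0 !mulr_ge0// ltW.
  apply: le_trans (cB k i Kk ik) _.
  by rewrite le_eqVlt; apply/orP; left; apply/eqP; ring.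
- move=> N; rewrite -mulr_sumr; apply: ler_wpM2l; last exact: sum_norm_ch.
  by rewrite !mulr_ge0// ltW.
- move=> i; have r0 : rho%:C ^+ i != 0 by rewrite expf_neq0.
  rewrite (_ : (ch al i)%:C = g i * (rho%:C ^+ i)^-1).
    exact: ctendsM (clim i) (ctends_cst _).
  by rewrite /g /bterm mulfK.
Qed.

(** * The lowest coefficients, and quotients of binomial coefficients *)

Section Inner.
Hypothesis al_gt0 : 0 < al.

Let chS_norm n : `|ch al n.+2| = `|ch al n.+1| * ((n.+1%:R - al) / n.+2%:R).
Proof.
rewrite chS normrM; congr (_ * _); rewrite -normrN -mulNr opprB ger0_norm//.
by rewrite divr_ge0// subr_ge0 (le_trans (ltW al_lt1))// ler1n.
Qed.

Lemma norm_ch_gt0 n : 0 < `|ch al n|.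
Proof.
case: n => [|n]; first by rewrite ch0 normr1.
elim: n => [|n ih]; first by rewrite chS ch0 mul1r subr0 divr1 gtr0_norm.
rewrite chS_norm mulr_gt0// divr_gt0// subr_gt0 (lt_le_trans al_lt1)//.
by rewrite ler1n.
Qed.

(** From index 2 on, |ch al n| n (n - 1) does not decrease, and at n = 2 it equals al (1 - al). The
    exponent 2 costs only a power of the index in [T_bound]. *)
Lemma norm_ch_lower n : al * (1 - al) <= `|ch al n| * n.+1%:R ^+ 2.
Proof.
have a1 : 0 <= 1 - al by rewrite subr_ge0 ltW.
have aa : al * (1 - al) <= al by rewrite ler_piMr// gerBl.
case: n => [|[|n]].
- by rewrite ch0 normr1 expr1n mulr1; apply: le_trans aa (ltW al_lt1).
- rewrite chS ch0 mul1r subr0 divr1 (ger0_norm al_ge0); apply: le_trans aa _.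
  by rewrite ler_peMr// exprn_ege1// ler1n.
have key : al * (1 - al) <= `|ch al n.+2| * (n.+2%:R * n.+1%:R).
  elim: n => [|n ih].
    rewrite chS_norm chS ch0 mul1r subr0 divr1 (ger0_norm al_ge0).
    by rewrite le_eqVlt; apply/orP; left; apply/eqP; field.
  apply: le_trans ih _; rewrite (chS_norm n.+1) -!mulrA.
  apply: ler_wpM2l => //.
  rewrite (_ : _ * (_ * (_ * _)) = (n.+2%:R - al) * n.+2%:R); last first.
    by rewrite mulKf// pnatr_eq0.
  by rewrite mulrC; apply: ler_wpM2r => //; have := al_lt1; rewrite -(natr1 n.+1); lra.
apply: le_trans key _; apply: ler_wpM2l => //; rewrite expr2.
by rewrite -!natrM ler_nat leq_mul// leqW.
Qed.

Let D : R := 2 / (1 - al).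
Let D1 : 1 <= D.
Proof. by rewrite /D ler_pdivlMr ?subr_gt0//; have := al_gt0; lra. Qed.

(** From index 1 on the ratio of consecutive |ch al n| increases, so raising [l] by 1 shrinks the
    left side at least as much as the right. [D] is fixed at l = 1, where the new factor on the
    right is at least (1 - al) / 2. The lemma serves to bound |ch al (k - l)| by |ch al k| up to a
    power of l. *)
Lemma norm_ch_supermul m l : `|ch al m| * `|ch al l| <= D * `|ch al (m + l)|.
Proof.
case: m => [|m].
  by rewrite ch0 normr1 mul1r add0n ler_peMl//; exact: D1.
case: l => [|l].
  by rewrite ch0 normr1 mulr1 addn0 ler_peMl//; exact: D1.
elim: l => [|l ih].
  rewrite addn1 chS_norm mulrCA; apply: ler_wpM2l => //.
  rewrite chS ch0 mul1r subr0 divr1 (ger0_norm al_ge0).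
  apply: le_trans (ltW al_lt1) _; rewrite /D mulrA ler_pdivlMr ?ltr0n//.
  rewrite mulrAC ler_pdivlMr ?subr_gt0//.
  have : 0 <= m%:R * (1 + al) :> R by rewrite mulr_ge0// addr_ge0.
  rewrite -(natr1 m.+1) -(natr1 m); lra.
rewrite addnS addSn (chS_norm (m + l.+1)) (chS_norm l) mulrA (mulrA D).
rewrite addSn in ih; apply: ler_pM => //.
  by rewrite divr_ge0// subr_ge0 (le_trans (ltW al_lt1))// ler1n.
rewrite ler_pdivrMr ?ltr0n// mulrAC ler_pdivlMr ?ltr0n//.
rewrite -(natr1 l.+1) -(natr1 l) -(natr1 (m + l.+1).+1) -(natr1 (m + l.+1)).
rewrite natrD -(natr1 l); have := al_ge0.
have : 0 <= m%:R * (1 + al) :> R by rewrite mulr_ge0// addr_ge0.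
lra.
Qed.

Lemma cvg_ch_ratio j : ch al (k + j) / ch al k @[k --> \oo] --> ((-1) ^+ j : R).
Proof.
elim: j => [|j ih].
  rewrite expr0 (_ : (fun k => _) = fun=> 1); first exact: cvg_cst.
  by apply/funext => k; rewrite addn0 divff// -normr_gt0 norm_ch_gt0.
rewrite exprSr.
have h1 : (- (((j%:R - al) + k%:R) / ((j%:R + 1) + k%:R))) @[k --> \oo] --> (-1 : R).
  by apply: cvgN; exact: cvg_ratio_shift.
apply: cvg_trans (cvgM ih h1); apply: near_eq_cvg; near=> k.
rewrite addnS chS /=; rewrite natrD -natr1 natrD.
rewrite (_ : al - _ = - (j%:R - al + k%:R)); last by ring.
rewrite (_ : k%:R + j%:R + 1 = j%:R + 1 + k%:R); ring.
Unshelve. all: by end_near. Qed.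

Lemma cvg_ch_ratioV j : ch al k / ch al (k + j) @[k --> \oo] --> ((-1) ^+ j : R).
Proof.
have s0 : (-1) ^+ j != 0 :> R by rewrite signr_eq0.
have : (ch al (k + j) / ch al k)^-1 @[k --> \oo] --> (((-1) ^+ j)^-1 : R).
  by apply: cvgV => //; exact: cvg_ch_ratio.
rewrite invr_sign; apply: cvg_trans.
by apply: near_eq_cvg; near=> k; rewrite /= invf_div.
Unshelve. all: by end_near. Qed.

Let ratio_cancel (W P CK CJ CL K1 KJ RJ RL RK : R[i]) :
  CK != 0 -> CL != 0 -> RK != 0 -> KJ != 0 ->
  W * (P * CK) * (CJ / CL * (CL / CK)) * (K1 / KJ) * (RJ * RL) =
  W * K1 * P / RK * (CJ * (RK * RJ * RL) * (1 / KJ)).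
Proof. by move=> h1 h2 h3 h4; field; rewrite h1 h2 h3 h4. Qed.

Variables (w : nat -> R) (A : R).
Hypothesis w_lim : w k * ((-1) ^+ k.+1 * ch al k) @[k --> \oo] --> A.

(** Normalization of the lowest coefficients: [w] matches the size of [ch al k], the extra factor k
    cancels the weight 1 / (k + j + 1) in [invgram], and rho^-k cancels the decay of
    [g (k + j - l)]. *)
Let nu k : R[i] := (w k * k%:R * (-1) ^+ k.+1 / rho ^+ k)%:C.

Let hst : R[i] := tsum (fun j => h j * (- rho%:C) ^+ j).

(** The coefficients of (1 + rho x)^al (1 + x / rho)^-2 in powers of x, times [A] and times [hst],
    which is (1 - rho^2)^(-al). *)
Let L (i : nat) : R[i] :=
  \sum_(l < i.+1) g (i - l)%N * (l.+1%:R * (- (rho%:C)^-1) ^+ l * (A%:C * hst)).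

Let w_bound : exists W, forall k, `|w k * ch al k| <= W.
Proof.
have := cvg_seq_bounded (cvgP _ w_lim).
move=> [M [_ /(_ (M + 1))]]; rewrite ltrDl ltr01 => /(_ isT) hM.
exists (M + 1) => k; have := hM k I; rewrite /= !normrM normrX normrN normr1.
by rewrite expr1n mul1r.
Qed.

Let T (Y : nat -> nat -> R[i]) k j l : R[i] :=
  nu k * (toep g l (k + j) * (1 / (k + j).+1%:R)) * Y k j.

(** Uniform in [k]: [norm_ch_supermul] and [norm_ch_lower] bound |ch al (k + j - l)| / |ch al k| by
    a multiple of (l + 1)^2, and what remains is |w k * ch al k|, bounded because it converges. *)
Let T_bound : exists B, forall (K : nat) (Y : nat -> nat -> R[i]),
  (forall k j, (K <= k)%N -> cnorm (Y k j) <= 2 * H) ->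
  forall k j l, (K <= k)%N -> (l <= k)%N ->
    cnorm (T Y k j l) <= B * l.+1%:R ^+ 2 * rho ^- l * rho ^+ j.
Proof.
have [W hW] := w_bound.
have W0 : 0 <= W by apply: le_trans (hW 0%N).
have aa : 0 < al * (1 - al) by rewrite mulr_gt0// subr_gt0.
exists (W * (D / (al * (1 - al))) * (2 * H)) => K Y YB k j l Kk lk.
rewrite cnormM [leRHS](_ : _ =
  (W * (D / (al * (1 - al)) * l.+1%:R ^+ 2) * rho ^- l * rho ^+ j) * (2 * H));
  last by ring.
apply: ler_pM; rewrite ?cnorm_ge0//; last exact: YB.
rewrite !cnormM cnormV cnorm_nat cnorm1 mul1r /nu cnorm_real /toep ifT; last by natlia.
rewrite cnorm_bterm_real.
have b1 : `|ch al (k + j - l)| <= `|ch al k| * (D / (al * (1 - al)) * l.+1%:R ^+ 2).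
  apply: (@le_trans _ _ `|ch al (k - l)|).
    by apply: norm_ch_anti => //; natlia.
  have := norm_ch_supermul (k - l) l; rewrite subnK// => h1.
  have h2 := norm_ch_lower l.
  have c0 := norm_ch_gt0 (k - l).
  rewrite (_ : _ * (_ / _ * _) = (D * `|ch al k|) * l.+1%:R ^+ 2 / (al * (1 - al)));
    last by ring.
  rewrite ler_pdivlMr//; apply: (@le_trans _ _
    (`|ch al (k - l)| * (`|ch al l| * l.+1%:R ^+ 2))).
    by apply: ler_wpM2l => //; exact: ltW.
  by rewrite mulrA; apply: ler_wpM2r => //; exact: exprn_ge0.
rewrite !normrM normfV normrX normrN normr1 expr1n mulr1 (ger0_norm (ler0n _ _)).
rewrite (ger0_norm (exprn_ge0 _ rho_ge0)).
have r0 m : 0 < rho ^+ m by rewrite exprn_gt0.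
rewrite (_ : rho ^+ (k + j - l) = rho ^+ k * rho ^+ j / rho ^+ l); last first.
  apply: (@mulIf _ (rho ^+ l)); first by rewrite gt_eqF.
  by rewrite divfK ?gt_eqF// -!exprD; congr (_ ^+ _); natlia.
apply: (@le_trans _ _ (`|w k| * 1 / rho ^+ k *
   (`|ch al k| * (D / (al * (1 - al)) * l.+1%:R ^+ 2) * (rho ^+ k * rho ^+ j / rho ^+ l)))).
  rewrite (_ : _ / rho ^+ k * _ = `|w k| * (k%:R / (k + j).+1%:R) / rho ^+ k *
     (`|ch al (k + j - l)| * (rho ^+ k * rho ^+ j / rho ^+ l))); last by ring.
  apply: ler_pM.
  - by rewrite !mulr_ge0// invr_ge0 ltW.
  - by rewrite !mulr_ge0// ?invr_ge0 ltW.
  - apply: ler_wpM2r; first by rewrite invr_ge0 ltW.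
    apply: ler_wpM2l => //; rewrite ler_pdivrMr ?ltr0n// mul1r ler_nat; natlia.
  - by apply: ler_wpM2r => //; rewrite !mulr_ge0// ?invr_ge0 ltW.
have rk : rho ^+ k != 0 by rewrite gt_eqF.
rewrite [leLHS](_ : _ = (`|w k * ch al k|) *
   ((D / (al * (1 - al)) * l.+1%:R ^+ 2) * rho ^- l * rho ^+ j) *
   (rho ^+ k / rho ^+ k)); last by rewrite normrM; ring.
rewrite divff// mulr1.
rewrite [leRHS](_ : _ = W *
   ((D / (al * (1 - al)) * l.+1%:R ^+ 2) * rho ^- l * rho ^+ j)); last by ring.
apply: ler_wpM2r => //; rewrite !mulr_ge0// ?invr_ge0 ?exprn_ge0 ?(ltW aa)//.
by rewrite subr_ge0 ltW.
Qed.

Theorem inner_coeffs (q e : R) : 0 <= q < rho -> 0 < e ->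
  exists K, forall k, (K <= k)%N ->
  forall N, \sum_(i < N) cnorm ((nu k * c k i - L i) * q%:C ^+ i) <= e.
Proof.
move=> /andP[q0 qr] e0.
have [K0 [C [Y hY]]] := dual_coeffs.
have YB k j : (K0 <= k)%N -> cnorm (Y k j) <= 2 * H by move=> /hY[].
have [B hB] := T_bound; have {}hB := hB K0 Y YB.
have B0 : 0 <= B.
  have := le_trans (cnorm_ge0 _) (hB K0 0%N 0%N (leqnn _) (leq0n _)).
  by rewrite expr1n expr0 invr1 !mulr1.
have r0 m : 0 < rho ^+ m by rewrite exprn_gt0.
have sT k l : (K0 <= k)%N -> (l <= k)%N -> asum (fun j => T Y k j l).
  move=> Kk lk; apply: (@asum_le _ _ _ (B * l.+1%:R ^+ 2 * rho ^- l * H)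
     (fun j => hB k j l Kk lk)) => N.
  rewrite -mulr_sumr; apply: ler_wpM2l; last by apply: sum_geometric; rewrite rho_ge0.
  by rewrite !mulr_ge0// ?exprn_ge0// invr_ge0 ltW.
have cE k i : (K0 <= k)%N -> (i <= k)%N -> nu k * c k i =
    \sum_(l < i.+1) g (i - l)%N * (l.+1%:R * tsum (fun j => T Y k j l)).
  move=> Kk ik; have [_ _ ->] := hY k Kk.
  have lk (l : 'I_i.+1) : (l <= k)%N by rewrite (leq_trans _ ik)// -ltnS.
  transitivity (\sum_(l < i.+1) tsum (fun j => g (i - l)%N * (l.+1%:R * T Y k j l))).
    rewrite -(@tsum_sum _ _ _ (fun (l : 'I_i.+1) j =>
      g (i - l)%N * (l.+1%:R * T Y k j l))) => [|l]; last first.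
      by apply: asumZ; apply: asumZ; exact: sT.
    rewrite -tsumZ; last first.
      apply: (@asum_bounded _ (fun j => invgram g i (k + j)) _ (2 * H)).
        exists (H * H) => N; apply: le_trans (invgram_sum_le gH i (k + N)).
        rewrite big_split_ord /= lerDr.
        by apply: sumr_ge0 => n _; exact: cnorm_ge0.
      by move=> j; exact: YB.
    apply: eq_tsum => j; rewrite /invgram mulr_suml mulr_sumr.
    apply: eq_bigr => l _; rewrite /T {1}/toep -ltnS ltn_ord; ring.
  apply: eq_bigr => l _; rewrite tsumZ; last by apply: asumZ; exact: sT.
  by rewrite tsumZ//; exact: sT.
have tB k l : (K0 <= k)%N -> (l <= k)%N ->
    cnorm (tsum (fun j => T Y k j l)) <= B * l.+1%:R ^+ 2 * rho ^- l * H.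
  move=> Kk lk; apply: tsum_le => N.
  apply: (@le_trans _ _ (\sum_(j < N) B * l.+1%:R ^+ 2 * rho ^- l * rho ^+ j)).
    by apply: ler_sum => j _; exact: hB.
  rewrite -mulr_sumr; apply: ler_wpM2l; last by apply: sum_geometric; rewrite rho_ge0.
  by rewrite !mulr_ge0// ?exprn_ge0// invr_ge0 ltW.
(* The exponent 4 is one for the weight l + 1, two from [T_bound] and one for the number of indices
   l; the sum over i then converges because q < rho strictly. *)
have fB k i : (K0 <= k)%N -> cnorm (nu k * c k i * q%:C ^+ i) <=
    (B * H) * (i.+1%:R ^+ 4 * (q / rho) ^+ i).
  move=> Kk; have [ik|ki] := leqP i k; last first.
    rewrite c_gt// mulr0 mul0r cnorm0 !mulr_ge0// ?(ltW H0)//.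
    by rewrite exprn_ge0// divr_ge0.
  rewrite cE// cnormM cnormX cnorm_real (ger0_norm q0) expr_div_n.
  rewrite [leRHS](_ : _ = (B * H * i.+1%:R ^+ 4 / rho ^+ i) * q ^+ i); last by ring.
  apply: ler_wpM2r; first exact: exprn_ge0.
  apply: le_trans (cnorm_sum _ _ _) _.
  apply: (@le_trans _ _ (\sum_(l < i.+1) B * H * i.+1%:R ^+ 3 / rho ^+ i)).
    apply: ler_sum => l _; have li : (l <= i)%N by rewrite -ltnS.
    rewrite 2!cnormM cnorm_nat.
    apply: (@le_trans _ _ (1 * (i.+1%:R * (B * i.+1%:R ^+ 2 * rho ^- i * H))));
      last by rewrite le_eqVlt; apply/orP; left; apply/eqP; ring.
    apply: ler_pM; rewrite ?mulr_ge0 ?cnorm_ge0//.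
      by apply: le_trans (cnorm_bterm_le _ nal) _; rewrite exprn_ile1// ltW.
    apply: ler_pM; rewrite ?cnorm_ge0// ?ler_nat//.
    apply: le_trans (tB k l Kk (leq_trans li ik)) _.
    apply: ler_wpM2r; first exact: ltW.
    apply: ler_pM; rewrite ?mulr_ge0 ?invr_ge0 ?exprn_ge0//.
      by apply: ler_wpM2l => //; apply: lerXn2r; rewrite ?nnegrE// ler_nat.
    rewrite lef_pV2 ?posrE//; apply: ler_wiXn2l => //; exact: ltW.
  rewrite sumr_const card_ord -mulr_natr le_eqVlt; apply/orP; left; apply/eqP; ring.
have tlim l : ctends (fun k => tsum (fun j => T Y k j l))
    ((- (rho%:C)^-1) ^+ l * (A%:C * hst)).
  have -> : (- (rho%:C)^-1) ^+ l * (A%:C * hst) =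
      tsum (fun j => (- (rho%:C)^-1) ^+ l * A%:C * (h j * (- rho%:C) ^+ j)).
    rewrite tsumZ ?mulrA//; apply: (asum_bounded (B := 1)) => // j.
    by rewrite cnormX cnormN cnorm_real ger0_norm// exprn_ile1// ltW.
  apply: (@tsum_tannery _ _ _ (fun j => B * l.+1%:R ^+ 2 * rho ^- l * rho ^+ j)
    (B * l.+1%:R ^+ 2 * rho ^- l * H) (maxn K0 l)) => [k j|N|j].
  - by rewrite geq_max => /andP[Kk lk]; exact: hB.
  - rewrite -mulr_sumr; apply: ler_wpM2l; last by apply: sum_geometric; rewrite rho_ge0.
    by rewrite !mulr_ge0// ?exprn_ge0// invr_ge0 ltW.
  rewrite (_ : _ * _ * _ =
     (A * ((-1) ^+ j * (-1) ^+ l) * 1)%:C * (rho%:C ^+ j * (rho%:C)^-1 ^+ l) * h j);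
    last first.
    rewrite !rmorphM /= !rmorphXn /= !rmorphN !rmorph1 (exprNn _ l) (exprNn rho%:C).
    ring.
  apply: ctendsM; last by apply: (@ctends_dual K0 C) => k /hY[].
  (* The quotient of ch al (k + j - l) by ch al k is split at k - l: going up by j contributes
     (-1)^j and coming down by l contributes (-1)^l. *)
  apply: (@ctends_near _ (fun k => (w k * ((-1) ^+ k.+1 * ch al k) *
     ((ch al ((k - l) + j) / ch al (k - l)) * (ch al (k - l) / ch al (k - l + l))) *
     (k%:R / (k + j).+1%:R))%:C * (rho%:C ^+ j * (rho%:C)^-1 ^+ l)) _ _ l).
    move=> k lk; rewrite subnK// /nu /toep ifT; last by natlia.
    rewrite (_ : (k - l + j = k + j - l)%N); last by natlia.
    rewrite /g /bterm (_ : rho%:C ^+ (k + j - l) =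
       rho%:C ^+ k * rho%:C ^+ j * (rho%:C)^-1 ^+ l); last first.
      apply: (@mulIf _ (rho%:C ^+ l)); first by rewrite expf_neq0.
      rewrite exprVn divfK ?expf_neq0// -!exprD; congr (_ ^+ _); natlia.
    rewrite !rmorphM /= !fmorphV /= !rmorphXn /= !rmorph_nat.
    have k0 : (ch al k)%:C != 0 :> R[i].
      by rewrite -cnorm_eq0 cnorm_real gt_eqF// norm_ch_gt0.
    have k1 : (ch al (k - l))%:C != 0 :> R[i].
      by rewrite -cnorm_eq0 cnorm_real gt_eqF// norm_ch_gt0.
    have k2 : (k + j).+1%:R != 0 :> R[i] by rewrite pnatr_eq0.
    have k3 : rho%:C ^+ k != 0 by rewrite expf_neq0.
    exact: ratio_cancel.
  apply: ctendsM (ctends_cst _); apply/ctends_real.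
  apply: cvgM; first apply: cvgM => //.
    have sh1 (f : nat -> R) (x : R) : f k @[k --> \oo] --> x ->
        f (k - l)%N @[k --> \oo] --> x.
      move=> /cvgrPdist_le fx; apply/cvgrPdist_le => d /fx[N _ hN].
      by exists (N + l)%N => // k /= hk; apply: hN => /=; natlia.
    apply: cvgM.
      by apply: (sh1 (fun k => ch al (k + j) / ch al k)); exact: cvg_ch_ratio.
    by apply: (sh1 (fun k => ch al k / ch al (k + l))); exact: cvg_ch_ratioV.
  have := cvg_ratio_shift 0 (j%:R + 1); apply: cvg_trans; apply: near_eq_cvg.
  by near=> k; rewrite /= add0r -natr1 natrD; congr (_ / _); ring.
have qr01 : 0 <= q / rho < 1 by rewrite divr_ge0//= ltr_pdivrMr// mul1r.
have [S hS] := @sum_poly_geometric (q / rho) 4 qr01 isT.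
have sB N : \sum_(i < N) (B * H) * (i.+1%:R ^+ 4 * (q / rho) ^+ i) <= B * H * S.
  by rewrite -mulr_sumr; apply: ler_wpM2l => //; rewrite mulr_ge0// ltW.
have lB i : ctends (fun k => nu k * c k i * q%:C ^+ i) (L i * q%:C ^+ i).
  apply: ctendsM _ (ctends_cst _).
  apply: (@ctends_near _ (fun k => \sum_(l < i.+1) g (i - l)%N *
    (l.+1%:R * tsum (fun j => T Y k j l))) _ _ (maxn K0 i)).
    by move=> k; rewrite geq_max => /andP[Kk ik]; rewrite cE.
  apply: ctends_sum => l; apply: ctendsM (ctends_cst _) _; rewrite -mulrA.
  exact: ctendsM (ctends_cst _) (tlim l).
have [K hK] := tannery fB sB lB e0.
exists K => k Kk N; apply: le_trans (hK k Kk N).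
by apply: ler_sum => i _; rewrite mulrBl.
Unshelve. all: by end_near. Qed.

End Inner.
End CoefficientAsymptotics.

(** * Area integrals and Stokes' formula *)

Section AreaIntegral.
Context {R : realType}.
Implicit Types (f g : R[i] -> R[i]) (z : R[i]).

Local Notation leb := (@lebesgue_measure R).
Local Notation leb2 := (@lebesgue_measure R \x @lebesgue_measure R)%E.

Local Notation RR := (measurableTypeR R * measurableTypeR R)%type.

Definition pt (p : R * R) : R[i] := p.1 +i* p.2.

(** Measurability is required on the whole plane, so that one statement serves every domain and
    every change of variables. *)
Definition cmeas f :=
  measurable_fun [set: RR] (fun p => complex.Re (f (pt p))) /\
  measurable_fun [set: RR] (fun p => complex.Im (f (pt p))).

Lemma cmeas_cst (c : R[i]) : cmeas (fun=> c).
Proof. by split; exact: measurable_cst. Qed.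

Lemma cmeas_id : cmeas (fun z => z).
Proof. by split; [exact: measurable_fst|exact: measurable_snd]. Qed.

Lemma cmeasD f g : cmeas f -> cmeas g -> cmeas (fun z => f z + g z).
Proof.
move=> [f1 f2] [g1 g2]; split.
  by under eq_fun do rewrite cReD; exact: measurable_funD.
by under eq_fun do rewrite cImD; exact: measurable_funD.
Qed.

Lemma cmeasM f g : cmeas f -> cmeas g -> cmeas (fun z => f z * g z).
Proof.
move=> [f1 f2] [g1 g2]; split.
  by under eq_fun do rewrite cReM; apply: measurable_funB; exact: measurable_funM.
by under eq_fun do rewrite cImM; apply: measurable_funD; exact: measurable_funM.
Qed.

Lemma conjcE z : z^* = complex.Re z -i* complex.Im z.
Proof. by case: z. Qed.

Lemma conj_realC (x : R) : (x%:C)^* = x%:C.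
Proof. by rewrite conjcE /= oppr0. Qed.

Lemma cmeasJ f : cmeas f -> cmeas (fun z => (f z)^*).
Proof.
move=> [f1 f2]; split; first by under eq_fun do rewrite conjcE /=.
by under eq_fun do rewrite conjcE /=; exact: measurableT_comp.
Qed.

Lemma cmeasX f n : cmeas f -> cmeas (fun z => f z ^+ n).
Proof.
move=> mf; elim: n => [|n ih].
  by under eq_fun do rewrite expr0; exact: cmeas_cst.
by under eq_fun do rewrite exprS; exact: cmeasM.
Qed.

Lemma cmeas_sum (I : Type) (s : seq I) (F : I -> R[i] -> R[i]) :
  (forall i, cmeas (F i)) -> cmeas (fun z => \sum_(i <- s) F i z).
Proof.
move=> h; elim: s => [|i s ih].
  by under eq_fun do rewrite big_nil; exact: cmeas_cst.
by under eq_fun do rewrite big_cons; exact: cmeasD.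
Qed.

Lemma cmeas_horner (p : {poly R[i]}) : cmeas (fun z => p.[z]).
Proof.
elim/poly_ind: p => [|p c ih]; first by under eq_fun do rewrite horner0; exact: cmeas_cst.
under eq_fun do rewrite hornerMXaddC.
by apply: cmeasD (cmeasM ih cmeas_id) (cmeas_cst c).
Qed.

Lemma horner_bounded (p : {poly R[i]}) (K : R) : exists2 M, 0 <= M &
  forall z, cnorm z <= K -> cnorm p.[z] <= M.
Proof.
elim/poly_ind: p => [|p c [M M0 hM]].
  by exists 0 => // z _; rewrite horner0 cnorm0.
exists (M * `|K| + cnorm c).
  by rewrite addr_ge0 ?cnorm_ge0// mulr_ge0.
move=> z zK; rewrite hornerMXaddC; apply: le_trans (cnormD _ _) _.
rewrite lerD2r cnormM; apply: ler_pM; rewrite ?cnorm_ge0 ?hM//.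
exact: le_trans zK (ler_norm _).
Qed.

Section OnSet.
Variable A : set R[i].
Let D : set RR := [set p | A (pt p)].
Hypothesis mD : measurable D.
Hypothesis finD : (leb2 D < +oo)%E.

Definition bounded_on f := exists M : R, forall z, A z -> cnorm (f z) <= M.

Let integrable_part (h : RR -> R) : measurable_fun setT h ->
  (exists M, forall p, D p -> `|h p| <= M) -> leb2.-integrable D (EFin \o h).
Proof.
move=> mh [M hM]; apply: measurable_bounded_integrable => //.
  exact: measurable_funTS.
exists M; split; [exact: num_real|]; move=> N MN p Dp; apply: le_trans (hM p Dp) _; exact: ltW.
Qed.

Lemma integrable_Re f : cmeas f -> bounded_on f ->
  leb2.-integrable D (EFin \o (fun p => complex.Re (f (pt p)))).
Proof.
move=> [mf _] [M hM]; apply: integrable_part => //; exists M => p Dp.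
exact: le_trans (Re_le_cnorm _) (hM _ Dp).
Qed.

Lemma integrable_Im f : cmeas f -> bounded_on f ->
  leb2.-integrable D (EFin \o (fun p => complex.Im (f (pt p)))).
Proof.
move=> [_ mf] [M hM]; apply: integrable_part => //; exists M => p Dp.
exact: le_trans (Im_le_cnorm _) (hM _ Dp).
Qed.

Lemma eq_area_integral f g : (forall z, A z -> f z = g z) ->
  area_integral A f = area_integral A g.
Proof.
move=> fg; rewrite /area_integral; congr (_ +i* _).
  by apply: eq_Rintegral => p; rewrite inE /= => Ap; rewrite fg.
by apply: eq_Rintegral => p; rewrite inE /= => Ap; rewrite fg.
Qed.

Lemma area_integralD f g : cmeas f -> bounded_on f -> cmeas g -> bounded_on g ->
  area_integral A (fun z => f z + g z) = area_integral A f + area_integral A g.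
Proof.
move=> mf bf mg bg; rewrite /area_integral /=; apply/eqP.
rewrite eq_complex /=; apply/andP; split; apply/eqP.
  under eq_Rintegral do rewrite cReD.
  by apply: RintegralD => //; exact: integrable_Re.
under eq_Rintegral do rewrite cImD.
by apply: RintegralD => //; exact: integrable_Im.
Qed.

Lemma bounded_onM f g : bounded_on f -> bounded_on g ->
  bounded_on (fun z => f z * g z).
Proof.
move=> [M hM] [N hN]; exists (M * N) => z Az; rewrite cnormM.
by apply: ler_pM; rewrite ?cnorm_ge0 ?hM ?hN.
Qed.

Lemma bounded_onD f g : bounded_on f -> bounded_on g ->
  bounded_on (fun z => f z + g z).
Proof.
move=> [M hM] [N hN]; exists (M + N) => z Az; apply: le_trans (cnormD _ _) _.
by rewrite lerD ?hM ?hN.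
Qed.

Lemma bounded_onX f n : bounded_on f -> bounded_on (fun z => f z ^+ n).
Proof.
move=> bf; elim: n => [|n ih].
  by exists 1 => z _; rewrite expr0 cnorm1.
have [M hM] := bounded_onM bf ih; exists M => z Az; rewrite exprS; exact: hM.
Qed.

Lemma bounded_on_cst (c : R[i]) : bounded_on (fun=> c).
Proof. by exists (cnorm c). Qed.

Lemma bounded_onJ f : bounded_on f -> bounded_on (fun z => (f z)^*).
Proof. by move=> [M hM]; exists M => z Az; rewrite cnormJ hM. Qed.

Lemma area_integralZ c f : cmeas f -> bounded_on f ->
  area_integral A (fun z => c * f z) = c * area_integral A f.
Proof.
move=> mf bf; have iR := integrable_Re mf bf; have iI := integrable_Im mf bf.
have bZ x : bounded_on (fun z => x * f z).
  by apply: bounded_onM => //; exact: bounded_on_cst.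
have mZ x : cmeas (fun z => x * f z) by apply: cmeasM => //; exact: cmeas_cst.
have iRZ (x : R) : leb2.-integrable D (EFin \o (fun p => x * complex.Re (f (pt p)))).
  have := integrable_Re (mZ x%:C) (bZ x%:C); congr (_.-integrable _ _).
  by apply/funext => p /=; rewrite cReM /= mul0r subr0.
have iIZ (x : R) : leb2.-integrable D (EFin \o (fun p => x * complex.Im (f (pt p)))).
  have := integrable_Im (mZ x%:C) (bZ x%:C); congr (_.-integrable _ _).
  by apply/funext => p /=; rewrite cImM /= mul0r addr0.
rewrite /area_integral; apply/eqP; rewrite eq_complex cReM cImM /=.
apply/andP; split; apply/eqP.
  under eq_Rintegral do rewrite cReM.
  by rewrite RintegralB ?RintegralZl.
under eq_Rintegral do rewrite cImM.
by rewrite RintegralD ?RintegralZl.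
Qed.

Lemma area_integral_sum (I : Type) (s : seq I) (F : I -> R[i] -> R[i]) :
  (forall i, cmeas (F i)) -> (forall i, bounded_on (F i)) ->
  area_integral A (fun z => \sum_(i <- s) F i z) =
  \sum_(i <- s) area_integral A (F i).
Proof.
move=> mF bF; elim: s => [|i s ih].
  rewrite big_nil (@eq_area_integral _ (fun=> 0 * 0)) => [|z _]; last first.
    by rewrite big_nil mul0r.
  by rewrite (area_integralZ 0 (cmeas_cst 0) (bounded_on_cst 0)) mul0r.
rewrite big_cons -ih -area_integralD//.
- by apply: eq_area_integral => z _; rewrite big_cons.
- exact: cmeas_sum.
- elim: s {ih} => [|j s [M hM]].
    by exists 0 => z _; rewrite big_nil cnorm0.
  have [N hN] := bF j; exists (N + M) => z Az; rewrite big_cons.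
  by apply: le_trans (cnormD _ _) _; rewrite lerD ?hN ?hM.
Qed.

Lemma area_integralJ f : cmeas f -> bounded_on f ->
  area_integral A (fun z => (f z)^*) = (area_integral A f)^*.
Proof.
move=> mf bf; have iI := integrable_Im mf bf.
rewrite /area_integral conjcE /=; congr (_ +i* _).
  by under eq_Rintegral do rewrite conjcE /=.
under eq_Rintegral do rewrite conjcE /= -mulN1r.
by rewrite RintegralZl// mulN1r.
Qed.

Lemma area_integral_le f (M : R) : cmeas f -> (forall z, A z -> cnorm (f z) <= M) ->
  cnorm (area_integral A f) <= 2 * (M * fine (leb2 D)).
Proof.
move=> mf fM; have bf : bounded_on f by exists M.
have key (h : RR -> R) : leb2.-integrable D (EFin \o h) ->
    (forall p, D p -> `|h p| <= M) ->
    `|\int[leb2]_(p in D) h p| <= M * fine (leb2 D).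
  move=> ih hM; apply: le_trans (le_normr_Rintegral mD ih) _.
  rewrite -Rintegral_cst//; apply: le_Rintegral => //.
    exact: integrable_norm.
  by apply: integrable_part; [exact: measurable_cst|exists `|M|].
apply: le_trans (cnorm_le_ReIm _) _; rewrite /area_integral /= mulr2n mulrDl !mul1r lerD//.
  apply: key; first exact: integrable_Re.
  by move=> p Dp; apply: le_trans (Re_le_cnorm _) (fM _ Dp).
apply: key; first exact: integrable_Im.
by move=> p Dp; apply: le_trans (Im_le_cnorm _) (fM _ Dp).
Qed.

End OnSet.

(** Differentiation along the real line, componentwise: the functions concerned contain conjugates
    and are not holomorphic. *)
Definition cder (f f' : R -> R[i]) := forall s : R,
  is_derive s 1 (fun t => complex.Re (f t)) (complex.Re (f' s)) /\
  is_derive s 1 (fun t => complex.Im (f t)) (complex.Im (f' s)).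

Lemma cder_cst (c : R[i]) : cder (fun=> c) (fun=> 0).
Proof. by move=> s; split; exact: is_derive_cst. Qed.

Lemma cderD (f f' g g' : R -> R[i]) : cder f f' -> cder g g' ->
  cder (fun s => f s + g s) (fun s => f' s + g' s).
Proof.
move=> hf hg s; have [f1 f2] := hf s; have [g1 g2] := hg s; split.
  by under eq_fun do rewrite cReD; rewrite cReD; exact: is_deriveD.
by under eq_fun do rewrite cImD; rewrite cImD; exact: is_deriveD.
Qed.

Lemma cderM (f f' g g' : R -> R[i]) : cder f f' -> cder g g' ->
  cder (fun s => f s * g s) (fun s => f' s * g s + f s * g' s).
Proof.
move=> hf hg s; have [f1 f2] := hf s; have [g1 g2] := hg s; split.
  under eq_fun do rewrite cReM.
  apply: (is_derive_eq (is_deriveB (is_deriveM f1 g1) (is_deriveM f2 g2))).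
  rewrite cReD !cReM /GRing.scale /=; ring.
under eq_fun do rewrite cImM.
apply: (is_derive_eq (is_deriveD (is_deriveM f1 g2) (is_deriveM f2 g1))).
by rewrite cImD !cImM /GRing.scale /=; ring.
Qed.

Lemma cderJ (f f' : R -> R[i]) : cder f f' ->
  cder (fun s => (f s)^*) (fun s => (f' s)^*).
Proof.
move=> hf s; have [f1 f2] := hf s; split.
  by under eq_fun do rewrite conjcE /=; rewrite conjcE.
by under eq_fun do rewrite conjcE /=; rewrite conjcE; exact: is_deriveN.
Qed.

Lemma cder_real (f : R -> R) (f' : R -> R) :
  (forall s : R, is_derive s (1 : R) f (f' s)) -> cder (fun s => (f s)%:C) (fun s => (f' s)%:C).
Proof. by move=> hf s; split; [exact: hf|exact: is_derive_cst]. Qed.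

Lemma cder_line (z0 d : R[i]) : cder (fun s => z0 + s%:C * d) (fun=> d).
Proof.
have h : cder (fun s => s%:C) (fun=> 1).
  by apply: (@cder_real id (fun=> 1)) => s; exact: is_derive_id.
have := cderD (cder_cst z0) (cderM h (cder_cst d)); congr (cder _ _).
by apply/funext => s; rewrite mul1r mulr0 addr0 add0r.
Qed.

Lemma cder_horner (p : {poly R[i]}) (f f' : R -> R[i]) : cder f f' ->
  cder (fun s => p.[f s]) (fun s => p^`().[f s] * f' s).
Proof.
move=> hf; elim/poly_ind: p => [|p c ih].
  have := cder_cst 0; congr (cder _ _); apply/funext => s.
    by rewrite horner0.
  by rewrite deriv0 horner0 mul0r.
have := cderD (cderM ih hf) (cder_cst c); congr (cder _ _); apply/funext => s.
  by rewrite hornerMXaddC.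
rewrite derivMXaddC hornerD hornerMX; ring.
Qed.

(* The square makes the truncation of a smooth function C^1. *)
Definition sqpos (t : R) : R := Num.max t 0 ^+ 2.

(** The remainder of the linear approximation is at most h^2 in each of the four sign cases,
    including those where the truncation point is crossed. *)
Lemma is_derive_sqpos (t : R) : is_derive t 1 sqpos (2 * Num.max t 0).
Proof.
have key (h : R) : `|sqpos (t + h) - sqpos t - 2 * Num.max t 0 * h| <= h ^+ 2.
  rewrite /sqpos /Num.max; case: ltP => h1; case: ltP => h2;
    rewrite ler_norml; apply/andP; split; nra.
suff : h^-1 *: (sqpos (h *: 1 + t) - sqpos t) @[h --> 0^'] --> 2 * Num.max t 0.
  move=> h; apply: DeriveDef; first by apply/cvg_ex; exists (2 * Num.max t 0).
  by rewrite /derive; apply/cvg_lim.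
apply/cvgrPdist_le => e e0; near=> h.
have h0 : h != 0 by near: h; exact: nbhs_dnbhs_neq.
rewrite distrC (_ : _ - _ = h^-1 * (sqpos (t + h) - sqpos t - 2 * Num.max t 0 * h)).
  rewrite normrM normfV ler_pdivrMl ?normr_gt0//; apply: le_trans (key h) _.
  rewrite -(real_normK (num_real h)) expr2; apply: ler_wpM2l => //.
  near: h; apply: dnbhs0_le => //.
by rewrite /GRing.scale /= mulr1 (addrC h); field.
Unshelve. all: by end_near. Qed.

Definition ccont (f : R -> R[i]) :=
  continuous (fun s => complex.Re (f s)) /\ continuous (fun s => complex.Im (f s)).

Lemma cder_ccont (f f' : R -> R[i]) : cder f f' -> ccont f.
Proof.
by move=> hf; split => s; apply/differentiable_continuous/derivable1_diffP;
  have [h1 h2] := hf s; exact: ex_derive.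
Qed.

Lemma ccontM (f g : R -> R[i]) : ccont f -> ccont g -> ccont (fun s => f s * g s).
Proof.
move=> [f1 f2] [g1 g2]; split => s.
  under eq_fun do rewrite cReM.
  by apply: cvgB; apply: cvgM; [exact: f1|exact: g1|exact: f2|exact: g2].
under eq_fun do rewrite cImM.
by apply: cvgD; apply: cvgM; [exact: f1|exact: g2|exact: f2|exact: g1].
Qed.

Lemma ccontD (f g : R -> R[i]) : ccont f -> ccont g -> ccont (fun s => f s + g s).
Proof.
move=> [f1 f2] [g1 g2]; split => s.
  by under eq_fun do rewrite cReD; apply: cvgD; [exact: f1|exact: g1].
by under eq_fun do rewrite cImD; apply: cvgD; [exact: f2|exact: g2].
Qed.

Lemma ccont_real (f : R -> R) : continuous f -> ccont (fun s => (f s)%:C).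
Proof. by move=> hf; split => // s; exact: cvg_cst. Qed.

Lemma integral_derive_eq0 (F f : R -> R) (K : R) : 0 < K ->
  (forall x : R, is_derive x (1 : R) F (f x)) -> continuous f ->
  (forall x, K <= `|x| -> F x = 0 /\ f x = 0) ->
  (\int[leb]_x (f x)%:E = 0)%E.
Proof.
move=> K0 dF cf zF.
have -> : (fun x => (f x)%:E) = (EFin \o f) \_ `[- K, K].
  apply/funext => x; rewrite patchE; case: ifPn => //.
  rewrite notin_setE /= in_itv /= => /negP; rewrite -ler_norml -ltNge => h.
  by have [_ ->] := zF x (ltW h).
rewrite -integral_mkcond (@continuous_FTC2 _ _ F)//.
- have KN : K <= `|- K| by rewrite normrN ler_norm.
  by have [-> _] := zF K (ler_norm _); have [-> _] := zF _ KN; rewrite subee.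
- by rewrite gtrN.
- exact: continuous_subspaceT.
- have cF x : {for x, continuous F}.
    by apply/differentiable_continuous/derivable1_diffP; exact: ex_derive.
  split; [by move=> x _; exact: ex_derive| | ].
    by apply: cvg_at_right_filter; exact: cF.
  by apply: cvg_at_left_filter; exact: cF.
- by move=> x _; rewrite derive1E; exact: derive_val.
Qed.

Lemma integrable_compact_support (h : RR -> R) (M K : R) :
  measurable_fun setT h -> (forall p, `|h p| <= M) ->
  (forall p, K <= `|p.1| \/ K <= `|p.2| -> h p = 0) ->
  leb2.-integrable setT (EFin \o h).
Proof.
move=> mh hM hK; pose Q : set RR := `[- K, K] `*` `[- K, K].
have mQ : measurable Q by apply: measurableX; exact: measurable_itv.
have -> : EFin \o h = (EFin \o h) \_ Q.
  apply/funext => p; rewrite patchE; case: ifPn => //.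
  rewrite notin_setE /Q /= !in_itv /= -!ler_norml => /not_andP[|] /negP;
    rewrite -ltNge => /ltW hp; rewrite hK//; by [left|right].
apply/(integrable_mkcond _ mQ); apply: measurable_bounded_integrable => //.
- rewrite [X in (X < _)%E](_ : _ = leb `[(- K)%R, K] * leb `[(- K)%R, K])%E; last first.
    by apply: product_measure1E; exact: measurable_itv.
  by rewrite !lebesgue_measure_itv /= !lte_fin; case: ifP => _;
    rewrite ?mule0 ?mul0e ?ltry// -?EFinD -?EFinM ltry.
- exact: measurable_funTS.
- by exists M; split; [exact: num_real|]; move=> N MN p _; apply: le_trans (hM p) (ltW MN).
Qed.

(** Fubini in the order in which the slices vanish; the bound and the compact support supply
    integrability on the plane. *)
Lemma integral_slices_eq0 (h : RR -> R) (M K : R) :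
  measurable_fun setT h -> (forall p, `|h p| <= M) ->
  (forall p, K <= `|p.1| \/ K <= `|p.2| -> h p = 0) ->
  (forall y, \int[leb]_x (h (x, y))%:E = 0)%E \/
  (forall x, \int[leb]_y (h (x, y))%:E = 0)%E ->
  \int[leb2]_p h p = 0.
Proof.
move=> mh hM hK slices; have ih := integrable_compact_support mh hM hK.
rewrite /Rintegral; case: slices => hs.
  rewrite -(integral21_prod_meas1 ih) /fubini_G /=.
  by under eq_integral do rewrite hs; rewrite integral0.
rewrite -(integral12_prod_meas1 ih) /fubini_F /=.
by under eq_integral do rewrite hs; rewrite integral0.
Qed.

End AreaIntegral.

(** * Stokes' formula for a weight vanishing to second order on the boundary *)

Section StokesIdentity.
Context {R : realType}.
Variables (U A B : {poly R[i]}) (r2 K : R).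
Local Notation leb := (@lebesgue_measure R).
Local Notation leb2 := (@lebesgue_measure R \x @lebesgue_measure R)%E.
Local Notation RR := (measurableTypeR R * measurableTypeR R)%type.

Definition defect (z : R[i]) : R := r2 - cnorm U.[z] ^+ 2.

Hypothesis K_gt0 : 0 < K.
Hypothesis defect_le0 : forall z,
  K <= `|complex.Re z| \/ K <= `|complex.Im z| -> defect z <= 0.

Let G := [set z : R[i] | 0 < defect z].
Let Phi z : R[i] := (sqpos (defect z))%:C * (A.[z] * (B.[z])^*).
(** The derivative of [Phi] in the real direction [d]. It is continuous across the boundary of [G]
    and zero outside, so no boundary term arises. *)
Let D (d z : R[i]) : R[i] :=
  (2 * Num.max (defect z) 0 *
     (- (2 * complex.Re ((U.[z])^* * (U^`().[z] * d)))))%:C * (A.[z] * (B.[z])^*)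
  + (sqpos (defect z))%:C *
    (A^`().[z] * d * (B.[z])^* + A.[z] * (B^`().[z] * d)^*).

Let line (z0 d : R[i]) (s : R) : R[i] := z0 + s%:C * d.

Lemma defectE z : defect z = r2 - complex.Re (U.[z] * (U.[z])^*).
Proof. by rewrite /defect cReM conjcE /= mulrN opprK cnorm_sqr !expr2. Qed.

Let Re_conj_id (u v d : R[i]) : 0 - complex.Re (v * d * u^* + u * (v * d)^*) =
  - (2 * complex.Re (u^* * (v * d))).
Proof. by case: u v d => [u1 u2] [v1 v2] [d1 d2] /=; ring. Qed.

Let is_derive_defect z0 d (s : R) :
  is_derive s (1 : R) (fun t => defect (line z0 d t))
    (- (2 * complex.Re ((U.[line z0 d s])^* * (U^`().[line z0 d s] * d)))).
Proof.
have hU := cder_horner U (cder_line z0 d).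
have [h _] := cderM hU (cderJ hU) s.
under eq_fun do rewrite defectE.
apply: (is_derive_eq (is_deriveB (is_derive_cst r2 s 1) h)).
exact: Re_conj_id.
Qed.

Let cder_Phi z0 d : cder (fun s => Phi (line z0 d s)) (fun s => D d (line z0 d s)).
Proof.
have hA := cder_horner A (cder_line z0 d).
have hB := cder_horner B (cder_line z0 d).
apply: cderM (cderM hA (cderJ hB)).
apply: (@cder_real _ _ (fun s => 2 * Num.max (defect (line z0 d s)) 0 *
     (- (2 * complex.Re ((U.[line z0 d s])^* * (U^`().[line z0 d s] * d)))))) => s.
exact: (@is_derive1_comp _ sqpos _ s _ _ (is_derive_sqpos _) (is_derive_defect z0 d s)).
Qed.

Let defect_continuous z0 d : continuous (fun s => defect (line z0 d s)).
Proof.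
move=> s; apply/differentiable_continuous/derivable1_diffP.
have h := is_derive_defect z0 d s; exact: ex_derive.
Qed.

Let pos_continuous z0 d : continuous (fun s => Num.max (defect (line z0 d s)) 0).
Proof.
move=> s; apply: (@continuous_max _ _ (fun s => defect (line z0 d s)) (fun=> 0)).
  exact: defect_continuous.
exact: cvg_cst.
Qed.

Let ccont_horner (p : {poly R[i]}) z0 d : ccont (fun s => p.[line z0 d s]).
Proof. exact: cder_ccont (cder_horner p (cder_line z0 d)). Qed.

Let ccont_cst (c : R[i]) : ccont (fun _ : R => c).
Proof. exact: cder_ccont (cder_cst c). Qed.

Let ccontJ (f : R -> R[i]) : ccont f -> ccont (fun s => (f s)^*).
Proof.
move=> [f1 f2]; split => s.
  by under eq_fun do rewrite conjcE /=; exact: f1.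
by under eq_fun do rewrite conjcE /=; apply: cvgN; exact: f2.
Qed.

Let ccont_D z0 d : ccont (fun s => D d (line z0 d s)).
Proof.
have cA := ccont_horner A z0 d; have cA' := ccont_horner A^`() z0 d.
have cB := ccont_horner B z0 d; have cB' := ccont_horner B^`() z0 d.
have cU := ccont_horner U z0 d; have cU' := ccont_horner U^`() z0 d.
have cd := ccont_cst d.
have cp := @pos_continuous z0 d.
apply: ccontD; apply: ccontM.
- apply: ccont_real => s; apply: cvgM; first by apply: cvgM; [exact: cvg_cst|exact: cp].
  apply: cvgN; apply: cvgM; first exact: cvg_cst.
  by have [h _] := ccontM (ccontJ cU) (ccontM cU' cd); exact: h.
- exact: ccontM cA (ccontJ cB).
- apply: ccont_real => s; rewrite /sqpos.
  by under eq_fun do rewrite expr2; apply: cvgM; exact: cp.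
- exact: ccontD (ccontM (ccontM cA' cd) (ccontJ cB)) (ccontM cA (ccontJ (ccontM cB' cd))).
Qed.

Let defect_meas : cmeas (fun z => (defect z)%:C).
Proof.
have mU := cmeas_horner U.
have := cmeasD (cmeas_cst r2%:C) (cmeasM (cmeas_cst (-1)) (cmeasM mU (cmeasJ mU))).
congr cmeas; apply/funext => z; rewrite defectE; apply/eqP.
rewrite eq_complex !cReD !cImD !cReM !cImM !conjcE /=.
by apply/andP; split; apply/eqP; ring.
Qed.

Let pos_meas : cmeas (fun z => (Num.max (defect z) 0)%:C).
Proof.
have [h _] := defect_meas; split; last exact: measurable_cst.
by apply: measurable_maxr; [exact: h|exact: measurable_cst].
Qed.

Let sqpos_meas : cmeas (fun z => (sqpos (defect z))%:C).
Proof.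
have := cmeasX 2 pos_meas; congr cmeas; apply/funext => z.
by rewrite /sqpos rmorphXn.
Qed.

Let cmeas_Re (f : R[i] -> R[i]) : cmeas f -> cmeas (fun z => (complex.Re (f z))%:C).
Proof. by move=> [h _]; split; [exact: h|exact: measurable_cst]. Qed.

Let D_meas d : cmeas (D d).
Proof.
have mA := cmeas_horner A; have mA' := cmeas_horner A^`().
have mB := cmeas_horner B; have mB' := cmeas_horner B^`().
have mU := cmeas_horner U; have mU' := cmeas_horner U^`().
have md := cmeas_cst d.
apply: cmeasD; apply: cmeasM.
- have := cmeasM (cmeasM (cmeas_cst 2%:C) pos_meas)
    (cmeasM (cmeas_cst (- 2)%:C) (cmeas_Re (cmeasM (cmeasJ mU) (cmeasM mU' md)))).
  congr cmeas; apply/funext => z.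
  by rewrite -!rmorphM /= mulNr.
- exact: cmeasM mA (cmeasJ mB).
- exact: sqpos_meas.
- exact: cmeasD (cmeasM (cmeasM mA' md) (cmeasJ mB)) (cmeasM mA (cmeasJ (cmeasM mB' md))).
Qed.

Let max_out z : ~ G z -> Num.max (defect z) 0 = 0.
Proof. by move=> /negP; rewrite -leNgt => h; rewrite max_r. Qed.

Let D_out d z : ~ G z -> D d z = 0.
Proof.
move=> /max_out h; rewrite /D /sqpos h mulr0 mul0r expr0n /= mul0r.
by rewrite mul0r addr0.
Qed.

Let Phi_out z : ~ G z -> Phi z = 0.
Proof. by move=> /max_out h; rewrite /Phi /sqpos h expr0n /= mul0r. Qed.

Let far_out z : K <= `|complex.Re z| \/ K <= `|complex.Im z| -> ~ G z.
Proof. by move=> /defect_le0 h; rewrite /G /= => h2; move: h; rewrite leNgt h2. Qed.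

Let near_in z : G z -> cnorm z <= 2 * K.
Proof.
move=> Gz; apply: le_trans (cnorm_le_ReIm z) _.
have h1 : `|complex.Re z| <= K.
  by rewrite leNgt; apply/negP => /ltW h; exact: (far_out (or_introl h)).
have h2 : `|complex.Im z| <= K.
  by rewrite leNgt; apply/negP => /ltW h; exact: (far_out (or_intror h)).
by rewrite mulr2n mulrDl !mul1r lerD.
Qed.

Lemma horner_bounded_on (p : {poly R[i]}) : bounded_on G (fun z => p.[z]).
Proof.
by have [M _ hM] := horner_bounded p (2 * K); exists M => z /near_in; exact: hM.
Qed.

Lemma defect_bounded_on : bounded_on G (fun z => (defect z)%:C).
Proof.
exists r2 => z Gz; rewrite cnorm_real ger0_norm ?(ltW Gz)//.
by rewrite /defect gerBl sqr_ge0.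
Qed.

Let pos_bounded : bounded_on G (fun z => (Num.max (defect z) 0)%:C).
Proof.
have [M hM] := defect_bounded_on; exists M => z Gz.
by have := hM z Gz; rewrite max_l// ltW.
Qed.

Let D_bounded d : exists M, forall z, cnorm (D d z) <= M.
Proof.
have bA := horner_bounded_on A; have bA' := horner_bounded_on A^`().
have bB := horner_bounded_on B; have bB' := horner_bounded_on B^`().
have bU := horner_bounded_on U; have bU' := horner_bounded_on U^`().
have bd := bounded_on_cst G d.
have bRe (f : R[i] -> R[i]) : bounded_on G f ->
    bounded_on G (fun z => (complex.Re (f z))%:C).
  move=> [M hM]; exists M => z /hM; rewrite cnorm_real; apply: le_trans.
  exact: Re_le_cnorm.
have [M hM] : bounded_on G (D d).
  apply: bounded_onD; apply: bounded_onM.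
  - have [M hM] := bounded_onM (bounded_onM (bounded_on_cst G 2%:C) pos_bounded)
      (bounded_onM (bounded_on_cst G (- 2)%:C)
        (bRe _ (bounded_onM (bounded_onJ bU) (bounded_onM bU' bd)))).
    by exists M => z /hM; rewrite -!rmorphM /= mulNr.
  - exact: bounded_onM bA (bounded_onJ bB).
  - have [M hM] := bounded_onX 2 pos_bounded.
    by exists M => z /hM; rewrite /sqpos rmorphXn.
  - exact: bounded_onD (bounded_onM (bounded_onM bA' bd) (bounded_onJ bB))
      (bounded_onM bA (bounded_onJ (bounded_onM bB' bd))).
exists `|M| => z; have [Gz|nGz] := pselect (G z).
  exact: le_trans (hM z Gz) (ler_norm _).
by rewrite D_out// cnorm0.
Qed.

(** On every line parallel to [d] the integrand is the derivative of a function with compact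
    support; horizontal lines serve for d = 1 and vertical ones for d = 'i. *)
Let area_D d : d = 1 \/ d = 'i -> area_integral G (D d) = 0.
Proof.
move=> hd; have [M hM] := D_bounded d; have [mR mI] := D_meas d.
have out (p : RR) : K <= `|p.1| \/ K <= `|p.2| -> D d (pt p) = 0.
  by move=> h; apply: D_out; exact: far_out.
have slice (F : R[i] -> R) (hF0 : F 0 = 0) :
    (forall z0, forall s : R, is_derive s (1 : R)
       (fun t => F (Phi (line z0 d t))) (F (D d (line z0 d s)))) ->
    (forall z0, continuous (fun s => F (D d (line z0 d s)))) ->
    (forall y, \int[leb]_x (F (D d (pt (x, y))))%:E = 0)%E \/
    (forall x, \int[leb]_y (F (D d (pt (x, y))))%:E = 0)%E.
  move=> dF cF; case: hd => dE; [left => y|right => x].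
    have lE s : pt (s, y) = line (0 +i* y) d s.
      by rewrite dE /line /pt mulr1; apply/eqP; rewrite eq_complex /= addr0 add0r !eqxx.
    under eq_integral do rewrite lE.
    apply: (@integral_derive_eq0 _ (fun s => F (Phi (line (0 +i* y) d s))) _ K) => //.
    by move=> s Ks; rewrite -lE; split; rewrite ?D_out ?Phi_out//; apply: far_out; left.
  have lE s : pt (x, s) = line (x%:C) d s.
    rewrite dE /line /pt; apply/eqP; rewrite eq_complex /=.
    by apply/andP; split; apply/eqP; ring.
  under eq_integral do rewrite lE.
  apply: (@integral_derive_eq0 _ (fun s => F (Phi (line x%:C d s))) _ K) => //.
  by move=> s Ks; rewrite -lE; split; rewrite ?D_out ?Phi_out//; apply: far_out; right.
have ext (F : R[i] -> R) (hF0 : F 0 = 0) :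
    \int[leb2]_(p in [set p | G (pt p)]) F (D d (pt p)) = \int[leb2]_p F (D d (pt p)).
  rewrite Rintegral_mkcond; congr (Rintegral _ _ _); apply/funext => p.
  rewrite patchE; case: ifPn => //; rewrite notin_setE /= => h.
  by rewrite D_out.
rewrite /area_integral /=; congr (_ +i* _).
  rewrite (ext (@complex.Re R))//; apply: (@integral_slices_eq0 _ _ M K) => //.
  - by move=> p; apply: le_trans (Re_le_cnorm _) (hM _).
  - by move=> p /out ->.
  apply: slice => // z0.
    by move=> s; have [] := cder_Phi z0 d s.
  by have [] := ccont_D z0 d.
rewrite (ext (@complex.Im R))//; apply: (@integral_slices_eq0 _ _ M K) => //.
- by move=> p; apply: le_trans (Im_le_cnorm _) (hM _).
- by move=> p /out ->.
apply: slice => // z0.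
  by move=> s; have [] := cder_Phi z0 d s.
by have [] := ccont_D z0 d.
Qed.

Lemma measurable_defect_pos : measurable ([set p | G (pt p)] : set RR).
Proof.
have [h _] := defect_meas.
have -> : [set p | G (pt p)] =
    [set: RR] `&` (fun p : RR => defect (pt p)) @^-1` `]0, +oo[.
  by apply/seteqP; split => p /=; rewrite in_itv /= andbT => // -[].
exact: h.
Qed.

Lemma finite_defect_pos : (leb2 ([set p | G (pt p)] : set RR) < +oo)%E.
Proof.
apply: (@le_lt_trans _ _ (leb2 (`[(- K)%R, K] `*` `[(- K)%R, K] : set RR))).
  apply: le_measure; rewrite ?inE.
  - exact: measurable_defect_pos.
  - by apply: measurableX; exact: measurable_itv.
  - move=> p /= Gp; rewrite /= !in_itv /= -!ler_norml; split.
      by rewrite leNgt; apply/negP => /ltW h; exact: (@far_out (pt p) (or_introl h) Gp).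
    by rewrite leNgt; apply/negP => /ltW h; exact: (@far_out (pt p) (or_intror h) Gp).
rewrite [X in (X < _)%E](_ : _ = leb `[(- K)%R, K] * leb `[(- K)%R, K])%E; last first.
  by apply: product_measure1E; exact: measurable_itv.
by rewrite !lebesgue_measure_itv /= !lte_fin; case: ifP => _;
  rewrite ?mule0 ?mul0e ?ltry// -?EFinD -?EFinM ltry.
Qed.

(* The area integral of the z-derivative of sqpos (defect z) A conj(B), which is
   C^1 with compact support, vanishes. *)
Theorem stokes_identity :
  area_integral G (fun z => ((defect z) ^+ 2)%:C * (A^`().[z] * (B.[z])^*)) =
  2 * area_integral G (fun z => (defect z)%:C *
        (U^`().[z] * (U.[z])^* * (A.[z] * (B.[z])^*))).
Proof.
have mA := cmeas_horner A; have mA' := cmeas_horner A^`().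
have mB := cmeas_horner B.
have mU := cmeas_horner U; have mU' := cmeas_horner U^`().
have bA := horner_bounded_on A; have bA' := horner_bounded_on A^`().
have bB := horner_bounded_on B.
have bU := horner_bounded_on U; have bU' := horner_bounded_on U^`().
have bD d : bounded_on G (D d).
  by have [M hM] := D_bounded d; exists M => z _; exact: hM.
have m1 : cmeas (fun z => ((defect z) ^+ 2)%:C * (A^`().[z] * (B.[z])^*)).
  apply: cmeasM (cmeasM mA' (cmeasJ mB)).
  by have := cmeasX 2 defect_meas; congr cmeas; apply/funext => z; rewrite rmorphXn.
have b1 : bounded_on G (fun z => ((defect z) ^+ 2)%:C * (A^`().[z] * (B.[z])^*)).
  apply: bounded_onM (bounded_onM bA' (bounded_onJ bB)).
  have [M hM] := bounded_onX 2 defect_bounded_on.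
  by exists M => z /hM; rewrite rmorphXn.
have m2 : cmeas (fun z => (defect z)%:C *
        (U^`().[z] * (U.[z])^* * (A.[z] * (B.[z])^*))).
  exact: cmeasM defect_meas (cmeasM (cmeasM mU' (cmeasJ mU)) (cmeasM mA (cmeasJ mB))).
have b2 : bounded_on G (fun z => (defect z)%:C *
        (U^`().[z] * (U.[z])^* * (A.[z] * (B.[z])^*))).
  exact: bounded_onM defect_bounded_on
    (bounded_onM (bounded_onM bU' (bounded_onJ bU)) (bounded_onM bA (bounded_onJ bB))).
have mG := measurable_defect_pos; have fG := finite_defect_pos.
(* D 1 - i D i is twice the complex derivative with respect to z, for which the conjugates of [U]
   and [B] are constants. *)
have eqD : area_integral G (fun z => D 1 z + (- 'i) * D 'i z) = 0.
  rewrite area_integralD//; first last.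
  - by apply: bounded_onM => //; exact: bounded_on_cst.
  - by apply: cmeasM => //; exact: cmeas_cst.
  rewrite area_integralZ//.
  by rewrite !area_D ?mulr0 ?addr0//; [right|left].
have eqG : area_integral G (fun z => D 1 z + (- 'i) * D 'i z) =
    area_integral G (fun z => 2 * (((defect z) ^+ 2)%:C * (A^`().[z] * (B.[z])^*)) +
      (- 4) * ((defect z)%:C * (U^`().[z] * (U.[z])^* * (A.[z] * (B.[z])^*)))).
  apply: eq_area_integral => z Gz.
  rewrite /D /sqpos max_l ?(ltW Gz)//.
  have key (t : R) (u u' a a' b b' : R[i]) :
    (2 * t * - (2 * complex.Re (u^* * (u' * 1))))%:C * (a * b^*) +
    (t ^+ 2)%:C * (a' * 1 * b^* + a * (b' * 1)^*) +
    - 'i * ((2 * t * - (2 * complex.Re (u^* * (u' * 'i))))%:C * (a * b^*) +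
      (t ^+ 2)%:C * (a' * 'i * b^* + a * (b' * 'i)^*)) =
    2 * ((t ^+ 2)%:C * (a' * b^*)) + - 4 * (t%:C * (u' * u^* * (a * b^*))).
    case: u => u1 u2; case: u' => v1 v2; case: a => a1 a2; case: a' => a3 a4.
    case: b => b1' b2'; case: b' => b3 b4.
    have -> : (2 : R[i]) = 2%:C by rewrite rmorph_nat.
    have -> : (- 4 : R[i]) = (- 4)%:C by rewrite rmorphN rmorph_nat.
    apply/eqP; rewrite eq_complex /=; apply/andP; split; apply/eqP; ring.
  exact: key.
move: eqD; rewrite eqG area_integralD//; first last.
- by apply: bounded_onM => //; exact: bounded_on_cst.
- by apply: cmeasM => //; exact: cmeas_cst.
- by apply: bounded_onM => //; exact: bounded_on_cst.
- by apply: cmeasM => //; exact: cmeas_cst.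
rewrite !area_integralZ//; set X := area_integral _ _; set Y := area_integral _ _.
move=> e; apply: (@mulfI _ 2); first by rewrite pnatr_eq0.
by apply/eqP; rewrite -subr_eq0 -e; apply/eqP; ring.
Qed.

End StokesIdentity.

(** * Moments of the lemniscate *)

Section LemniscateMoments.
Context {R : realType}.
Variables (m : nat) (r : R).
Hypotheses (hm : (2 <= m)%N) (hr0 : 0 < r) (hr1 : r < 1).
Local Notation leb := (@lebesgue_measure R).
Local Notation leb2 := (@lebesgue_measure R \x @lebesgue_measure R)%E.
Local Notation RR := (measurableTypeR R * measurableTypeR R)%type.

Let rho : R := r ^+ m.
Let U : {poly R[i]} := 'X^m - 1.
Let G : set R[i] := lemniscate m r.

Let m_gt0 : (0 < m)%N. Proof. exact: ltnW. Qed.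
Let rho_gt0 : 0 < rho. Proof. exact: exprn_gt0. Qed.
Let rho_lt1 : rho < 1. Proof. by rewrite exprn_ilt1// ?ltW// -lt0n. Qed.

Let UE z : U.[z] = z ^+ m - 1.
Proof. by rewrite /U hornerD hornerN hornerXn hornerC. Qed.

Lemma lemniscateE z : lemniscate m r z <-> cnorm (z ^+ m - 1) < rho.
Proof. by rewrite /lemniscate /= cnormE ltcR. Qed.

Let G_defect : G = [set z | 0 < defect U (rho ^+ 2) z].
Proof.
apply/seteqP; split => z.
  move=> /lemniscateE h; rewrite /= /defect subr_gt0 UE.
  by rewrite ltr_pXn2r// ?nnegrE ?cnorm_ge0// ltW.
rewrite /= /defect subr_gt0 UE => h; apply/lemniscateE; move: h.
by rewrite ltr_pXn2r// ?nnegrE ?cnorm_ge0// ltW.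
Qed.

(** For |z| >= 2 the modulus of z^m - 1 is at least 1 and so exceeds rho. *)
Let defect_far z : 2 <= `|complex.Re z| \/ 2 <= `|complex.Im z| ->
  defect U (rho ^+ 2) z <= 0.
Proof.
move=> h; have z2 : 2 <= cnorm z.
  by case: h => h; apply: le_trans h _; [exact: Re_le_cnorm|exact: Im_le_cnorm].
rewrite /defect subr_le0 UE; apply: (@le_trans _ _ 1).
  by rewrite exprn_ile1// ltW.
apply: exprn_ege1; have := cnormD (z ^+ m - 1) 1; rewrite subrK cnorm1 cnormX.
have : 2 <= cnorm z ^+ m.
  apply: (le_trans z2); rewrite -{1}[cnorm z]expr1; apply: ler_weXn2l => //.
  by apply: le_trans z2; rewrite ler1n.
lra.
Qed.

Let K0 : 0 < 2 :> R. Proof. by []. Qed.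

Lemma measurable_lemniscate : measurable ([set p | G (pt p)] : set RR).
Proof.
have := measurable_defect_pos U (rho ^+ 2).
by rewrite (_ : [set z | _] = G).
Qed.

Lemma finite_lemniscate : (leb2 ([set p | G (pt p)] : set RR) < +oo)%E.
Proof.
have := finite_defect_pos defect_far; by rewrite (_ : [set z | _] = G).
Qed.

Lemma lemniscate_horner_bounded (p : {poly R[i]}) : bounded_on G (fun z => p.[z]).
Proof. by rewrite G_defect; exact: (horner_bounded_on defect_far). Qed.

Let mG := measurable_lemniscate.
Let fG := finite_lemniscate.

Let t (z : R[i]) : R[i] := (rho ^+ 2)%:C - U.[z] * (U.[z])^*.

Let defectC z : (defect U (rho ^+ 2) z)%:C = t z.
Proof.
rewrite defectE /t conjcE; apply/eqP; rewrite eq_complex cReD cImD cReN cImN.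
by rewrite cImM /=; apply/andP; split; apply/eqP; ring.
Qed.

Let W (n l : nat) (z : R[i]) : R[i] :=
  U^`().[z] * U.[z] ^+ n * ((U^`().[z] * U.[z] ^+ l)^*).

(** Moments with weight t^p, where t = rho^2 - |u|^2. Those wanted have p = 0; Stokes' formula links
    p = 1 to p = 2, and [J_rec] links p + 1 to p. *)
Let J (p n l : nat) : R[i] := area_integral G (fun z => t z ^+ p * W n l z).

Let t_meas p : cmeas (fun z => t z ^+ p).
Proof.
have mU := cmeas_horner U; apply: cmeasX.
have := cmeasD (cmeas_cst (rho ^+ 2)%:C) (cmeasM (cmeas_cst (-1)) (cmeasM mU (cmeasJ mU))).
by congr cmeas; apply/funext => z; rewrite mulN1r.
Qed.

Let W_meas n l : cmeas (W n l).
Proof.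
have mU := cmeas_horner U; have mU' := cmeas_horner U^`().
exact: cmeasM (cmeasM mU' (cmeasX n mU)) (cmeasJ (cmeasM mU' (cmeasX l mU))).
Qed.

Let t_bounded p : bounded_on G (fun z => t z ^+ p).
Proof.
apply: bounded_onX; rewrite G_defect.
have [M hM] := @defect_bounded_on _ U (rho ^+ 2).
by exists M => z /hM; rewrite defectC.
Qed.

Let W_bounded n l : bounded_on G (W n l).
Proof.
have bU := lemniscate_horner_bounded U; have bU' := lemniscate_horner_bounded U^`().
exact: bounded_onM (bounded_onM bU' (bounded_onX n bU))
  (bounded_onJ (bounded_onM bU' (bounded_onX l bU))).
Qed.

Let tW_meas p n l : cmeas (fun z => t z ^+ p * W n l z).
Proof. exact: cmeasM. Qed.

Let tW_bounded p n l : bounded_on G (fun z => t z ^+ p * W n l z).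
Proof. exact: bounded_onM. Qed.

Let J_stokes n l : 2 * J 1 n l.+1 = n%:R * J 2 n.-1 l.
Proof.
have := stokes_identity (U ^+ n) (U^`() * U ^+ l) K0 defect_far.
rewrite -[X in area_integral X _ = _]/[set z | 0 < defect U (rho ^+ 2) z] -G_defect.
rewrite -/G /J.
rewrite (@eq_area_integral _ _ _ (fun z => n%:R * (t z ^+ 2 * W n.-1 l z))); last first.
  move=> z _; rewrite rmorphXn /= defectC deriv_exp hornerMn hornerM horner_exp.
  by rewrite hornerM horner_exp /W -mulr_natl; ring.
rewrite area_integralZ// => ->; congr (2 * _); apply: eq_area_integral => z _.
by rewrite expr1 defectC /W horner_exp hornerM horner_exp exprS !rmorphM /=; ring.
Qed.

Let J_rec p n l : J p.+1 n l = (rho ^+ 2)%:C * J p n l - J p n.+1 l.+1.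
Proof.
have mc c q n' l' : cmeas (fun z => c * (t z ^+ q * W n' l' z)).
  by apply: cmeasM => //; exact: cmeas_cst.
have bc c q n' l' : bounded_on G (fun z => c * (t z ^+ q * W n' l' z)).
  by apply: bounded_onM => //; exact: bounded_on_cst.
rewrite -mulN1r /J -area_integralZ// -area_integralZ// -area_integralD//.
apply: eq_area_integral => z _.
by rewrite exprS {1}/t /W !exprS !rmorphM /=; ring.
Qed.

Let J_conj p n l : J p l n = (J p n l)^*.
Proof.
rewrite /J -area_integralJ//; apply: eq_area_integral => z _.
rewrite rmorphM rmorphXn /= -defectC conj_realC /W; congr (_ * _).
by rewrite [RHS]rmorphM /= conjCK mulrC.
Qed.

(** Stokes' formula turns 2 J 1 into (n + 1) J 2, and [J_rec] leads back to p = 1; the unknown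
    reappears with coefficient n + 1, whence n + 3. *)
Let J1_rec d n : n.+3%:R * J 1 n.+1 (n.+1 + d) =
  n.+1%:R * (rho ^+ 2)%:C * J 1 n (n + d).
Proof.
have := J_stokes n.+1 (n + d); rewrite -addSn /= (J_rec 1) -addSn => e.
have -> : n.+3%:R = 2 + n.+1%:R :> R[i] by rewrite -natrD.
rewrite mulrDl e; ring.
Qed.

Let decay := fun n => \int[leb2]_(p in [set p | G (pt p)])
  ((cnorm U.[pt p] / rho) ^+ n).

Let cnormU_meas : measurable_fun [set: RR] (fun p => cnorm U.[pt p]).
Proof.
have mU := cmeas_horner U; have [h _] := cmeasM mU (cmeasJ mU).
have -> : (fun p : RR => cnorm U.[pt p]) =
    (fun p => Num.sqrt (complex.Re (U.[pt p] * (U.[pt p])^*))).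
  apply/funext => p; rewrite cReM conjcE /= mulrN opprK -!expr2 -cnorm_sqr.
  by rewrite sqrtr_sqr ger0_norm// cnorm_ge0.
apply: measurableT_comp => //.
by apply: continuous_measurable_fun; exact: sqrt_continuous.
Qed.

Let quot_lt1 z : G z -> 0 <= cnorm U.[z] / rho < 1.
Proof.
move=> /lemniscateE h; rewrite divr_ge0 ?cnorm_ge0 ?(ltW rho_gt0)//=.
by rewrite ltr_pdivrMr// mul1r UE.
Qed.

Let quot_meas n : measurable_fun [set: RR] (fun p => (cnorm U.[pt p] / rho) ^+ n).
Proof.
by apply: measurable_funX; apply: measurable_funM => //; exact: measurable_cst.
Qed.

Let cvg_decay : decay n @[n --> \oo] --> (0 : R).
Proof.
have dc := @dominated_convergence _ RR R leb2 [set p | G (pt p)] mG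
  (fun n p => ((cnorm U.[pt p] / rho) ^+ n)%:E) (cst 0%E) (cst 1%E).
have [||||| _ _ h] := dc.
- by move=> n; apply/measurable_EFinP; exact: measurable_funTS.
- exact: measurable_cst.
- apply: aeW => p Gp; have /andP[q0 q1] := quot_lt1 Gp.
  apply/cvg_EFin; first by near=> n.
  by apply: cvg_expr; rewrite ger0_norm.
- have := @measurable_bounded_integrable _ RR R leb2 (cst 1) _ mG fG
    (measurable_cst _); apply.
  by exists 1; split => // x x1 p _; rewrite /= normr1 ltW.
- apply: aeW => p n Gp; have /andP[q0 q1] := quot_lt1 Gp.
  by rewrite /= lee_fin ger0_norm ?exprn_ge0// exprn_ile1// ltW.
by move: h; rewrite integral0; exact: fine_cvg.
Unshelve. all: by end_near. Qed.

(** On G the quotient |u| / rho is below 1, so the integrals of its powers tend to 0 by dominated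
    convergence. This fixes the constant that the recursion for p = 0 leaves open. *)
Let J0_decay d : ctends (fun n => J 0 n (n + d) / (rho ^+ (2 * n))%:C) 0.
Proof.
have [M hM] := lemniscate_horner_bounded U^`().
have key n : cnorm (J 0 n (n + d) / (rho ^+ (2 * n))%:C) <=
    2 * (M ^+ 2 * decay n).
  have M0 : 0 <= M.
    apply: le_trans (cnorm_ge0 _) (hM 1 _).
    by apply/lemniscateE; rewrite expr1n subrr cnorm0.
  have r0 : 0 < rho ^+ (2 * n) by rewrite exprn_gt0.
  rewrite cnormM cnormV cnorm_real (ger0_norm (ltW r0)) ler_pdivrMr//.
  have Wle z : G z -> cnorm (W n (n + d) z) <=
      M ^+ 2 * rho ^+ (2 * n) * (cnorm U.[z] / rho) ^+ n.
    move=> Gz; have /andP[q0 q1] := quot_lt1 Gz.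
    rewrite /W cnormM cnormJ !cnormM !cnormX.
    have hM' := hM z Gz; move: q0 q1.
    set q := cnorm U.[z] / rho => q0 q1.
    have -> : cnorm U.[z] = rho * q by rewrite mulrCA divff ?mulr1// gt_eqF.
    have x0 : 0 <= rho * q by rewrite mulr_ge0// ltW.
    have xr : rho * q <= rho by rewrite ler_piMr// ltW.
    have x1 : (rho * q) ^+ (n + d) <= rho ^+ n.
      rewrite exprD -[leRHS]mulr1; apply: ler_pM; rewrite ?exprn_ge0//.
        by apply: lerXn2r; rewrite ?nnegrE// ltW.
      by rewrite exprn_ile1// (le_trans xr)// ltW.
    have -> : M ^+ 2 * rho ^+ (2 * n) * q ^+ n = (M * (rho * q) ^+ n) * (M * rho ^+ n).
      rewrite mul2n -addnn exprD (exprMn n rho q).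
      by move: (rho ^+ n) (q ^+ n) => x y; ring.
    apply: ler_pM; rewrite ?mulr_ge0 ?cnorm_ge0 ?exprn_ge0//.
      by apply: ler_wpM2r => //; exact: exprn_ge0.
    by apply: ler_pM; rewrite ?cnorm_ge0 ?exprn_ge0.
  have half (h : RR -> R) : measurable_fun setT h ->
      (forall p : RR, G (pt p) -> `|h p| <= cnorm (W n (n + d) (pt p))) ->
      `|\int[leb2]_(p in [set p | G (pt p)]) h p| <= M ^+ 2 * decay n * rho ^+ (2 * n).
    move=> mh hW.
    have bint (g : RR -> R) : measurable_fun setT g -> (exists N, forall p : RR, G (pt p) -> `|g p| <= N) ->
        leb2.-integrable [set p | G (pt p)] (EFin \o g).
      move=> mg [N gN]; apply: measurable_bounded_integrable => //.
        exact: measurable_funTS.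
      exists N; split; [exact: num_real|] => x Nx p Gp.
      exact: le_trans (gN p Gp) (ltW Nx).
    have hB p : G (pt p) -> `|h p| <= M ^+ 2 * rho ^+ (2 * n) * (cnorm U.[pt p] / rho) ^+ n.
      by move=> Gp; apply: le_trans (hW p Gp) (Wle _ Gp).
    have C0 : 0 <= M ^+ 2 * rho ^+ (2 * n) by rewrite mulr_ge0 ?sqr_ge0// ltW.
    have ih : leb2.-integrable [set p | G (pt p)] (EFin \o h).
      apply: bint => //; exists (M ^+ 2 * rho ^+ (2 * n)) => p Gp.
      apply: le_trans (hB p Gp) _; have /andP[q0 q1] := quot_lt1 Gp.
      by rewrite ler_piMr// exprn_ile1// ltW.
    have iq : leb2.-integrable [set p | G (pt p)]
        (EFin \o (fun p => (cnorm U.[pt p] / rho) ^+ n)).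
      apply: bint => //; exists 1 => p Gp; have /andP[q0 q1] := quot_lt1 Gp.
      by rewrite ger0_norm ?exprn_ge0// exprn_ile1// ltW.
    have icq : leb2.-integrable [set p | G (pt p)]
        (EFin \o (fun p => M ^+ 2 * rho ^+ (2 * n) * (cnorm U.[pt p] / rho) ^+ n)).
      apply: bint.
        by apply: measurable_funM => //; exact: measurable_cst.
      exists (M ^+ 2 * rho ^+ (2 * n)) => p Gp; have /andP[q0 q1] := quot_lt1 Gp.
      rewrite normrM (ger0_norm C0); apply: ler_piMr => //.
      by rewrite ger0_norm ?exprn_ge0// exprn_ile1// ltW.
    apply: le_trans (le_normr_Rintegral mG ih) _.
    rewrite mulrAC /decay -RintegralZl//; apply: le_Rintegral => //.
    exact: integrable_norm.
  have [mR mI] := W_meas n (n + d).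
  rewrite /J (@eq_area_integral _ _ _ (W n (n + d))) => [|z _]; last first.
    by rewrite expr0 mul1r.
  apply: le_trans (cnorm_le_ReIm _) _; rewrite /area_integral /=.
  rewrite mulr2n mulrDl mul1r mulrDl; apply: lerD; apply: half => // p _.
    exact: Re_le_cnorm.
  exact: Im_le_cnorm.
have lim0 : 2 * (M ^+ 2 * decay n) @[n --> \oo] --> (0 : R).
  have : 2 * (M ^+ 2 * decay n) @[n --> \oo] --> (2 * (M ^+ 2 * 0) : R).
    by apply: cvgMr; apply: cvgMr; exact: cvg_decay.
  by rewrite !mulr0.
move=> e e0; move/cvgrPdist_le : lim0 => /(_ e e0)[N _ hN]; exists N => n Nn.
rewrite subr0; apply: le_trans (key n) _.
have := hN n Nn; rewrite /= sub0r normrN; apply: le_trans; exact: ler_norm.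
Qed.

Let rhoC_neq0 n : (rho ^+ n)%:C != 0 :> R[i].
Proof. by rewrite -cnorm_eq0 cnorm_real normr_eq0 gt_eqF// exprn_gt0. Qed.

(** [J_stokes] with n = 0 kills J 1 0 (d + 1), hence every J 1 on that diagonal; then J 0 divided by
    rho^(2 k) is constant along it, and the constant is 0 by [J0_decay]. *)
Let J0_offdiag_lt n d : J 0 n (n + d.+1) = 0.
Proof.
have J1 k : J 1 k (k + d.+1) = 0.
  elim: k => [|k ih].
    have := J_stokes 0 d; rewrite mul0r add0n => /eqP.
    by rewrite mulf_eq0 pnatr_eq0 => /eqP.
  have := J1_rec d.+1 k; rewrite ih mulr0 => /eqP.
  by rewrite mulf_eq0 pnatr_eq0 => /eqP.
have J0 k : J 0 k (k + d.+1) = (rho ^+ (2 * k))%:C * J 0 0 d.+1.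
  elim: k => [|k ih]; first by rewrite muln0 expr0 mul1r add0n.
  have := J_rec 0 k (k + d.+1); rewrite J1 => /esym/eqP; rewrite subr_eq0 => /eqP <-.
  by rewrite ih mulnS exprD !rmorphM /=; ring.
have : ctends (fun k => J 0 k (k + d.+1) / (rho ^+ (2 * k))%:C) (J 0 0 d.+1).
  apply: ctends_ext (ctends_cst _) => k.
  by rewrite J0 mulrAC divff ?mul1r.
by move=> /ctends_uniq /(_ (J0_decay d.+1)); rewrite J0 => ->; rewrite mulr0.
Qed.

Lemma moment_offdiag n l : n != l -> J 0 n l = 0.
Proof.
rewrite neq_ltn => /orP[nl|ln].
  by rewrite -(subnKC nl) addSnnS J0_offdiag_lt.
by rewrite J_conj -(subnKC ln) addSnnS J0_offdiag_lt conjC0.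
Qed.

(** The increments of J 0 k k / rho^(2 k) are multiples of 1 / ((k + 1) (k + 2)) and telescope, so
    the quotient is a constant plus c / (k + 1); decay makes the constant vanish. *)
Lemma moment_diag n : J 0 n n = (rho ^+ (2 * n))%:C / n.+1%:R * J 0 0 0.
Proof.
pose c := 2 * J 1 0 0 / (rho ^+ 2)%:C.
have nn0 k : k.+1%:R != 0 :> R[i] by rewrite pnatr_eq0.
have r2S k : (rho ^+ (2 * k.+1))%:C = (rho ^+ 2)%:C * (rho ^+ (2 * k))%:C :> R[i].
  by rewrite mulnS exprD rmorphM.
have J1 k : J 1 k k = (rho ^+ (2 * k))%:C * (2 * J 1 0 0 / (k.+1%:R * k.+2%:R)).
  elim: k => [|k ih].
    by rewrite muln0 expr0 mul1r mul1r mulrC mulKf.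
  apply: (@mulfI _ k.+3%:R) => //.
  have := J1_rec 0 k; rewrite !addn0 => ->; rewrite ih r2S.
  have key (x y w p q X : R[i]) : x != 0 -> y != 0 -> w != 0 ->
    x * p * (q * (X / (x * y))) = w * (p * q * (X / (y * w))).
    by move=> hx hy hw; field; rewrite hx hy hw.
  exact: key.
have J0 k : J 0 k k / (rho ^+ (2 * k))%:C = (J 0 0 0 - c) + c / k.+1%:R.
  elim: k => [|k ih].
    by rewrite muln0 expr0 !divr1 subrK.
  have := J_rec 0 k k; rewrite J1 => e.
  have -> : J 0 k.+1 k.+1 = (rho ^+ 2)%:C * J 0 k k -
      (rho ^+ (2 * k))%:C * (2 * J 1 0 0 / (k.+1%:R * k.+2%:R)) by rewrite e; ring.
  rewrite -[J 0 k k](divfK (rhoC_neq0 (2 * k))) ih r2S /c.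
  have -> : k.+2%:R = k.+1%:R + 1 :> R[i] by rewrite natr1.
  have key (x p q X Y : R[i]) : x != 0 -> x + 1 != 0 -> p != 0 -> q != 0 ->
    (p * ((Y - X / p + X / p / x) * q) - q * (X / (x * (x + 1)))) / (p * q) =
    Y - X / p + X / p / (x + 1).
    by move=> hx hy hp hq; field; rewrite hx hy hp hq.
  by apply: key => //; rewrite natr1.
have clim : ctends (fun k => J 0 k (k + 0) / (rho ^+ (2 * k))%:C) (J 0 0 0 - c).
  rewrite -[J 0 0 0 - c]addr0 -[X in ctends _ (_ + X)](mulr0 c).
  apply: (@ctends_ext _ (fun k => (J 0 0 0 - c) + c * (harmonic k)%:C)) => [k|].
    by rewrite addn0 J0 /harmonic /= fmorphV rmorph_nat.
  apply: ctendsD (ctends_cst _) (ctendsM (ctends_cst _) _).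
  by apply/ctends_real; exact: cvg_harmonic.
have /eqP := ctends_uniq clim (J0_decay 0); rewrite subr_eq0 => /eqP e0.
have := J0 n; rewrite -e0 subrr add0r => e.
by rewrite -[J 0 n n](divfK (rhoC_neq0 (2 * n))) e; ring.
Qed.

Lemma moment_scale : exists kap : R[i], forall n l,
  area_integral G (fun z => U^`().[z] * U.[z] ^+ n * ((U^`().[z] * U.[z] ^+ l)^*)) =
  (n == l)%:R * ((rho ^+ (2 * n))%:C / n.+1%:R * kap).
Proof.
exists (J 0 0 0) => n l.
rewrite (@eq_area_integral _ _ _ (fun z => t z ^+ 0 * W n l z)) => [|z _]; last first.
  by rewrite expr0 mul1r.
by rewrite -/(J 0 n l); case: eqVneq => [<-|/moment_offdiag ->];
  rewrite ?mul1r ?mul0r// moment_diag.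
Qed.

End LemniscateMoments.

(** * Rotations preserve area, and roots of unity *)

Section Rotation.
Context {R : realType}.
Local Notation leb := (@lebesgue_measure R).
Local Notation leb2 := (@lebesgue_measure R \x @lebesgue_measure R)%E.
Local Notation RR := (measurableTypeR R * measurableTypeR R)%type.

Lemma lebesgue_measure_translate (c : R) (A : set R) : measurable A ->
  pushforward leb (fun x => x + c : measurableTypeR R) A = leb A.
Proof.
have mc : measurable_fun [set: measurableTypeR R] (fun x : measurableTypeR R => x + c : measurableTypeR R).
  by apply: measurable_funD => //; exact: measurable_cst.
move=> mA; apply/esym/lebesgue_measure_unique => //= _ [[a b]] _ <-.
rewrite /pushforward (_ : _ @^-1` _ = `]a - c, b - c]%classic); last first.
  by apply/seteqP; split => x /=; rewrite !in_itv /= ltrBlDr lerBrDr.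
rewrite !lebesgue_measure_itv /= !lte_fin; case: ltP => ab.
  by rewrite ltrD2r ab -!EFinD; congr (_%:E); ring.
by rewrite ltrD2r ltNge ab.
Qed.

Lemma ge0_integral_translate (c : R) (f : measurableTypeR R -> \bar R) :
  measurable_fun setT f -> (forall x, 0 <= f x)%E ->
  (\int[leb]_x f (x + c)%R = \int[leb]_x f x)%E.
Proof.
have mc : measurable_fun [set: measurableTypeR R] (fun x : measurableTypeR R => x + c : measurableTypeR R).
  by apply: measurable_funD => //; exact: measurable_cst.
move=> mf f0; have := @ge0_integral_pushforward _ _ _ _ R _ mc leb setT f
  measurableT mf (fun y _ => f0 y).
rewrite preimage_setT => <-; apply: eq_measure_integral => A mA _.
exact: lebesgue_measure_translate.
Qed.

(** Stated through integrals of nonnegative functions: this form composes, and for a shear it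
    follows from Tonelli's theorem and translation invariance on each line. *)
Definition area_preserving (phi : RR -> RR) := measurable_fun setT phi /\
  forall f : RR -> \bar R, measurable_fun setT f -> (forall p, 0 <= f p)%E ->
    (\int[leb2]_p f (phi p) = \int[leb2]_p f p)%E.

Lemma area_preserving_comp (phi psi : RR -> RR) :
  area_preserving phi -> area_preserving psi -> area_preserving (phi \o psi).
Proof.
move=> [mphi hphi] [mpsi hpsi]; split; first exact: measurableT_comp.
move=> f mf f0; rewrite -(hphi f)// -(hpsi (f \o phi))//.
  exact: measurableT_comp.
by move=> p; exact: f0.
Qed.

Lemma area_preserving_shearx (c : R) :
  area_preserving (fun p => (p.1 + c * p.2, p.2)).
Proof.
have mphi : measurable_fun [set: RR] ((fun p => (p.1 + c * p.2, p.2)) : RR -> RR).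
  apply/measurable_fun_pairP; split; last exact: measurable_snd.
  by apply: measurable_funD => //; apply: measurable_funM => //; exact: measurable_cst.
split=> // f mf f0; rewrite [LHS]fubini_tonelli2//; last exact: measurableT_comp.
rewrite [RHS]fubini_tonelli2//; apply: eq_integral => y _; rewrite /fubini_G /=.
rewrite (@ge0_integral_translate (c * y) (fun x => f (x, y)))//.
exact: measurableT_comp.
Qed.

Lemma area_preserving_sheary (c : R) :
  area_preserving (fun p => (p.1, p.2 + c * p.1)).
Proof.
have mphi : measurable_fun [set: RR] ((fun p => (p.1, p.2 + c * p.1)) : RR -> RR).
  apply/measurable_fun_pairP; split; first exact: measurable_fst.
  by apply: measurable_funD => //; apply: measurable_funM => //; exact: measurable_cst.
split=> // f mf f0; rewrite [LHS]fubini_tonelli1//; last exact: measurableT_comp.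
rewrite [RHS]fubini_tonelli1//; apply: eq_integral => x _; rewrite /fubini_F /=.
rewrite (@ge0_integral_translate (c * x) (fun y => f (x, y)))//.
exact: measurableT_comp.
Qed.

(* A rotation is a product of three shears. *)
Lemma area_preserving_rotation (w : R[i]) : cnorm w = 1 -> complex.Im w != 0 ->
  area_preserving (fun p => (complex.Re (w * pt p), complex.Im (w * pt p))).
Proof.
case: w => c s w1 /= s0; have cs : c ^+ 2 + s ^+ 2 = 1.
  by rewrite -[1](expr1n _ 2) -w1 cnorm_sqr.
have := area_preserving_comp (area_preserving_shearx ((c - 1) / s))
  (area_preserving_comp (area_preserving_sheary s)
    (area_preserving_shearx ((c - 1) / s))).
congr area_preserving; apply/funext => -[x y] /=; congr (_, _).
  have -> : s * y = (1 - c ^+ 2) / s * y.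
    by rewrite -cs; field.
  by field.
by field.
Qed.

Lemma ge0_integral_area_preserving (phi : RR -> RR) (D : set RR) (f : RR -> \bar R) :
  area_preserving phi -> measurable D -> measurable_fun setT f ->
  (forall p, 0 <= f p)%E ->
  (\int[leb2]_(p in phi @^-1` D) f (phi p) = \int[leb2]_(p in D) f p)%E.
Proof.
move=> [mphi hphi] mD mf f0; rewrite integral_mkcond [RHS]integral_mkcond -[RHS]hphi.
- by apply: eq_integral => p _; rewrite !patchE.
- by apply/(measurable_restrictT _ mD); exact: measurable_funTS.
- by move=> p; exact: erestrict_ge0.
Qed.

Lemma integral_area_preserving (phi : RR -> RR) (D : set RR) (h : RR -> R) :
  area_preserving phi -> measurable D -> measurable_fun setT h ->
  \int[leb2]_(p in phi @^-1` D) h (phi p) = \int[leb2]_(p in D) h p.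
Proof.
move=> ap mD mh; have mh' : measurable_fun setT (EFin \o h) by exact/measurable_EFinP.
rewrite /Rintegral; congr fine; rewrite integralE [RHS]integralE; congr (_ - _)%E.
  rewrite -(ge0_integral_area_preserving ap mD (measurable_funepos mh'))//.
  by apply: eq_integral => p _; rewrite !funeposE.
rewrite -(ge0_integral_area_preserving ap mD (measurable_funeneg mh'))//.
by apply: eq_integral => p _; rewrite !funenegE.
Qed.

Lemma area_integral_comp (A : set R[i]) (f : R[i] -> R[i]) (w : R[i]) :
  measurable ([set p | A (pt p)] : set RR) -> cmeas f ->
  cnorm w = 1 -> complex.Im w != 0 ->
  area_integral [set z | A (w * z)] (fun z => f (w * z)) = area_integral A f.
Proof.
move=> mA [fR fI] w1 w0; have ap := area_preserving_rotation w1 w0.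
have e (p : RR) : pt (complex.Re (w * pt p), complex.Im (w * pt p)) = w * pt p.
  by rewrite /pt /=; case: (w * _).
rewrite /area_integral -(integral_area_preserving ap mA fR).
rewrite -(integral_area_preserving ap mA fI) /preimage /=.
rewrite (_ : [set p : R * R | A (w * _)] =
  [set t | A (pt (complex.Re (w * pt t), complex.Im (w * pt t)))]).
  by congr (_ +i* _); apply: eq_Rintegral => p _; rewrite e.
by apply/seteqP; split => p /=; rewrite e.
Qed.

Lemma measurable_rotate (A : set R[i]) (w : R[i]) :
  measurable ([set p | A (pt p)] : set RR) ->
  cnorm w = 1 -> complex.Im w != 0 ->
  measurable ([set p | A (w * pt p)] : set RR).
Proof.
move=> mA w1 w0; have [mphi _] := area_preserving_rotation w1 w0.
rewrite (_ : [set p | A (w * _)] =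
  (fun p => (complex.Re (w * pt p), complex.Im (w * pt p))) @^-1` [set p | A (pt p)]).
  by rewrite -(setTI (_ @^-1` _)); exact: mphi.
by apply/seteqP; split => p /=; rewrite /pt /=; case: (w * _).
Qed.

Lemma cexpD (z w : R[i]) : cexp (z + w) = cexp z * cexp w.
Proof.
rewrite /cexp cReD cImD expRD rmorphM /= sinD cosD; apply/eqP.
by rewrite eq_complex /=; apply/andP; split; apply/eqP; ring.
Qed.

Lemma cexp0 : cexp (0 : R[i]) = 1.
Proof. by rewrite /cexp /= expR0 cos0 sin0 mul1r. Qed.

Lemma cexp_neq0 (z : R[i]) : cexp z != 0.
Proof.
apply/eqP => z0; have := cexpD z (- z); rewrite z0 mul0r subrr cexp0.
by move/eqP; rewrite oner_eq0.
Qed.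

Lemma cexpMn (z : R[i]) n : cexp (n%:R * z) = cexp z ^+ n.
Proof.
elim: n => [|n ih]; first by rewrite mul0r cexp0 expr0.
by rewrite -natr1 mulrDl mul1r cexpD ih exprSr.
Qed.

Lemma cnorm_cexp (z : R[i]) : cnorm (cexp z) = expR (complex.Re z).
Proof.
rewrite /cexp cnormM cnorm_real ger0_norm ?expR_ge0// -[RHS]mulr1; congr (_ * _).
have : cnorm (cos (complex.Im z) +i* sin (complex.Im z)) ^+ 2 = 1.
  by rewrite cnorm_sqr /= cos2Dsin2.
move/eqP; rewrite sqrf_eq1 => /orP[/eqP//|/eqP e].
by have := cnorm_ge0 (cos (complex.Im z) +i* sin (complex.Im z)); rewrite e; lra.
Qed.

Lemma cexp_imag (t : R) : cexp (t *i) = cos t +i* sin t.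
Proof. by rewrite /cexp /= expR0 mul1r. Qed.

Lemma cexp_2pi_nat n : cexp ((2 * pi * n%:R : R) *i) = 1.
Proof.
have -> : (2 * pi * n%:R : R) *i = n%:R * ((2 * pi : R) *i).
  by rewrite -(rmorph_nat (@real_complex R)); apply/eqP; rewrite eq_complex /=;
    apply/andP; split; apply/eqP; ring.
by rewrite cexpMn cexp_imag mulr_natl cos2pi sin2pi expr1n.
Qed.

Lemma unit_rootX m j n : unit_root R m j ^+ n = unit_root R m (j * n).
Proof.
rewrite /unit_root -cexpMn; congr cexp.
rewrite -(rmorph_nat (@real_complex R)) natrM; apply/eqP; rewrite eq_complex /=.
by apply/andP; split; apply/eqP; ring.
Qed.

Lemma unit_root_exp m j : (0 < m)%N -> unit_root R m j ^+ m = 1.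
Proof.
move=> m0; rewrite unit_rootX /unit_root -(cexp_2pi_nat j); congr (cexp (_ *i)).
by rewrite natrM; field; rewrite pnatr_eq0 -lt0n.
Qed.

(** With y half the angle, cos (2 y) = 1 would force sin y = 0, while 0 < y < pi. *)
Lemma unit_root_neq1 m d : (0 < d < m)%N -> unit_root R m d != 1.
Proof.
move=> /andP[d0 dm]; have m0 : 0 < m%:R :> R by rewrite ltr0n; exact: leq_trans dm.
rewrite /unit_root cexp_imag; apply/eqP => -[c1 _].
pose y : R := pi * d%:R / m%:R; have y0 : 0 < y.
  by rewrite divr_gt0// mulr_gt0 ?pi_gt0 ?ltr0n.
have ypi : y < pi by rewrite ltr_pdivrMr// ltr_pM2l ?pi_gt0// ltr_nat.
have := @sin_gt0_pi _ y; rewrite y0 ypi => /(_ isT); have := cos2Dsin2 y; move: c1.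
rewrite (_ : _ / _ = y + y); last by rewrite /y; field; rewrite gt_eqF.
by rewrite cosD -!expr2; nra.
Qed.

End Rotation.

Section RotationMoments.
Context {R : realType}.
Variables (m : nat) (r : R).
Hypotheses (hm : (2 <= m)%N) (hr0 : 0 < r) (hr1 : r < 1).

(** Rotation by w = exp (2 pi i / m) preserves the domain and multiplies the integrand by w^(a - b),
    which is not 1. *)
Lemma moment_class a b : a != b %[mod m] ->
  area_integral (lemniscate m r) (fun z => z ^+ a * (z ^+ b)^*) = 0.
Proof.
move=> ab; have m0 : (0 < m)%N by exact: ltnW.
(* [b * m.-1] plays the role of -b modulo m. *)
have eb : (m * b = b + b * m.-1)%N by rewrite -mulnS (prednK m0) mulnC.
have hd : (0 < (a + b * m.-1) %% m < m)%N.
  rewrite ltn_pmod// andbT lt0n; apply: contra ab => /eqP h0.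
  by rewrite -(eqn_modDr (b * m.-1)) h0 -eb modnMr.
(* The shear decomposition divides by the imaginary part, which is 0 for w = -1 when m = 2. The half
   angle [v] has positive imaginary part, and rotating by it twice gives [w]. *)
pose v : R[i] := cexp ((pi / m%:R) *i); pose w := unit_root R m 1.
have vvw : v * v = w.
  rewrite /v /w /unit_root -cexpD; congr cexp; apply/eqP; rewrite eq_complex /=.
  by apply/andP; split; apply/eqP; ring.
have wX n : w ^+ n = unit_root R m n by rewrite unit_rootX mul1n.
have wm : w ^+ m = 1 by exact: unit_root_exp.
clearbody w.
have v1 : cnorm v = 1 by rewrite /v cnorm_cexp /= expR0.
have v0 : complex.Im v != 0.
  rewrite /v cexp_imag /= gt_eqF// sin_gt0_pi// divr_gt0 ?pi_gt0 ?ltr0n//=.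
  by rewrite ltr_pdivrMr ?ltr0n// ltr_pMr ?pi_gt0// ltr1n.
have mG := measurable_lemniscate m hr0.
have mf (x : R[i]) : cmeas (fun z => (x * z) ^+ a * ((x * z) ^+ b)^*).
  have mx : cmeas (fun z => x * z) by exact: cmeasM (cmeas_cst x) cmeas_id.
  exact: cmeasM (cmeasX a mx) (cmeasJ (cmeasX b mx)).
set I := LHS; have bf : bounded_on (lemniscate m r) (fun z => z ^+ a * (z ^+ b)^*).
  have bz : bounded_on (lemniscate m r) (fun z : R[i] => z).
    have [M hM] := lemniscate_horner_bounded hm hr0 hr1 'X.
    by exists M => z /hM; rewrite hornerX.
  exact: bounded_onM (bounded_onX a bz) (bounded_onJ (bounded_onX b bz)).
have f1 : cmeas (fun z : R[i] => z ^+ a * (z ^+ b)^*).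
  by have := mf 1; congr cmeas; apply/funext => z; rewrite mul1r.
have e : area_integral (lemniscate m r) (fun z => (w * z) ^+ a * ((w * z) ^+ b)^*) = I.
  rewrite /I -(area_integral_comp mG f1 v1 v0).
  rewrite -(area_integral_comp (measurable_rotate mG v1 v0) (mf v) v1 v0).
  rewrite (_ : [set z | _] = lemniscate m r); last first.
    by apply/seteqP; split => z /=; rewrite mulrA vvw !lemniscateE
      exprMn wm mul1r.
  by apply: eq_area_integral => z _; rewrite mulrA vvw.
pose c : R[i] := w ^+ a * (w ^+ b)^*.
have cI : c * I = I.
  rewrite -[RHS]e -(area_integralZ mG (finite_lemniscate hm hr0 hr1) c f1 bf).
  by apply: eq_area_integral => z _; rewrite /c !exprMn [X in _ = _ * X](rmorphM Num.conj) mulrACA.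
have [/eqP c1|c1] := boolP (c == 1); last first.
  move/eqP: cI; rewrite -subr_eq0 -{2}[I]mul1r -mulrBl mulf_eq0 subr_eq0 (negbTE c1).
  by move/eqP.
have wb1 : (w ^+ b)^* * w ^+ b = 1.
  have : cnorm (w ^+ b) = 1 by rewrite wX /unit_root cnorm_cexp /= expR0.
  move=> n1; apply/eqP; rewrite eq_complex conjcE cReM cImM /=.
  rewrite mulNr opprK -!expr2 -cnorm_sqr n1 expr1n eqxx /=; apply/eqP; ring.
have wab : w ^+ a = w ^+ b by rewrite -[RHS]mul1r -c1 /c -mulrA wb1 mulr1.
have : w ^+ (a + b * m.-1) = 1.
  by rewrite exprD wab -(exprD w) -eb (exprM w) wm expr1n.
rewrite (divn_eq (a + b * m.-1) m) exprD mulnC exprM wm expr1n mul1r.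
rewrite wX => /eqP; apply: contraTeq => _.
exact: unit_root_neq1 hd.
Qed.

End RotationMoments.

Section Pairing.
Context {R : realType}.
Local Notation leb2 := (@lebesgue_measure R \x @lebesgue_measure R)%E.
Local Notation RR := (measurableTypeR R * measurableTypeR R)%type.
Variable A : set R[i].
Let D : set RR := [set p | A (pt p)].
Hypothesis mD : measurable D.
Hypothesis finD : (leb2 D < +oo)%E.

Lemma bounded_on_sum (I : Type) (s : seq I) (F : I -> R[i] -> R[i]) :
  (forall i, bounded_on A (F i)) -> bounded_on A (fun z => \sum_(i <- s) F i z).
Proof.
move=> bF; elim: s => [|j s [M hM]].
  by exists 0 => z _; rewrite big_nil cnorm0.
have [N hN] := bF j; exists (N + M) => z Az; rewrite big_cons.
by apply: le_trans (cnormD _ _) _; rewrite lerD ?hN ?hM.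
Qed.

Lemma pairing_sum (I J : Type) (s : seq I) (t : seq J) (c : I -> R[i]) (d : J -> R[i])
    (f : I -> R[i] -> R[i]) (g : J -> R[i] -> R[i]) :
  (forall i, cmeas (f i)) -> (forall i, bounded_on A (f i)) ->
  (forall j, cmeas (g j)) -> (forall j, bounded_on A (g j)) ->
  area_integral A (fun z => (\sum_(i <- s) c i * f i z) * (\sum_(j <- t) d j * g j z)^*) =
  \sum_(i <- s) \sum_(j <- t) c i * (d j)^* * area_integral A (fun z => f i z * (g j z)^*).
Proof.
move=> mf bf mg bg.
have mt i j : cmeas (fun z => f i z * (g j z)^*) by exact: cmeasM (mf i) (cmeasJ (mg j)).
have bt i j : bounded_on A (fun z => f i z * (g j z)^*).
  exact: bounded_onM (bf i) (bounded_onJ (bg j)).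
have mt' i j : cmeas (fun z => c i * (d j)^* * (f i z * (g j z)^*)).
  exact: cmeasM (cmeas_cst _) (mt i j).
have bt' i j : bounded_on A (fun z => c i * (d j)^* * (f i z * (g j z)^*)).
  exact: bounded_onM (bounded_on_cst A _) (bt i j).
transitivity (area_integral A (fun z => \sum_(i <- s) \sum_(j <- t)
    c i * (d j)^* * (f i z * (g j z)^*))).
  apply: eq_area_integral => z _; rewrite mulr_suml; apply: eq_bigr => i _.
  rewrite (rmorph_sum Num.conj) mulr_sumr; apply: eq_bigr => j _.
  by rewrite (rmorphM Num.conj) mulrACA.
rewrite (area_integral_sum mD finD).
- apply: eq_bigr => i _; rewrite (area_integral_sum mD finD)//.
  by apply: eq_bigr => j _; rewrite (area_integralZ mD finD).
- by move=> i; apply: cmeas_sum.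
- by move=> i; apply: bounded_on_sum.
Qed.

End Pairing.

Section UniformTail.
Context {R : realType}.

(** [N0] depends on the majorant alone, so a series whose terms depend on z is cut off uniformly in
    z. *)
Lemma tsum_tail (b : nat -> R) (B : R) : (forall i, 0 <= b i) ->
  (forall n, \sum_(i < n) b i <= B) -> forall e, 0 < e ->
  exists N0, forall a : nat -> R[i], (forall i, cnorm (a i) <= b i) ->
    forall N, (N0 <= N)%N -> cnorm (tsum a - \sum_(i < N) a i) <= e.
Proof.
move=> b0 bB e e0; have [N0 hN0] := real_tail bB b0 e0.
exists N0 => a ab N N0N; have sa : asum a by exact: asum_le ab bB.
have h : ctends (fun n => \sum_(i < N + n) a i - \sum_(i < N) a i)
    (tsum a - \sum_(i < N) a i).
  apply: ctendsD (ctends_cst _) => d d0; have [K hK] := tsum_cvg sa d0.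
  by exists K => n Kn; apply: hK; rewrite (leq_trans Kn)// leq_addl.
apply: ctends_le h _ => n.
rewrite (big_ord_cat a (leq_addr n N)) addrC addKr.
apply: le_trans (cnorm_sum _ _ _) _.
apply: (@le_trans _ _ (\sum_(N <= i < N + n) b i)); first exact: ler_sum.
have := hN0 (N + n)%N; rewrite (big_ord_cat b (leq_addr n N)).
have : \sum_(i < N0) b i <= \sum_(i < N) b i.
  by rewrite [leRHS](big_ord_cat b N0N) lerDl; exact: sumr_ge0.
lra.
Qed.

End UniformTail.

(** * The Gram matrix of the functions z^s u^a *)

Section ClassMoments.
Context {R : realType}.
Variables (m : nat) (r : R) (s : nat).
Hypotheses (hm : (2 <= m)%N) (hr0 : 0 < r) (hr1 : r < 1) (hs : (s <= m - 1)%N).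
Local Notation leb2 := (@lebesgue_measure R \x @lebesgue_measure R)%E.
Local Notation RR := (measurableTypeR R * measurableTypeR R)%type.

Let rho : R := r ^+ m.
Let al : R := 1 - s.+1%:R / m%:R.
Let G : set R[i] := lemniscate m r.
Let m_gt0 : (0 < m)%N. Proof. exact: ltnW. Qed.
Let sm : (s.+1 <= m)%N. Proof. by move: hm hs; clear; lia. Qed.
Let mR0 : 0 < m%:R :> R. Proof. by rewrite ltr0n. Qed.
Let rho_gt0 : 0 < rho. Proof. exact: exprn_gt0. Qed.
Let rho_lt1 : rho < 1. Proof. by rewrite exprn_ilt1// ?ltW// -lt0n. Qed.

Lemma class_exponent01 : 0 <= al < 1.
Proof.
rewrite /al subr_ge0 ler_pdivrMr// mul1r ler_nat sm /=.
by rewrite ltrBlDr ltrDl divr_gt0.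
Qed.

Lemma class_exponentM : m%:R * al = (m.-1 - s)%:R :> R.
Proof.
rewrite /al mulrBr mulr1 mulrC divfK ?gt_eqF// -natrB//; congr (_%:R).
by move: sm; clear; lia.
Qed.

Let al01' : 0 <= al <= 1.
Proof. by case/andP: class_exponent01 => -> /ltW. Qed.
Let nNal : `|- al| <= 1.
Proof. by rewrite normrN; case/andP: al01' => h1 h2; rewrite ger0_norm. Qed.

Let u (z : R[i]) : R[i] := z ^+ m - 1.

Let uG z : G z -> cnorm (u z) < rho. Proof. by move/lemniscateE. Qed.
Let uG1 z : G z -> cnorm (u z) < 1.
Proof. by move=> /uG h; exact: lt_trans h rho_lt1. Qed.

Lemma lemniscate_neq0 z : G z -> z != 0.
Proof.
move=> /uG1; apply: contraTN => /eqP ->.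
by rewrite /u expr0n gtn_eqF//= sub0r cnormN cnorm1 ltxx.
Qed.

(* [bpow (- al) (u z)] is z^{-(m-1-s)} up to an m-th root of unity. *)
Lemma cnorm_class_factor z : G z ->
  cnorm z ^+ s = cnorm (z ^+ m.-1 * bpow (- al) (u z)).
Proof.
move=> Gz; have sa : asum (bterm al (u z)) by apply: asum_bterm_le1 (al01') (ltW (uG1 Gz)).
have sN : asum (bterm (- al) (u z)) by exact: asum_bterm_lt1 (uG1 Gz).
have h1 : cnorm (bpow al (u z)) = cnorm z ^+ (m.-1 - s).
  have := bpow_root sa class_exponentM; rewrite /u addrCA subrr addr0 => /(congr1 cnorm).
  rewrite -exprM mulnC exprM !cnormX => /eqP.
  by rewrite eqrXn2 ?exprn_ge0 ?cnorm_ge0// => /eqP.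
have z0 : 0 < cnorm z by rewrite cnorm_gt0 lemniscate_neq0.
have := bpowN sa sN => /(congr1 cnorm); rewrite cnormM h1 cnorm1 => h2.
rewrite cnormM cnormX; apply: (@mulfI _ (cnorm z ^+ (m.-1 - s))).
  by rewrite gt_eqF// exprn_gt0.
rewrite mulrCA h2 mulr1 -exprD subnK//; move: sm; clear; lia.
Qed.

Let hc (a n : nat) : R[i] := toep (fun i => (ch (- al) i)%:C) a n.

Let hcE (a n : nat) (w : R[i]) : hc a n * w ^+ n = w ^+ a * toep (bterm (- al) w) a n.
Proof.
rewrite /hc /toep; case: leqP => [an|_]; last by rewrite mul0r mulr0.
by rewrite /bterm mulrCA -exprD subnKC.
Qed.

Let hsum a : exists B, forall N, \sum_(n < N) cnorm (hc a n) * rho ^+ n <= B.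
Proof.
have sh : asum (bterm (- al) rho%:C).
  by apply: asum_bterm_lt1 => //; rewrite cnorm_real ger0_norm// ltW.
have [B hB] := asum_toep a sh; exists B => N; apply: le_trans (hB N).
apply: ler_sum => n _.
have -> : cnorm (hc a n) * rho ^+ n = rho ^+ a * cnorm (toep (bterm (- al) rho%:C) a n).
  have := congr1 cnorm (hcE a n rho%:C); rewrite !cnormM !cnormX cnorm_real ger0_norm//.
  exact: ltW.
by rewrite ler_piMl ?cnorm_ge0// exprn_ile1// ltW.
Qed.

Let V a z : R[i] := tsum (fun n => hc a n * u z ^+ n).

Let VE a z : G z -> V a z = u z ^+ a * bpow (- al) (u z).
Proof.
move=> Gz; have sN : asum (bterm (- al) (u z)) by exact: asum_bterm_lt1 (uG1 Gz).
rewrite /bpow -(tsum_toep a sN) -tsumZ; last exact: asum_toep.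
by apply: eq_tsum => n; exact: hcE.
Qed.

Let T a N z : R[i] := \sum_(n < N) hc a n * u z ^+ n.

Let TU a N z : z ^+ m.-1 * T a N z =
  \sum_(n < N) (hc a n / m%:R) * ((('X^m - 1 : {poly R[i]})^`()).[z] * ('X^m - 1 : {poly R[i]}).[z] ^+ n).
Proof.
rewrite /T mulr_sumr; apply: eq_bigr => n _.
rewrite hornerD hornerN hornerXn hornerC derivB derivXn derivC subr0 hornerMn.
rewrite hornerXn -[_ *+ m]mulr_natl /u; have m0 : m%:R != 0 :> R[i] by rewrite pnatr_eq0 -lt0n.
by move: (hc a n) (z ^+ m.-1) ((z ^+ m - 1) ^+ n) => x y w; field.
Qed.

Let u_meas : cmeas u.
Proof.
have := cmeas_horner ('X^m - 1 : {poly R[i]}); congr cmeas; apply/funext => z.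
by rewrite hornerD hornerN hornerXn hornerC.
Qed.

Let T_meas a N : cmeas (T a N).
Proof. by apply: cmeas_sum => n; exact: cmeasM (cmeas_cst _) (cmeasX n u_meas). Qed.

Let z_bounded : exists2 M, 0 <= M & forall z, G z -> cnorm z ^+ m.-1 <= M.
Proof.
have [M hM] := lemniscate_horner_bounded hm hr0 hr1 ('X^(m.-1)).
exists `|M| => // z /hM; rewrite hornerXn cnormX => /le_trans; apply; exact: ler_norm.
Qed.

Let hcJ a n : (hc a n)^* = hc a n.
Proof. by rewrite /hc /toep; case: ifP => _; rewrite ?conj_realC ?conjC0. Qed.

Let hc_rho a n : hc a n * (rho ^+ n)%:C = (rho ^+ a)%:C * toep (bterm (- al) rho%:C) a n.
Proof. by rewrite !rmorphXn /=; exact: hcE. Qed.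

(** Of z^s only the square of the modulus enters the integrand, so by [cnorm_class_factor] z^s u^a
    may be replaced by z^(m-1) u^a (1 + u)^(-al), a series in the orthogonal functions u' u^n. Its
    truncations converge uniformly on G, and their moments are partial sums of [gram]. *)
Theorem class_moment : exists kap : R[i], forall a b,
  area_integral G (fun z => z ^+ s * u z ^+ a * (z ^+ s * u z ^+ b)^*) =
  kap * ((rho ^+ a)%:C * (rho ^+ b)%:C * gram (bterm (- al) rho%:C) a b).
Proof.
have [kap hkap] := moment_scale hm hr0 hr1; rewrite -/rho -/G in hkap.
have mG := measurable_lemniscate m hr0; have fG := finite_lemniscate hm hr0 hr1.
(* Since u' = m z^(m-1) occurs twice in the integrand, m^2 is divided out. *)
exists (kap / m%:R ^+ 2) => a b; set I := LHS.
have z_meas n : cmeas (fun z : R[i] => z ^+ n) by exact: cmeasX cmeas_id.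
pose IN N := area_integral G (fun z => (z ^+ m.-1 * T a N z) * (z ^+ m.-1 * T b N z)^*).
have INE N : IN N = kap / m%:R ^+ 2 * \sum_(n < N) ((rho ^+ a)%:C * (rho ^+ b)%:C) *
    (toep (bterm (- al) rho%:C) a n * (toep (bterm (- al) rho%:C) b n / n.+1%:R)).
  rewrite /IN; under eq_area_integral => z _ do rewrite !TU.
  set U : {poly R[i]} := 'X^m - 1.
  have mU := cmeas_horner U; have mU' := cmeas_horner U^`().
  have bU := lemniscate_horner_bounded hm hr0 hr1 U.
  have bU' := lemniscate_horner_bounded hm hr0 hr1 U^`().
  have mf (n : 'I_N) : cmeas (fun z => U^`().[z] * U.[z] ^+ n).
    exact: cmeasM mU' (cmeasX n mU).
  have bf (n : 'I_N) : bounded_on G (fun z => U^`().[z] * U.[z] ^+ n).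
    exact: bounded_onM bU' (bounded_onX n bU).
  rewrite (pairing_sum mG fG _ _ _ _ mf bf mf bf) mulr_sumr; apply: eq_bigr => n _.
  rewrite (bigD1 n)//= big1 ?addr0 => [|l ln]; last first.
    by rewrite hkap -[(n : nat) == l]/(n == l) eq_sym (negbTE ln) mul0r mulr0.
  have -> : (hc b n / m%:R)^* = hc b n / m%:R.
    by rewrite (rmorphM Num.conj) /= hcJ (fmorphV Num.conj) /= (rmorph_nat Num.conj).
  rewrite hkap eqxx mul1r.
  have -> : (rho ^+ (2 * n))%:C = (rho ^+ n)%:C * (rho ^+ n)%:C :> R[i].
    by rewrite mul2n -addnn exprD rmorphM.
  have -> : (rho ^+ a)%:C * (rho ^+ b)%:C * (toep (bterm (- al) rho%:C) a n *
      (toep (bterm (- al) rho%:C) b n / n.+1%:R)) =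
      (hc a n * (rho ^+ n)%:C) * (hc b n * (rho ^+ n)%:C) / n.+1%:R :> R[i].
    by rewrite !hc_rho; ring.
  have m0 : m%:R != 0 :> R[i] by rewrite pnatr_eq0 -lt0n.
  have n0 : n.+1%:R != 0 :> R[i] by rewrite pnatr_eq0.
  have key (x y p q k w : R[i]) : p != 0 -> q != 0 ->
    x / p * (y * p^-1) * (w * w / q * k) = k / p ^+ 2 * (x * w * (y * w) / q).
    by move=> hp hq; field; rewrite ?hp ?hq.
  exact: key.
have sh : asum (bterm (- al) rho%:C).
  by apply: asum_bterm_lt1 => //; rewrite cnorm_real ger0_norm// ltW.
have lim1 : ctends IN (kap / m%:R ^+ 2 * ((rho ^+ a)%:C * (rho ^+ b)%:C *
    gram (bterm (- al) rho%:C) a b)).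
  apply: ctends_ext (fun N => esym (INE N)) _; apply: ctendsM (ctends_cst _) _.
  have sg : asum (fun n => toep (bterm (- al) rho%:C) a n *
      (toep (bterm (- al) rho%:C) b n / n.+1%:R)).
    have [Ba hBa] := asum_toep a sh; have [Bb hBb] := asum_toep b sh.
    have Bb0 : 0 <= Bb by apply: le_trans (hBb 0%N); rewrite big_ord0.
    apply: (@asum_le _ _ (fun n => cnorm (toep (bterm (- al) rho%:C) a n) * Bb) (Ba * Bb)).
      move=> n; rewrite !cnormM; apply: ler_wpM2l; first exact: cnorm_ge0.
      rewrite cnormV cnorm_nat; apply: (@le_trans _ _ (cnorm (toep (bterm (- al) rho%:C) b n))).
        by rewrite ler_piMr ?cnorm_ge0// invf_le1 ?ler1n ?ltr0n.
      apply: le_trans (hBb n.+1); rewrite big_ord_recr /= lerDr.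
      by apply: sumr_ge0 => i _; exact: cnorm_ge0.
    by move=> n; rewrite -mulr_suml; apply: ler_wpM2r.
  by rewrite /gram -tsumZ//; apply: tsum_cvg; exact: asumZ.
apply: ctends_uniq lim1 => e e0.
have [M M0 hM] := z_bounded; have [Ca hCa] := hsum a; have [Cb hCb] := hsum b.
have bge c n : 0 <= cnorm (hc c n) * rho ^+ n.
  by rewrite mulr_ge0 ?cnorm_ge0// exprn_ge0// ltW.
have Ca0 : 0 <= Ca by apply: le_trans (hCa 0%N); rewrite big_ord0.
have Cb0 : 0 <= Cb by apply: le_trans (hCb 0%N); rewrite big_ord0.
have term_le c z n : G z -> cnorm (hc c n * u z ^+ n) <= cnorm (hc c n) * rho ^+ n.
  move=> Gz; rewrite cnormM cnormX; apply: ler_wpM2l; first exact: cnorm_ge0.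
  by apply: lerXn2r; rewrite ?nnegrE ?cnorm_ge0// ?ltW// uG.
pose ar := fine (leb2 ([set p | G (pt p)] : set RR)).
have ar0 : 0 <= ar by rewrite fine_ge0.
pose K := 2 * (M ^+ 2 * (Ca + Cb) * ar) + 1.
have K0 : 0 < K.
  by rewrite /K ltr_wpDl// mulr_ge0// mulr_ge0// mulr_ge0 ?sqr_ge0// addr_ge0.
have d0 : 0 < e / K by rewrite divr_gt0.
have [Na hNa] := tsum_tail (bge a) hCa d0; have [Nb hNb] := tsum_tail (bge b) hCb d0.
exists (maxn Na Nb) => N; rewrite geq_max => /andP[NaN NbN].
have VT z : G z -> cnorm (V a z - T a N z) <= e / K /\ cnorm (V b z - T b N z) <= e / K.
  by move=> Gz; split; [apply: hNa|apply: hNb] => // i; exact: term_le.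
have Vle z : G z -> cnorm (V a z) <= Ca.
  move=> Gz; apply: tsum_le => n; apply: le_trans (hCa n); apply: ler_sum => i _.
  exact: term_le.
have Tle z : G z -> cnorm (T b N z) <= Cb.
  move=> Gz; apply: le_trans (cnorm_sum _ _ _) _; apply: le_trans (hCb N).
  by apply: ler_sum => i _; exact: term_le.
have mI : cmeas (fun z : R[i] => z ^+ s * u z ^+ a * (z ^+ s * u z ^+ b)^*).
  exact: cmeasM (cmeasM (z_meas s) (cmeasX a u_meas))
    (cmeasJ (cmeasM (z_meas s) (cmeasX b u_meas))).
have mIN : cmeas (fun z => (z ^+ m.-1 * T a N z) * (z ^+ m.-1 * T b N z)^*).
  exact: cmeasM (cmeasM (z_meas m.-1) (T_meas a N)) (cmeasJ (cmeasM (z_meas m.-1) (T_meas b N))).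
have zb k : bounded_on G (fun z : R[i] => z ^+ k).
  have [B hB] := lemniscate_horner_bounded hm hr0 hr1 ('X^k).
  by exists B => z /hB; rewrite hornerXn.
have ub k : bounded_on G (fun z : R[i] => u z ^+ k).
  apply: bounded_onX; exists rho => z Gz; exact: ltW (uG Gz).
have bI : bounded_on G (fun z : R[i] => z ^+ s * u z ^+ a * (z ^+ s * u z ^+ b)^*).
  exact: bounded_onM (bounded_onM (zb s) (ub a)) (bounded_onJ (bounded_onM (zb s) (ub b))).
have Tb c : bounded_on G (T c N).
  by apply: bounded_on_sum => n; exact: bounded_onM (bounded_on_cst G _) (ub n).
have bIN : bounded_on G (fun z => (z ^+ m.-1 * T a N z) * (z ^+ m.-1 * T b N z)^*).
  exact: bounded_onM (bounded_onM (zb m.-1) (Tb a)) (bounded_onJ (bounded_onM (zb m.-1) (Tb b))).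
have -> : IN N - I = area_integral G (fun z => (z ^+ m.-1 * T a N z) * (z ^+ m.-1 * T b N z)^* +
    (-1) * (z ^+ s * u z ^+ a * (z ^+ s * u z ^+ b)^*)).
  rewrite (area_integralD mG fG mIN bIN (cmeasM (cmeas_cst (-1)) mI)
    (bounded_onM (bounded_on_cst G (-1)) bI)).
  by rewrite (area_integralZ mG fG (-1) mI bI) mulN1r.
apply: (@le_trans _ _ (2 * ((M ^+ 2 * ((Ca + Cb) * (e / K))) * ar))); last first.
  have -> : 2 * (M ^+ 2 * ((Ca + Cb) * (e / K)) * ar) = (K - 1) * (e / K).
    by rewrite /K; ring.
  by rewrite mulrBl mul1r mulrCA divff ?gt_eqF// mulr1 gerBl ltW.
apply: (area_integral_le mG fG).
  exact: cmeasD mIN (cmeasM (cmeas_cst (-1)) mI).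
move=> z Gz; have [ha hb] := VT z Gz; have hV := Vle z Gz; have hT := Tle z Gz.
have hz := hM z Gz.
have e1 : z ^+ s * u z ^+ a * (z ^+ s * u z ^+ b)^* =
    (z ^+ m.-1 * V a z) * (z ^+ m.-1 * V b z)^*.
  rewrite !VE//; set B := bpow _ _.
  have zz : z ^+ s * (z ^+ s)^* = (z ^+ m.-1 * B) * (z ^+ m.-1 * B)^*.
    have sq (w : R[i]) : w * w^* = ((cnorm w) ^+ 2)%:C.
      rewrite cnorm_sqr conjcE; apply/eqP; rewrite eq_complex cReM cImM /=.
      by apply/andP; split; apply/eqP; ring.
    by rewrite !sq -(cnorm_class_factor Gz) cnormX.
  rewrite !(rmorphM Num.conj) /= in zz *.
  transitivity (z ^+ s * (z ^+ s)^* * (u z ^+ a * (u z ^+ b)^*)); first by ring.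
  by rewrite zz; ring.
rewrite e1 mulN1r.
have -> : z ^+ m.-1 * T a N z * (z ^+ m.-1 * T b N z)^* -
    z ^+ m.-1 * V a z * (z ^+ m.-1 * V b z)^* =
    z ^+ m.-1 * (z ^+ m.-1)^* * (- (V a z * (V b z - T b N z)^*
      + (V a z - T a N z) * (T b N z)^*)).
  by rewrite !(rmorphM Num.conj) (rmorphB Num.conj) /=; ring.
rewrite !cnormM cnormN cnormJ cnormX -expr2.
apply: ler_pM; rewrite ?cnorm_ge0 ?sqr_ge0//.
  by apply: lerXn2r; rewrite ?nnegrE ?exprn_ge0 ?cnorm_ge0.
apply: le_trans (cnormD _ _) _; rewrite [leRHS]mulrDl; apply: lerD.
  by rewrite cnormM cnormJ; apply: ler_pM; rewrite ?cnorm_ge0.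
by rewrite cnormM cnormJ mulrC; apply: ler_pM; rewrite ?cnorm_ge0.
Qed.

End ClassMoments.

(** * Branches of powers *)

Section ModulusTopology.
Context {R : realType}.

(** Radii of balls in [R[i]] are elements of [R[i]]; being positive they are real, which allows the
    passage to radii in [R]. *)
Lemma nbhsCP (z : R[i]) (P : set R[i]) :
  nbhs z P <-> exists2 d : R, 0 < d & forall w, cnorm (w - z) < d -> P w.
Proof.
split.
  move=> /nbhs_ballP[e /= e0 he].
  have eE : e = (complex.Re e)%:C.
    have /complex_realP[x ->] : e \is Num.real by rewrite realE ltW.
    by [].
  exists (complex.Re e); first by move: e0; rewrite {1}eE ltcR.
  move=> w wz; apply: he; rewrite -ball_normE /= eE distrC cnormE ltcR//.
move=> [d d0 hd]; apply/nbhs_ballP; exists d%:C; first by rewrite /= ltcR.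
by move=> w; rewrite -ball_normE /= distrC cnormE ltcR; exact: hd.
Qed.

Lemma uniform_cvgC (K : set R[i]) (f : nat -> R[i] -> R[i]) (F : R[i] -> R[i]) :
  (forall e : R, 0 < e -> exists N, forall k, (N <= k)%N ->
    forall z, K z -> cnorm (f k z - F z) <= e) ->
  {uniform K, f @ \oo --> F}.
Proof.
move=> h P /uniform_nbhs[E [entE EP]].
move: entE; rewrite -entourage_ballE => -[d /= d0 dE].
have dR : d = (complex.Re d)%:C.
  by have /complex_realP[x ->] : d \is Num.real by rewrite realE ltW.
have d0' : 0 < complex.Re d / 2 by move: d0; rewrite {1}dR ltcR => ?; rewrite divr_gt0.
have [N hN] := h _ d0'; exists N => // k /= Nk; apply: EP => z Kz; apply: dE.
rewrite /= -ball_normE /= dR cnormE ltcR cnormB; apply: le_lt_trans (hN k Nk z Kz) _.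
by rewrite ltr_pdivrMr// ltr_pMr ?ltr1n//; move: d0; rewrite {1}dR ltcR.
Qed.

(* [dist] is [cnorm (y - x)] on the plane and [`|y - x|] on the line. *)
Definition econt (T : Type) (dist : T -> T -> R) (f : T -> R[i]) (x : T) :=
  forall e : R, 0 < e -> exists2 d : R, 0 < d &
    forall y, dist y x < d -> cnorm (f y - f x) < e.

Definition cdist (z w : R[i]) : R := cnorm (z - w).
Definition rdist (x y : R) : R := `|x - y|.

Lemma econt_continuous (f : R[i] -> R[i]) z : econt cdist f z -> {for z, continuous f}.
Proof.
move=> h P /nbhsCP[e e0 he]; have [d d0 hd] := h e e0.
by apply/nbhsCP; exists d => // w wz; apply: he; exact: hd.
Qed.

Lemma econt_continuousR (f : R[i] -> R) z :
  econt cdist (fun w => (f w)%:C) z -> {for z, continuous f}.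
Proof.
move=> h P /nbhs_ballP[e /= e0 he]; have [d d0 hd] := h e e0.
apply/nbhsCP; exists d => // w wz; apply: he; rewrite -ball_normE /= distrC.
by have := hd w wz; rewrite -rmorphB cnorm_real.
Qed.

Section Calculus.
Variables (T : Type) (dist : T -> T -> R).
Implicit Types (f g : T -> R[i]) (x : T).

Lemma econt_cst (c : R[i]) x : econt dist (fun=> c) x.
Proof. by move=> e e0; exists 1 => // y _; rewrite subrr cnorm0. Qed.

Lemma econtD f g x : econt dist f x -> econt dist g x ->
  econt dist (fun y => f y + g y) x.
Proof.
move=> hf hg e e0; have e2 : 0 < e / 2 by rewrite divr_gt0.
have [a a0 ha] := hf _ e2; have [b b0 hb] := hg _ e2.
exists (Num.min a b); first by rewrite lt_min a0.
move=> y; rewrite lt_min => /andP[/ha h1 /hb h2].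
rewrite opprD addrACA; apply: le_lt_trans (cnormD _ _) _.
by rewrite [e]splitr ltrD.
Qed.

Lemma econtM f g x : econt dist f x -> econt dist g x ->
  econt dist (fun y => f y * g y) x.
Proof.
move=> hf hg e e0; pose M := 1 + cnorm (f x) + cnorm (g x).
have M0 : 0 < M by rewrite /M -addrA ltr_pwDl// addr_ge0 ?cnorm_ge0.
have e1 : 0 < Num.min 1 (e / (2 * M)) by rewrite lt_min ltr01 divr_gt0 ?mulr_gt0.
have [a a0 ha] := hf _ e1; have [b b0 hb] := hg _ e1.
exists (Num.min a b); first by rewrite lt_min a0.
move=> y; rewrite lt_min => /andP[/ha + /hb]; rewrite !lt_min => /andP[h1 h2] /andP[h3 h4].
have -> : f y * g y - f x * g x = (f y - f x) * g y + f x * (g y - g x) by ring.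
apply: le_lt_trans (cnormD _ _) _; rewrite !cnormM.
have gy : cnorm (g y) <= 1 + cnorm (g x).
  by rewrite -(subrK (g x) (g y)); apply: le_trans (cnormD _ _) _; rewrite lerD2r ltW.
have fM : cnorm (f x) <= M by rewrite /M addrAC lerDr addr_ge0 ?cnorm_ge0.
have gM : cnorm (g y) <= M.
  by apply: (le_trans gy); rewrite /M addrAC lerDl cnorm_ge0.
have eM : e / (2 * M) * M = e / 2 by field; rewrite gt_eqF.
have : cnorm (f y - f x) * cnorm (g y) < e / 2 \/ cnorm (g y) = 0.
  have [->|gn] := eqVneq (cnorm (g y)) 0; first by right.
  have gp : 0 < cnorm (g y) by rewrite lt_neqAle eq_sym gn cnorm_ge0.
  left; rewrite -eM; apply: (@lt_le_trans _ _ (e / (2 * M) * cnorm (g y))).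
    by rewrite ltr_pM2r.
  by apply: ler_wpM2l => //; rewrite divr_ge0 ?mulr_ge0 ?(ltW e0) ?(ltW M0).
have : cnorm (f x) * cnorm (g y - g x) <= e / 2.
  by rewrite -eM mulrC; apply: ler_pM; rewrite ?cnorm_ge0// ltW.
by move=> h [h'|->]; [rewrite [e]splitr; lra|rewrite mulr0; lra].
Qed.

Lemma econtX f x n : econt dist f x -> econt dist (fun y => f y ^+ n) x.
Proof.
move=> hf; elim: n => [|n ih].
  rewrite (_ : (fun y => f y ^+ 0) = fun=> 1); first exact: econt_cst.
  by apply/funext => y; rewrite expr0.
rewrite (_ : (fun y => f y ^+ n.+1) = fun y => f y * f y ^+ n); first exact: econtM.
by apply/funext => y; rewrite exprS.
Qed.

Lemma econtV f x : f x != 0 -> econt dist f x -> econt dist (fun y => (f y)^-1) x.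
Proof.
rewrite -cnorm_gt0 => f0 hf e e0; set a := cnorm (f x) in f0.
have e1 : 0 < Num.min (a / 2) (e * (a * (a / 2))).
  by rewrite lt_min divr_gt0// !mulr_gt0.
have [d d0 hd] := hf _ e1; exists d => // y /hd; rewrite lt_min => /andP[h1 h2].
have fy : a / 2 < cnorm (f y).
  have := cnormD (f y) (f x - f y); rewrite addrCA subrr addr0 -/a.
  by rewrite (cnormB (f x)) => h; lra.
have y0 : 0 < cnorm (f y) by apply: lt_trans fy; rewrite divr_gt0.
have nx : f x != 0 by rewrite -cnorm_gt0. have ny : f y != 0 by rewrite -cnorm_gt0.
have -> : (f y)^-1 - (f x)^-1 = - ((f y - f x) / (f x * f y)).
  by move: (f x) (f y) nx ny => p q p0 q0; field; rewrite p0 q0.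
rewrite cnormN cnormM cnormV cnormM -/a ltr_pdivrMr ?mulr_gt0//.
apply: (lt_le_trans h2); apply: ler_wpM2l; first exact: ltW.
by apply: ler_wpM2l; rewrite ltW.
Qed.

Lemma econt_Re f x : econt dist f x -> econt dist (fun y => (complex.Re (f y))%:C) x.
Proof.
move=> hf e e0; have [d d0 hd] := hf e e0; exists d => // y /hd; apply: le_lt_trans.
by rewrite -rmorphB cnorm_real -cReN -cReD Re_le_cnorm.
Qed.

Lemma econt_Im f x : econt dist f x -> econt dist (fun y => (complex.Im (f y))%:C) x.
Proof.
move=> hf e e0; have [d d0 hd] := hf e e0; exists d => // y /hd; apply: le_lt_trans.
by rewrite -rmorphB cnorm_real -cImN -cImD Im_le_cnorm.
Qed.

Lemma econt_cnorm f x : econt dist f x -> econt dist (fun y => (cnorm (f y))%:C) x.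
Proof.
move=> hf e e0; have [d d0 hd] := hf e e0; exists d => // y /hd; apply: le_lt_trans.
by rewrite -rmorphB cnorm_real cnorm_dist.
Qed.

Lemma econt_real (h : T -> R) x (k : R -> R) : {for h x, continuous k} ->
  econt dist (fun y => (h y)%:C) x -> econt dist (fun y => (k (h y))%:C) x.
Proof.
move=> ck hh e e0; move/cvgrPdist_lt : ck => /(_ e e0); rewrite near_simpl.
move=> /nbhs_ballP[d /= d0 hd]; have [b b0 hb] := hh d d0; exists b => // y /hb.
rewrite -!rmorphB !cnorm_real => hyx; rewrite distrC; apply: hd.
by rewrite -ball_normE /= distrC.
Qed.

Lemma econt_ReIm (f g : T -> R) x : econt dist (fun y => (f y)%:C) x ->
  econt dist (fun y => (g y)%:C) x -> econt dist (fun y => f y +i* g y) x.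
Proof.
move=> hf hg; have := econtD hf (econtM (econt_cst (0 +i* 1) x) hg).
congr (econt _ _ _); apply/funext => y; apply/eqP; rewrite eq_complex /=.
by apply/andP; split; apply/eqP; ring.
Qed.

Lemma econt_cexp f x : econt dist f x -> econt dist (fun y => cexp (f y)) x.
Proof.
move=> hf; have hR := econt_Re hf; have hI := econt_Im hf.
apply: econtM.
  exact: (@econt_real (fun y => complex.Re (f y)) x expR (@continuous_expR R _) hR).
apply: econt_ReIm.
  exact: (@econt_real (fun y => complex.Im (f y)) x cos (@continuous_cos R _) hI).
exact: (@econt_real (fun y => complex.Im (f y)) x sin (@continuous_sin R _) hI).
Qed.

Lemma econt_comp (k : R[i] -> R[i]) f x : econt cdist k (f x) -> econt dist f x ->
  econt dist (fun y => k (f y)) x.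
Proof.
move=> hk hf e e0; have [d d0 hd] := hk e e0; have [b b0 hb] := hf d d0.
by exists b => // y /hb; exact: hd.
Qed.

End Calculus.

Lemma econt_id z : econt cdist id z.
Proof. by move=> e e0; exists e. Qed.

(** If a and b differ, the sum of a^(m-1-i) b^i over i < m vanishes, so m is the modulus of the sum
    of a^(m-1-i) (a^i - b^i), which is at most m^2 |a - b|. *)
Lemma unity_root_separated m (a b : R[i]) : (0 < m)%N -> a ^+ m = 1 -> b ^+ m = 1 ->
  cnorm (a - b) < m%:R^-1 -> a = b.
Proof.
move=> m0 am bm ab; apply/eqP; rewrite -subr_eq0; apply: contraTT ab => nab.
have n1 (c : R[i]) : c ^+ m = 1 -> cnorm c = 1.
  move=> /(congr1 cnorm); rewrite cnormX cnorm1 => /eqP.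
  by rewrite pexpr_eq1 ?cnorm_ge0// => /eqP.
have a1 := n1 _ am; have b1 := n1 _ bm.
have s0 : \sum_(i < m) a ^+ (m.-1 - i) * b ^+ i = 0.
  have := subrXX a b m; rewrite am bm subrr => /esym/eqP.
  by rewrite mulf_eq0 (negbTE nab) => /eqP.
have mE : m%:R = cnorm (\sum_(i < m) a ^+ (m.-1 - i) * (a ^+ i - b ^+ i)).
  have -> : \sum_(i < m) a ^+ (m.-1 - i) * (a ^+ i - b ^+ i) = m%:R * a ^+ m.-1.
    under eq_bigr do rewrite mulrBr; rewrite sumrB s0 subr0.
    rewrite (eq_bigr (fun=> a ^+ m.-1)) => [|i _].
      by rewrite sumr_const card_ord mulr_natl.
    by rewrite -exprD subnK// -ltnS prednK.
  by rewrite cnormM cnormX a1 expr1n mulr1 cnorm_nat.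
have : m%:R <= m%:R * (m%:R * cnorm (a - b)).
  rewrite {1}mE; apply: le_trans (cnorm_sum _ _ _) _.
  apply: (@le_trans _ _ (\sum_(i < m) m%:R * cnorm (a - b))); last first.
    by rewrite sumr_const card_ord -[leLHS]mulr_natl.
  apply: ler_sum => i _; rewrite cnormM cnormX a1 expr1n mul1r.
  apply: le_trans (cnorm_subX_le i _ _) _; rewrite ?a1 ?b1//.
  by apply: ler_wpM2r; rewrite ?cnorm_ge0// ler_nat ltnW.
rewrite -leNgt -[X in X <= _]mulr1 ler_pM2l ?ltr0n// => h.
by rewrite -[_^-1]mulr1 ler_pdivrMl ?ltr0n.
Qed.

(** Values closer than 1 / m coincide, so each level set is open and closed in [A]. Continuity
    relative to [A] is spelled out so as to fit both segments of the line and components in the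
    plane. *)
Lemma unity_root_locally_constant (T : topologicalType) (A : set T) (f : T -> R[i]) m :
  (0 < m)%N -> connected A ->
  (forall x, A x -> forall e : R, 0 < e -> nbhs x [set y | A y -> cnorm (f y - f x) < e]) ->
  (forall x, A x -> f x ^+ m = 1) -> forall x y, A x -> A y -> f x = f y.
Proof.
move=> m0 cA cf f1 x y Ax Ay; have m1 : 0 < m%:R^-1 :> R by rewrite invr_gt0 ltr0n.
have sep z w : A z -> A w -> cnorm (f w - f z) < m%:R^-1 -> f w = f z.
  by move=> Az Aw; apply: unity_root_separated; rewrite ?f1.
suff e : A `&` [set z | f z = f y] = A by move: Ax; rewrite -e => -[].
apply: cA.
- by exists y; split.
- exists (interior [set z | A z -> f z = f y]); first exact: open_interior.
  apply/seteqP; split => z.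
    move=> [Az /= zy]; split => //; rewrite /interior /=.
    by apply: filterS (cf z Az _ m1) => w /= wz Aw; rewrite -zy; exact: sep (wz Aw).
  by move=> [Az /interior_subset /= h]; split => //; exact: h.
- exists (~` interior [set z | A z -> f z != f y]); first exact: open_closedC (open_interior _).
  apply/seteqP; split => z.
    by move=> [Az /= zy]; split => // /interior_subset /= /(_ Az); rewrite zy eqxx.
  move=> [Az] /= zy; split => //; apply: contrapT => nzy; apply: zy.
  rewrite /interior /=; apply: filterS (cf z Az _ m1) => w /= wz Aw.
  by rewrite (sep z w)//; [exact/eqP|exact: wz].
Qed.

(** The principal logarithm on the open right half plane, which contains 1 + z whenever |z| <= 1 and
    z is not -1; elsewhere the formula does not give a logarithm. *)
Definition clog (w : R[i]) : R[i] :=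
  ln (cnorm w) +i* atan (complex.Im w / complex.Re w).

Lemma clogK (w : R[i]) : 0 < complex.Re w -> cexp (clog w) = w.
Proof.
case: w => x y /= x0; rewrite /cexp /clog /=.
have w0 : 0 < cnorm (x +i* y) by apply: lt_le_trans (Re_le_cnorm _); rewrite /= gtr0_norm.
rewrite lnK//; set t := y / x.
have nE : cnorm (x +i* y) = x * Num.sqrt (1 + t ^+ 2).
  apply/eqP; rewrite -(@eqrXn2 _ 2)// ?cnorm_ge0 ?mulr_ge0 ?sqrtr_ge0 ?(ltW x0)//.
  rewrite cnorm_sqr exprMn sqr_sqrtr ?addr_ge0 ?sqr_ge0// /t /=.
  by apply/eqP; field; rewrite gt_eqF.
have s0 : Num.sqrt (1 + t ^+ 2) != 0 by rewrite sqrtr_eq0 -ltNge ltr_pwDl// sqr_ge0.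
have c0 : cos (atan t) != 0 by rewrite cos_atan invr_neq0.
have sE : sin (atan t) = t * cos (atan t).
  by rewrite -{2}[t]atanK /tan divfK.
rewrite sE cos_atan nE; apply/eqP; rewrite eq_complex /= !mul0r subr0 addr0.
by apply/andP; split; apply/eqP; rewrite /t; field; rewrite ?s0 ?(gt_eqF x0).
Qed.

Lemma econt_clog (w : R[i]) : 0 < complex.Re w -> econt cdist clog w.
Proof.
move=> x0; have hI := econt_Im (@econt_id w); have hR := econt_Re (@econt_id w).
have w0 : 0 < cnorm w by apply: lt_le_trans (Re_le_cnorm _); rewrite gtr0_norm.
apply: econt_ReIm.
  exact: (econt_real (continuous_ln w0) (econt_cnorm (@econt_id w))).
apply: (econt_real (@continuous_atan R _)).
have := econtM hI (econtV _ hR); rewrite -cnorm_eq0 cnorm_real normr_eq0 gt_eqF// => /(_ isT).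
by congr (econt _ _ _); apply/funext => z; rewrite /= -fmorphV -rmorphM.
Qed.

Lemma Re_add1_gt0 (z : R[i]) : cnorm z <= 1 -> z != -1 -> 0 < complex.Re (1 + z).
Proof.
case: z => x y z1 zn; rewrite cReD /=.
have x1 : -1 <= x.
  by have := le_trans (Re_le_cnorm _) z1; rewrite ler_norml => /andP[].
have [xn|xe] := eqVneq x (-1); last by rewrite -ltrBlDl sub0r lt_neqAle eq_sym xe.
have : cnorm (x +i* y) ^+ 2 <= 1 by rewrite exprn_ile1 ?cnorm_ge0.
rewrite cnorm_sqr /= xn sqrrN expr1n gerDl => y0.
have ye : y = 0 by apply/eqP; rewrite -sqrf_eq0 eq_le y0 sqr_ge0.
by move: zn; rewrite xn ye => /eqP; case; apply/eqP; rewrite eq_complex /= oppr0 !eqxx.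
Qed.

Lemma econt_bpow (T : Type) (dist : T -> T -> R) (al : R) (k : T -> R[i]) x :
  0 <= al <= 1 -> (forall y, cnorm (k y) <= 1) -> econt dist k x ->
  econt dist (fun y => bpow al (k y)) x.
Proof.
move=> al01 k1 hk e e0; have [|d d0 hd] := @bpow_unif_continuous _ al al01 (e / 2).
  by rewrite divr_gt0.
have [b b0 hb] := hk d d0; exists b => // y /hb yx.
apply: le_lt_trans (hd _ _ (k1 y) (k1 x) (ltW yx)) _.
by rewrite ltr_pdivrMr// ltr_pMr// ltr1n.
Qed.

Lemma nbhs_econtC (A : set R[i]) (f : R[i] -> R[i]) (z : {z | A z}) :
  econt (fun a b : {z | A z} => cdist (sval a) (sval b)) (f \o sval) z ->
  forall e : R, 0 < e -> nbhs (sval z) [set y | A y -> cnorm (f y - f (sval z)) < e].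
Proof.
move=> h e e0; have [d d0 hd] := h e e0; apply/nbhsCP; exists d => // w wz Aw.
exact: (hd (exist _ w Aw)).
Qed.

Lemma nbhs_econtR (A : set R) (f : R -> R[i]) (x : {x | A x}) :
  econt (fun a b : {x | A x} => rdist (sval a) (sval b)) (f \o sval) x ->
  forall e : R, 0 < e -> nbhs (sval x) [set y | A y -> cnorm (f y - f (sval x)) < e].
Proof.
move=> h e e0; have [d d0 hd] := h e e0; apply/nbhs_ballP; exists d => // w.
rewrite -ball_normE /= distrC => wx Aw; exact: (hd (exist _ w Aw)).
Qed.

(* Along [0, z] the two sides differ by a continuous m-th root of unity. *)
Lemma bpow_clog (al : R) m n (z : R[i]) : 0 <= al <= 1 -> (0 < m)%N ->
  m%:R * al = n%:R -> cnorm z <= 1 -> z != -1 ->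
  bpow al z = cexp (al%:C * clog (1 + z)).
Proof.
move=> al01 m0 man z1 zn.
pose f (t : R) := bpow al (t%:C * z) / cexp (al%:C * clog (1 + t%:C * z)).
have tz (t : R) : 0 <= t <= 1 -> cnorm (t%:C * z) <= 1.
  by move=> /andP[t0 t1]; rewrite cnormM cnorm_real ger0_norm// mulr_ile1// cnorm_ge0.
have tRe (t : R) : 0 <= t <= 1 -> 0 < complex.Re (1 + t%:C * z).
  move=> /andP[t0 t1]; have := Re_add1_gt0 z1 zn; rewrite !cReD /= cReM /= mul0r subr0.
  have := le_trans (Re_le_cnorm _) z1; rewrite ler_norml => /andP[]; nra.
have fm (t : R) : 0 <= t <= 1 -> f t ^+ m = 1.
  move=> t01; rewrite /f exprMn exprVn.
  rewrite (bpow_root (asum_bterm_le1 al01 (tz t t01)) man) -cexpMn mulrA.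
  have -> : m%:R * al%:C = n%:R :> R[i].
    by rewrite -(rmorph_nat (@real_complex R)) -rmorphM man rmorph_nat.
  rewrite cexpMn clogK ?tRe// divff// expf_neq0//.
  by apply: contraTneq (tRe t t01) => ->; rewrite ltxx.
have : f 1 = f 0.
  have cI : connected (`[0%R, 1%R]%classic : set R) by exact: segment_connected.
  apply: (unity_root_locally_constant m0 cI).
  - move=> t tI; apply: (@nbhs_econtR _ f (exist _ t tI)).
    have tzc : econt (fun a b : {t : R | (`[0%R, 1%R]%classic : set R) t} => rdist (sval a) (sval b))
        (fun a => (sval a)%:C * z) (exist _ t tI).
      apply: econtM (econt_cst _ _ _) => e e0; exists e => // y.
      by rewrite -rmorphB cnorm_real.
    have I01 (a : {t : R | (`[0%R, 1%R]%classic : set R) t}) : 0 <= sval a <= 1.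
      by case: a => a /=; rewrite in_itv.
    apply: econtM.
      by apply: econt_bpow => // a; exact: tz.
    apply: econtV; first exact: cexp_neq0.
    apply: econt_cexp; apply: econtM (econt_cst _ _ _) _.
    apply: (@econt_comp _ _ clog); first by apply: econt_clog; exact: tRe.
    exact: econtD (econt_cst _ _ _) tzc.
  - by move=> t; rewrite /= in_itv /=; exact: fm.
  - by rewrite /= in_itv /= ler01 lexx.
  - by rewrite /= in_itv /= ler01 lexx.
rewrite /f mul0r addr0 mul1r bpow_at0.
have -> : clog 1 = 0.
  by rewrite /clog cnorm1 ln1 /= mul0r atan0.
rewrite mulr0 cexp0 divr1 => /(canRL (divfK (cexp_neq0 _))).
by rewrite mul1r.
Qed.

End ModulusTopology.

(** * The Bergman polynomials in one residue class *)

Section BergmanClass.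
Context {R : realType}.
Variables (m : nat) (r : R).
Hypotheses (hm : (2 <= m)%N) (hr0 : 0 < r) (hr1 : r < 1).
Variable P : nat -> {poly R[i]}.
Hypothesis hP : bergman_polynomials (lemniscate m r) P.

Let G : set R[i] := lemniscate m r.
Let mG := measurable_lemniscate m hr0.
Let fG := finite_lemniscate hm hr0 hr1.
Let bG := lemniscate_horner_bounded hm hr0 hr1.
Let rho : R := r ^+ m.

Let ip (f g : {poly R[i]}) : R[i] := area_integral G (fun z => f.[z] * (g.[z])^*).

Let m_ip (f g : {poly R[i]}) : cmeas (fun z => f.[z] * (g.[z])^*).
Proof. exact: cmeasM (cmeas_horner f) (cmeasJ (cmeas_horner g)). Qed.

Let b_ip (f g : {poly R[i]}) : bounded_on G (fun z => f.[z] * (g.[z])^*).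
Proof. exact: bounded_onM (bG f) (bounded_onJ (bG g)). Qed.

Let ip_linl (a : R[i]) (f1 f2 g : {poly R[i]}) : ip (a *: f1 + f2) g = a * ip f1 g + ip f2 g.
Proof.
rewrite /ip -(area_integralZ mG fG a (m_ip f1 g) (b_ip f1 g)).
rewrite -(area_integralD mG fG (cmeasM (cmeas_cst a) (m_ip f1 g))
  (bounded_onM (bounded_on_cst G a) (b_ip f1 g)) (m_ip f2 g) (b_ip f2 g)).
by apply: eq_area_integral => z _; rewrite hornerD hornerZ; ring.
Qed.

Let ipC (f g : {poly R[i]}) : ip g f = (ip f g)^*.
Proof.
rewrite /ip -(area_integralJ mG fG (m_ip f g) (b_ip f g)); apply: eq_area_integral => z _.
by rewrite (rmorphM Num.conj) /= conjCK mulrC.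
Qed.

Let ip_linr (a : R[i]) (f g1 g2 : {poly R[i]}) : ip f (a *: g1 + g2) = a^* * ip f g1 + ip f g2.
Proof. by rewrite ipC ip_linl (rmorphD Num.conj) (rmorphM Num.conj) /= -!ipC. Qed.

Let ip0r (f : {poly R[i]}) : ip f 0 = 0.
Proof.
by have := ip_linr (-1) f 0 0; rewrite scaler0 addr0 (rmorphN1 Num.conj) mulN1r addNr.
Qed.

Let size_reduce (f g : {poly R[i]}) k : (size f <= k.+1)%N -> size g = k.+1 ->
  (size (f - (f`_k / lead_coef g) *: g)%R <= k)%N.
Proof.
move=> fk gk; apply/leq_sizeP => j; rewrite leq_eqVlt => /orP[/eqP <-|kj].
  have g0 : lead_coef g != 0 by rewrite lead_coef_eq0 -size_poly_eq0 gk.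
  by rewrite coefB coefZ; move: g0; rewrite lead_coefE gk /= => g0; rewrite divfK ?subrr.
rewrite coefB coefZ (nth_default _ (leq_trans fk kj)).
by rewrite (nth_default 0 (s := g)) ?gk// mulr0 subrr.
Qed.

Let ip_low (f : {poly R[i]}) (B : nat -> {poly R[i]}) n : (forall k, size (B k) = k.+1) ->
  (forall b, (b < n)%N -> ip f (B b) = 0) ->
  forall g : {poly R[i]}, (size g <= n)%N -> ip f g = 0.
Proof.
move=> sB hB; suff h k : (k <= n)%N -> forall g : {poly R[i]}, (size g <= k)%N -> ip f g = 0.
  exact: h.
elim: k => [|k ih] kn g gk.
  by move: gk; rewrite size_poly_leq0 => /eqP ->; exact: ip0r.
rewrite -(subrK ((g`_k / lead_coef (B k)) *: B k) g) addrC ip_linr hB// mulr0 add0r.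
by apply: ih; [exact: ltnW|exact: size_reduce].
Qed.

Let P_size n : size (P n) = n.+1. Proof. by have [] := hP. Qed.
Let P_lead n : lead_coef (P n) != 0.
Proof. by have [_ h _] := hP; rewrite gt_eqF. Qed.
Let P_ip i j : ip (P i) (P j) = (i == j)%:R.
Proof. by have [_ _ h] := hP; exact: h. Qed.

Let P_low n (g : {poly R[i]}) : (size g <= n)%N -> ip (P n) g = 0.
Proof.
apply: (ip_low P_size) => b bn; rewrite P_ip; case: eqVneq bn => // ->.
by rewrite ltnn.
Qed.

(** Pairing with [P k] reads off the leading coefficient, which therefore vanishes, and the degree
    drops. The orthonormal system thus takes the place of an argument on positivity of the
    integral. *)
Let ip_definite n (d : {poly R[i]}) : (size d <= n)%N ->
  (forall i, (i < n)%N -> ip d (P i) = 0) -> d = 0.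
Proof.
elim: n d => [|k ih] d dk h; first by apply/eqP; rewrite -size_poly_leq0.
pose a := d`_k / lead_coef (P k); pose d' := d - a *: P k.
have d'k : (size d' <= k)%N by apply: size_reduce.
have dE : d = a *: P k + d' by rewrite /d' addrC subrK.
have a0 : a = 0.
  have := h k (ltnSn k); rewrite dE ip_linl P_ip eqxx mulr1 (ipC (P k)) P_low//.
  by rewrite conjC0 addr0.
apply: ih => [|i ik]; first by move: d'k; rewrite /d' a0 scale0r subr0.
by apply: h; exact: ltnW.
Qed.

Let p n : {poly R[i]} := monic_part (P n).

Let p_size n : size (p n) = n.+1.
Proof. by rewrite /p /monic_part size_scale ?invr_neq0// P_size. Qed.

Let p_monic n : (p n)`_n = 1.
Proof.
rewrite /p /monic_part coefZ; have := P_lead n; rewrite lead_coefE P_size /= => h.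
by rewrite mulVf.
Qed.

Let p_low n (g : {poly R[i]}) : (size g <= n)%N -> ip (p n) g = 0.
Proof.
move=> gn; rewrite /p /monic_part -[_ *: _]addr0 ip_linl P_low// mulr0 add0r.
by rewrite ipC ip0r conjC0.
Qed.

Let p_uniq n (f : {poly R[i]}) : (size f <= n.+1)%N -> f`_n = 1 ->
  (forall b, (b < n)%N -> ip f 'X^b = 0) -> f = p n.
Proof.
move=> fn f1 hf; apply/eqP; rewrite -subr_eq0; apply/eqP.
apply: (@ip_definite n).
  apply/leq_sizeP => j; rewrite leq_eqVlt coefB => /orP[/eqP <-|nj].
    by rewrite f1 p_monic subrr.
  by rewrite (nth_default _ (leq_trans fn nj)) (nth_default 0 (s := p n)) ?p_size// subrr.
move=> i iN; rewrite -scaleN1r addrC ip_linl p_low ?P_size// mulr0 add0r.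
by apply: (ip_low (fun k => size_polyXn _ k) hf); rewrite P_size.
Qed.

Let ip_expand (f : {poly R[i]}) N b : (size f <= N)%N -> ip f 'X^b =
  \sum_(i < N) f`_i * area_integral G (fun z => z ^+ i * (z ^+ b)^*).
Proof.
move=> fN.
have mX k : cmeas (fun z : R[i] => z ^+ k) by exact: cmeasX cmeas_id.
have bX k : bounded_on G (fun z : R[i] => z ^+ k).
  by have [B hB] := bG 'X^k; exists B => z /hB; rewrite hornerXn.
have := pairing_sum mG fG (index_enum 'I_N) [:: tt] (fun i => f`_i) (fun=> 1)
  (fun i : 'I_N => mX i) (fun i : 'I_N => bX i) (fun=> mX b) (fun=> bX b).
move=> e; rewrite /ip (@eq_area_integral _ _ _ (fun z : R[i] =>
    (\sum_(i < N) f`_i * z ^+ i) * (\sum_(j <- [:: tt]) 1 * z ^+ b)^*)); last first.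
  by move=> z _; rewrite (horner_coef_wide _ fN) big_seq1 mul1r hornerXn.
rewrite e; apply: eq_bigr => i _; rewrite big_seq1.
by rewrite (rmorph1 Num.conj) mulr1.
Qed.

Section Class.
Variable s : nat.
Hypothesis hs : (s <= m - 1)%N.
Let m_gt0 : (0 < m)%N. Proof. exact: ltnW. Qed.
Let sm : (s < m)%N. Proof. by move: hm hs; clear; lia. Qed.

(** Keeping only the exponents congruent to s modulo m leaves a monic polynomial that is still
    orthogonal to all lower powers, because different residue classes are orthogonal; uniqueness
    identifies it with [p n]. *)
Let p_support k i : (i %% m)%N != s -> (p (k * m + s))`_i = 0.
Proof.
set n := (k * m + s)%N.
have ns : (n %% m)%N = s by rewrite /n modnMDl modn_small.
pose f := \poly_(i < n.+1) (if (i %% m)%N == s then (p n)`_i else 0).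
have fn : (size f <= n.+1)%N by exact: size_poly.
suff <- : f = p n.
  by move=> his; rewrite coef_poly (negbTE his); case: ifP.
apply: p_uniq => //; first by rewrite coef_poly ltnSn ns eqxx p_monic.
move=> b bn; rewrite (ip_expand b fn).
have [bs|bs] := eqVneq (b %% m)%N s.
  transitivity (ip (p n) 'X^b); last by apply: p_low; rewrite size_polyXn.
  rewrite (@ip_expand _ n.+1) ?p_size//; apply: eq_bigr => j _.
  rewrite coef_poly ltn_ord; case: eqVneq => // hjs; rewrite mul0r.
  by rewrite (moment_class hm hr0 hr1) ?mulr0// bs.
apply: big1 => j _; rewrite coef_poly ltn_ord; case: eqVneq => hjs; last by rewrite mul0r.
by rewrite (moment_class hm hr0 hr1) ?mulr0// hjs eq_sym.
Qed.

Let q k : {poly R[i]} := \poly_(a < k.+1) (p (k * m + s))`_(a * m + s).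

Let pE k : p (k * m + s) = 'X^s * (q k \Po 'X^m).
Proof.
apply/polyP => i; rewrite coefXnM coef_comp_poly_Xn//.
have [his|his] := eqVneq (i %% m)%N s; last first.
  rewrite p_support//; case: ifP => // /negbT; rewrite -leqNgt => si.
  case: ifP => // /dvdnP[c hc]; exfalso; move/eqP: his; apply.
  by rewrite -(subnK si) hc modnMDl modn_small.
have iE : i = (i %/ m * m + s)%N by rewrite {1}(divn_eq i m) his.
have si : (s <= i)%N by rewrite iE leq_addl.
rewrite ltnNge si /= {2 3}iE addnK dvdn_mull// mulnK// coef_poly.
case: ltnP => [_|kj]; first by rewrite -iE.
by rewrite nth_default// p_size iE ltn_add2r ltn_mul2r m_gt0 kj.
Qed.

(** Re-expansion around z^m = 1, which passes from the variable z^m to u. *)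
Let Q k : {poly R[i]} := q k \Po ('X + 1).

Let q_size k : (size (q k) <= k.+1)%N. Proof. exact: size_poly. Qed.

Let q_lead k : (q k)`_k = 1.
Proof. by rewrite coef_poly ltnSn p_monic. Qed.

Let q_sizeE k : size (q k) = k.+1.
Proof.
apply/eqP; rewrite eqn_leq q_size /= ltnNge; apply/negP => h.
by have := q_lead k; rewrite nth_default// => /esym/eqP; rewrite oner_eq0.
Qed.

Let X1_size : size ('X + 1 : {poly R[i]}) = 2.
Proof. by have := size_XaddC (1 : R[i]); rewrite polyC1. Qed.

Let Q_size k : size (Q k) = k.+1.
Proof. by rewrite /Q size_comp_poly2 ?X1_size// q_sizeE. Qed.

Let Q_lead k : (Q k)`_k = 1.
Proof.
have := @lead_coef_comp _ (q k) ('X + 1); rewrite X1_size => /(_ isT).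
rewrite lead_coefE Q_size /= -/(Q k) => ->.
have -> : lead_coef ('X + 1 : {poly R[i]}) = 1.
  by have := lead_coefXaddC (1 : R[i]); rewrite polyC1.
by rewrite expr1n mulr1 lead_coefE q_sizeE /= q_lead.
Qed.

Let QE k z : (q k \Po 'X^m).[z] = \sum_(a < k.+1) (Q k)`_a * (z ^+ m - 1) ^+ a.
Proof.
rewrite -(@horner_coef_wide _ k.+1) ?Q_size// /Q !horner_comp hornerXn.
by rewrite hornerD hornerX hornerC subrK.
Qed.

Let rho_gt0 : 0 < rho. Proof. exact: exprn_gt0. Qed.
Let rhoC0 n : (rho ^+ n)%:C != 0 :> R[i].
Proof. by rewrite -cnorm_eq0 cnorm_real normr_eq0 gt_eqF// exprn_gt0. Qed.

Let zuE a z : ('X^s * ('X^m - 1) ^+ a : {poly R[i]}).[z] = z ^+ s * (z ^+ m - 1) ^+ a.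
Proof.
rewrite hornerM hornerXn; congr (_ * _).
by rewrite horner_exp hornerD hornerN hornerXn hornerC.
Qed.

Theorem bergman_class : exists c : nat -> nat -> R[i],
  [/\ forall k a, (k < a)%N -> c k a = 0, forall k, c k k = 1,
      forall k l, (l < k)%N -> \sum_(a < k.+1) c k a *
        gram (bterm (- (1 - s.+1%:R / m%:R)) rho%:C) a l = 0,
      forall k z, (monic_part (P (k * m + s)%N) %/ 'X^s).[z] =
        (rho ^+ k)%:C * \sum_(a < k.+1) c k a * ((z ^+ m - 1) / rho%:C) ^+ a &
      forall k z, (monic_part (P (k * m + s)%N)).[z] =
        z ^+ s * ((rho ^+ k)%:C * \sum_(a < k.+1) c k a * ((z ^+ m - 1) / rho%:C) ^+ a)].
Proof.
have [kap hkap] := class_moment hm hr0 hr1 hs.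
(* Coefficients in the variable u / rho, with rho^k factored out so that the leading one stays 1. *)
pose c k a := (Q k)`_a * (rho ^+ a)%:C / (rho ^+ k)%:C.
have QcE k z : (q k \Po 'X^m).[z] =
    (rho ^+ k)%:C * \sum_(a < k.+1) c k a * ((z ^+ m - 1) / rho%:C) ^+ a.
  rewrite QE mulr_sumr; apply: eq_bigr => a _; rewrite /c expr_div_n -rmorphXn /=.
  move: (rhoC0 a) (rhoC0 k); move: ((rho ^+ a)%:C : R[i]) ((rho ^+ k)%:C : R[i]) => x y x0 y0.
  by move: ((Q k)`_a) ((z ^+ m - 1) ^+ a) => A B; field; rewrite x0 y0.
exists c; split.
- by move=> k a ka; rewrite /c nth_default ?mul0r// Q_size.
- by move=> k; rewrite /c Q_lead mul1r divff.
- move=> k l lk.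
  (* With kap = 0 the function z^s would have norm 0, whereas [P s] is a multiple of it and has norm
     1. *)
  have kap0 : kap != 0.
    apply/eqP => k0; have := P_ip s s; rewrite eqxx.
    have e00 : p (0 * m + s) = 'X^s.
      rewrite pE -[RHS]mulr1; congr (_ * _).
      rewrite /q; apply/polyP => i; rewrite coef_comp_poly_Xn// coef_poly coef1.
      case: (posnP i) => [->|i0]; first by rewrite dvdn0 div0n /= mul0n add0n p_monic.
      case: ifP => // /dvdnP[j ij]; rewrite ij mulnK//; case: ltnP; last first.
        by move=> _; rewrite mulr0n.
      by rewrite ltnS leqn0 => /eqP j0; move: i0; rewrite ij j0.
    have e0 : P s = lead_coef (P s) *: 'X^s.
      by rewrite -e00 mul0n add0n /p /monic_part scalerA divff// scale1r.
    rewrite e0 -[X in ip X _]addr0 -[X in ip _ X]addr0 ip_linl ip_linr ip0r.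
    have ip0l g : ip 0 g = 0 by rewrite ipC ip0r conjC0.
    rewrite ip0l !addr0 => /eqP; rewrite /ip.
    rewrite (@eq_area_integral _ _ _ (fun z : R[i] => z ^+ s * (z ^+ m - 1) ^+ 0 * (z ^+ s * (z ^+ m - 1) ^+ 0)^*)).
      by rewrite hkap k0 mul0r !mulr0 eq_sym oner_eq0.
    by move=> z _; rewrite !hornerXn expr0 mulr1.
  have e1 := @p_low (k * m + s) ('X^s * ('X^m - 1) ^+ l).
  have sz : (size ('X^s * ('X^m - 1) ^+ l : {poly R[i]})%R <= k * m + s)%N.
    apply: leq_trans (size_polyMleq _ _) _; rewrite size_polyXn addSn /= addnC.
    have h1 : (size (('X^m - 1 : {poly R[i]}) ^+ l)%R <= (m * l).+1)%N.
      by apply: leq_trans (size_poly_exp_leq _ _) _; rewrite size_XnsubC.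
    rewrite leq_add2r; apply: (leq_trans h1); rewrite mulnC.
    by apply: (@leq_trans (l.+1 * m)); [rewrite mulSn addnC -addn1 leq_add2l|rewrite leq_mul2r lk orbT].
  have {e1} := e1 sz.
  rewrite /ip (@eq_area_integral _ _ _ (fun z : R[i] =>
    (\sum_(a < k.+1) (Q k)`_a * (z ^+ s * (z ^+ m - 1) ^+ a)) *
    (\sum_(j <- [:: tt]) 1 * (z ^+ s * (z ^+ m - 1) ^+ l))^*)); last first.
    move=> z _; rewrite pE hornerM hornerXn QE big_seq1 mul1r mulr_sumr; congr (_ * _).
      by apply: eq_bigr => a _; rewrite mulrCA.
    by rewrite zuE.
  have mf a : cmeas (fun z : R[i] => z ^+ s * (z ^+ m - 1) ^+ a).
    have := cmeas_horner ('X^s * ('X^m - 1) ^+ a : {poly R[i]}); congr cmeas; apply/funext => z.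
    by rewrite zuE.
  have bf a : bounded_on G (fun z : R[i] => z ^+ s * (z ^+ m - 1) ^+ a).
    have [B hB] := bG ('X^s * ('X^m - 1) ^+ a); exists B => z /hB.
    by rewrite zuE.
  rewrite (pairing_sum mG fG _ _ _ _ (fun a : 'I_k.+1 => mf a) (fun a : 'I_k.+1 => bf a)
    (fun=> mf l) (fun=> bf l)).
  move=> e2; apply: (@mulfI _ (kap * ((rho ^+ k)%:C * (rho ^+ l)%:C))).
    by rewrite !mulf_neq0.
  rewrite mulr0 -[RHS]e2 mulr_sumr; apply: eq_bigr => a _.
  rewrite big_seq1 (rmorph1 Num.conj) mulr1 hkap /c.
  move: (rhoC0 k); move: ((rho ^+ k)%:C : R[i]) => x x0.
  by move: (gram _ _ _) => g; field.
- move=> k z; rewrite -/(p _) pE mulrC mulpK ?QcE//.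
  by rewrite -size_poly_eq0 size_polyXn.
- by move=> k z; rewrite -/(p _) pE hornerM hornerXn QcE.
Qed.

End Class.

End BergmanClass.

(** * The two limits *)

Section OuterLimit.
Context {R : realType}.
Variables (m : nat) (r : R).
Hypotheses (hm : (2 <= m)%N) (hr0 : 0 < r) (hr1 : r < 1).
Variable P : nat -> {poly R[i]}.
Hypothesis hP : bergman_polynomials (lemniscate m r) P.
Variable s : nat.
Hypothesis hs : (s <= m - 1)%N.

Let rho : R := r ^+ m.
Let al : R := 1 - s.+1%:R / m%:R.
Let m_gt0 : (0 < m)%N. Proof. exact: ltnW. Qed.
Let rho_gt0 : 0 < rho. Proof. exact: exprn_gt0. Qed.
Let rho_lt1 : rho < 1. Proof. by rewrite exprn_ilt1// ?ltW// -lt0n. Qed.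
Let al01 : 0 <= al < 1. Proof. exact: class_exponent01. Qed.
Let al01' : 0 <= al <= 1. Proof. by case/andP: al01 => -> /ltW. Qed.

Lemma tau_half : tau R m s / 2 = al.
Proof.
have m0 : m%:R != 0 :> R by rewrite pnatr_eq0 -lt0n.
by rewrite /tau /al -natr1; field.
Qed.

Let r2m : r ^+ (2 * m) = rho ^+ 2. Proof. by rewrite mulnC exprM. Qed.
Let r2_gt0 : 0 < rho ^+ 2. Proof. by rewrite exprn_gt0. Qed.
Let rhoC0 : rho%:C != 0 :> R[i].
Proof. by rewrite -cnorm_eq0 cnorm_real normr_eq0 gt_eqF. Qed.

(** In this variable the set |u| >= rho^2 becomes part of the closed unit disc, the limit becomes (1
    + zeta)^al, and the excluded point becomes zeta = -1. *)
Let zeta (u : R[i]) : R[i] := (rho ^+ 2)%:C / u.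

Let zetaE u : u != 0 -> (u + (rho ^+ 2)%:C) / u = 1 + zeta u.
Proof. by move=> u0; rewrite mulrDl divff. Qed.

Let outerP z : outer_domain m r z ->
  [/\ z ^+ m - 1 != 0, cnorm (zeta (z ^+ m - 1)) <= 1 & zeta (z ^+ m - 1) != -1].
Proof.
move=> [+ un]; rewrite r2m cnormE lecR => h; set u := z ^+ m - 1 in h un *.
have u0 : 0 < cnorm u by exact: lt_le_trans h.
have un0 : u != 0 by rewrite -cnorm_gt0.
split => //.
  by rewrite /zeta cnormM cnormV cnorm_real ger0_norm ?(ltW r2_gt0)// ler_pdivrMr// mul1r.
apply/eqP => /(congr1 ( *%R^~ u)); rewrite /zeta divfK// mulN1r => e.
by apply: un; rewrite -r2m in e; rewrite e opprK.
Qed.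

Let L (z : R[i]) : R[i] := clog ((z ^+ m - 1 + (r ^+ (2 * m))%:C) / (z ^+ m - 1)).
Let F (z : R[i]) : R[i] := cexp (al%:C * L z).

Let FE z : z ^+ m - 1 != 0 -> cnorm (zeta (z ^+ m - 1)) <= 1 -> zeta (z ^+ m - 1) != -1 ->
  F z = bpow al (zeta (z ^+ m - 1)).
Proof.
move=> u0 z1 zn; rewrite (bpow_clog al01' m_gt0 (class_exponentM hm hs) z1 zn).
by rewrite /F /L r2m zetaE.
Qed.

Let F_branch : power_branch (outer_domain m r)
  (fun z => (z ^+ m - 1 + (r ^+ (2 * m))%:C) / (z ^+ m - 1)) al F.
Proof.
exists L; split.
  apply: continuous_in_subspaceT => z; rewrite inE => /outerP[u0 z1 zn].
  apply: econt_continuous.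
  have hu : econt cdist (fun w : R[i] => w ^+ m - 1) z.
    exact: econtD (econtX m (@econt_id _ z)) (econt_cst _ _ _).
  apply: (@econt_comp _ _ _ clog).
    by apply: econt_clog; rewrite r2m zetaE// Re_add1_gt0.
  by apply: econtM; [exact: econtD hu (econt_cst _ _ _)|exact: econtV].
move=> z /outerP[u0 z1 zn]; split => //.
by rewrite /L clogK// r2m zetaE// Re_add1_gt0.
Qed.

Let F_infinity : tends_to_at_infinity F 1.
Proof.
move=> e e0; have e2 : 0 < e / 2 by rewrite divr_gt0.
have [d d0 hd] := bpow_unif_continuous al01' e2.
(* Beyond this radius |z|^m >= |z|, so |u| exceeds 1 + 1 / d, which makes |zeta| smaller than 1 and
   at most [d]. *)
exists (2 + d^-1) => z; rewrite !cnormE !ltcR => hz; set u := z ^+ m - 1.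
have dV : 0 < d^-1 by rewrite invr_gt0.
have hu : 1 + d^-1 < cnorm u.
  have z1 : 1 <= cnorm z by lra.
  have := cnormD u 1; rewrite subrK cnorm1 cnormX.
  have : cnorm z <= cnorm z ^+ m by rewrite -{1}[cnorm z]expr1; apply: ler_weXn2l.
  lra.
have u0 : 0 < cnorm u by lra.
have r21 : rho ^+ 2 < 1 by rewrite exprn_ilt1// ltW.
have zE : cnorm (zeta u) = rho ^+ 2 / cnorm u.
  by rewrite /zeta cnormM cnormV cnorm_real ger0_norm// ltW.
have z1 : cnorm (zeta u) < 1 by rewrite zE ltr_pdivrMr// mul1r; lra.
have zd : cnorm (zeta u) <= d.
  rewrite zE ler_pdivrMr//; apply: (@le_trans _ _ (d * d^-1)).
    by rewrite divff ?gt_eqF// ltW.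
  by apply: ler_wpM2l; lra.
rewrite FE ?(ltW z1) -?cnorm_gt0//; last first.
  by apply: contraTneq z1 => ->; rewrite cnormN cnorm1 ltxx.
have := hd (zeta u) 0 (ltW z1); rewrite cnorm0 subr0 bpow_at0 => /(_ ler01 zd).
by move=> /le_lt_trans; apply; rewrite ltr_pdivrMr// ltr_pMr// ltr1n.
Qed.

(** On the outer domain |zeta| <= 1, so the difference is at most the l^1 distance of
    [outer_coeffs], whatever the point. *)
Let F_cvg : cvg_uniformly_on_compacts (outer_domain m r)
  (fun k z => (monic_part (P (k * m + s)%N) %/ 'X^s).[z] / (z ^+ m - 1) ^+ k) F.
Proof.
move=> K _ KD; have [c [c_gt c_monic c_orth pE _]] := bergman_class hm hr0 hr1 hP hs.
have rho01 : 0 < rho < 1 by rewrite rho_gt0.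
apply: uniform_cvgC => e e0.
have [N hN] := outer_coeffs rho01 al01 c_gt c_monic c_orth e0.
exists N => k Nk z /KD/outerP[u0 z1 zn]; rewrite FE// pE.
set u := z ^+ m - 1 in u0 z1 zn *.
(* The coefficients read from the top: for a = k - i, the factor rho^k (u / rho)^a / u^k equals
   rho^(-i) zeta^i. *)
pose b i := (if (i <= k)%N then c k (k - i)%N else 0) / rho%:C ^+ i * zeta u ^+ i.
have -> : (rho ^+ k)%:C * (\sum_(a < k.+1) c k a * (u / rho%:C) ^+ a) / u ^+ k = tsum b.
  rewrite (@tsum_fin _ _ k.+1) => [|i ki]; last by rewrite /b leqNgt ki !mul0r.
  rewrite (reindex_inj rev_ord_inj) /= mulr_sumr mulr_suml; apply: eq_bigr => i _.
  have ik : (i <= k)%N by rewrite -ltnS.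
  have kE : rho%:C ^+ k = rho%:C ^+ (k - i) * rho%:C ^+ i :> R[i] by rewrite -exprD subnK.
  have uE : u ^+ k = u ^+ (k - i) * u ^+ i by rewrite -exprD subnK.
  rewrite /b ik subSS /zeta !expr_div_n uE.
  rewrite [(rho ^+ k)%:C]rmorphXn [(rho ^+ 2)%:C]rmorphXn /= kE [(rho%:C ^+ 2) ^+ i]exprAC.
  have h1 : rho%:C ^+ i != 0 :> R[i] by rewrite expf_neq0.
  have h2 : rho%:C ^+ (k - i) != 0 :> R[i] by rewrite expf_neq0.
  have h3 : u ^+ i != 0 by rewrite expf_neq0.
  have h4 : u ^+ (k - i) != 0 by rewrite expf_neq0.
  move: (u ^+ i) (u ^+ (k - i)) h3 h4 => p q p0 q0.
  move: (c k (k - i)%N) (rho%:C ^+ i) (rho%:C ^+ (k - i)) h1 h2 => w x y x0 y0.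
  by field; rewrite x0 y0 p0 q0.
have sb : asum b by apply: (@asum_fin _ _ k.+1) => i ki; rewrite /b leqNgt ki !mul0r.
have sz : asum (bterm al (zeta u)) by exact: asum_bterm_le1.
rewrite /bpow -tsumB//; apply: tsum_le => M; apply: le_trans (hN k Nk M).
apply: ler_sum => i _; rewrite /b /bterm -mulrBl cnormM cnormX.
by rewrite ler_piMr ?cnorm_ge0// exprn_ile1// cnorm_ge0.
Qed.

Theorem outer_limit : exists F : R[i] -> R[i],
  [/\ power_branch (outer_domain m r)
        (fun z => (z ^+ m - 1 + (r ^+ (2 * m))%:C) / (z ^+ m - 1))
        (tau R m s / 2) F,
      tends_to_at_infinity F 1 &
      cvg_uniformly_on_compacts (outer_domain m r)
        (fun k z => (monic_part (P (k * m + s)%N) %/ 'X^s).[z] / (z ^+ m - 1) ^+ k) F].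
Proof. by exists F; rewrite tau_half; split. Qed.

End OuterLimit.

(** * The limit inside the critical circle *)

Section InnerLimit.
Context {R : realType}.

Lemma ch_m2 n : ch (- 2 : R) n = (-1) ^+ n * n.+1%:R.
Proof.
elim: n => [|n ih]; first by rewrite ch0 expr0 mul1r.
have n0 : n.+1%:R != 0 :> R by rewrite pnatr_eq0.
rewrite chS ih exprS -[n.+2%:R]natr1 -[n%:R](addrK 1) natr1.
by move: (n.+1%:R : R) n0 => N N0; field.
Qed.

(** [asum_bterm_lt1] covers exponents of modulus at most 1, so -2 is reached as -1 added to
    itself. *)
Lemma bpow_m2 (z : R[i]) : cnorm z < 1 ->
  asum (bterm (- 2) z) /\ bpow (- 2) z = (1 + z) ^- 2.
Proof.
move=> z1; have s1 : asum (bterm (- 1) z) by apply: asum_bterm_lt1; rewrite ?normrN ?normr1.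
have e2 : - 2 = - 1 + - 1 :> R by rewrite -opprD.
split; first by rewrite e2; exact: asum_btermD.
rewrite e2 bpowD//; have := bpowN (asum_bterm1 z) s1; rewrite bpow1 => h.
have n0 : 1 + z != 0 by apply: contra_eq_neq h => ->; rewrite mul0r eq_sym oner_eq0.
by rewrite -[bpow _ _](mulKf n0) h mulr1 -expr2 exprVn.
Qed.

(** Links the series to the real power function; it produces the power of 1 - r^(2 m) in the
    limit. *)
Lemma bpow_real (al t : R) m n : 0 <= al <= 1 -> (0 < m)%N -> m%:R * al = n%:R ->
  0 <= t < 1 -> bpow al (- t%:C) = ((1 - t) `^ al)%:C.
Proof.
move=> al01 m0 man /andP[t0 t1].
rewrite (bpow_clog al01 m0 man).
- have d0 : 0 < 1 - t by rewrite subr_gt0.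
  have -> : 1 + - t%:C = (1 - t)%:C :> R[i] by rewrite rmorphB.
  have -> : clog (1 - t)%:C = (ln (1 - t))%:C.
    by rewrite /clog cnorm_real gtr0_norm//= mul0r atan0.
  rewrite -rmorphM /cexp /= cos0 sin0 /powR gt_eqF//.
  by apply/eqP; rewrite eq_complex /= !mulr1 !mul0r subr0 mulr0 addr0 !eqxx.
- by rewrite cnormN cnorm_real ger0_norm// ltW.
- by rewrite eqr_opp; apply/eqP => /complexI t1'; rewrite t1' ltxx in t1.
Qed.

Variables (m : nat) (r : R).
Hypotheses (hm : (2 <= m)%N) (hr0 : 0 < r) (hr1 : r < 1).
Variable P : nat -> {poly R[i]}.
Hypothesis hP : bergman_polynomials (lemniscate m r) P.
Variables s j : nat.
Hypothesis hs : (s <= m - 2)%N.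

Let rho : R := r ^+ m.
Let al : R := 1 - s.+1%:R / m%:R.
Let m_gt0 : (0 < m)%N. Proof. exact: ltnW. Qed.
Let hs1 : (s <= m - 1)%N. Proof. by apply: leq_trans hs _; rewrite leq_sub2l. Qed.
Let rho_gt0 : 0 < rho. Proof. exact: exprn_gt0. Qed.
Let rho_lt1 : rho < 1. Proof. by rewrite exprn_ilt1// ?ltW// -lt0n. Qed.
Let rho01 : 0 < rho < 1. Proof. by rewrite rho_gt0. Qed.
Let al01 : 0 <= al < 1. Proof. exact: class_exponent01. Qed.
Let al01' : 0 <= al <= 1. Proof. by case/andP: al01 => -> /ltW. Qed.
Let al_gt0 : 0 < al.
Proof.
rewrite /al subr_gt0 ltr_pdivrMr ?ltr0n// mul1r ltr_nat.
by move: hm hs; clear; lia.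
Qed.
Let alM : m%:R * al = (m.-1 - s)%:R :> R. Proof. exact: class_exponentM. Qed.

Let u (z : R[i]) : R[i] := z ^+ m - 1.
Let G : set R[i] := lemniscate m r.

Let G_root : G (unit_root R m j).
Proof. by apply/lemniscateE; rewrite unit_root_exp// subrr cnorm0. Qed.

(** The quotient of z^s (1 + u)^al by z^(m-1) has m-th power 1, since s m + m (m - 1 - s) = m (m -
    1). It is therefore constant on the component, and at the root of unity w there, where u = 0, it
    equals w^(s - m + 1) = w^(s + 1). *)
Lemma class_factor_component z : lemniscate_component m r j z ->
  z ^+ s * bpow al (u z) = cexp ((2 * pi * j%:R * (s.+1)%:R / m%:R) *i) * z ^+ (m - 1).
Proof.
move=> Cz; pose w := unit_root R m j.
have CG : lemniscate_component m r j `<=` G by exact: connected_component_sub.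
have Cw : lemniscate_component m r j w by exact: connected_component_refl.
have wm : w ^+ m = 1 by exact: unit_root_exp.
have wS : w ^+ s.+1 = cexp ((2 * pi * j%:R * (s.+1)%:R / m%:R) *i).
  by rewrite unit_rootX /unit_root; congr (cexp (_ *i)); rewrite natrM mulrA.
clearbody w.
pose f (z : R[i]) := z ^+ s * bpow al (u z) / z ^+ (m - 1).
have z_neq0 y : G y -> y != 0 by exact: (lemniscate_neq0 hm hr0 hr1).
have u1 y : G y -> cnorm (u y) <= 1.
  by move=> /lemniscateE h; apply: ltW; exact: lt_trans h rho_lt1.
have cC : connected (lemniscate_component m r j) by exact: component_connected.
have := @unity_root_locally_constant _ _ _ f m m_gt0 cC.
have cf : forall x, lemniscate_component m r j x -> forall e : R, 0 < e ->
    nbhs x [set y | lemniscate_component m r j y -> cnorm (f y - f x) < e].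
  move=> x Cx; apply: (@nbhs_econtC _ _ f (exist _ x Cx)).
  have hid : econt (fun a b : {z | lemniscate_component m r j z} => cdist (sval a) (sval b))
      (fun a => sval a) (exist _ x Cx) by move=> e e0; exists e.
  apply: econtM.
    apply: econtM; first exact: (econtX s hid).
    apply: econt_bpow => //; first by move=> a; apply: u1; apply: CG; exact: svalP.
    exact: econtD (econtX m hid) (econt_cst _ _ _).
  apply: econtV; last exact: (econtX (m - 1) hid).
  by rewrite /= expf_neq0// z_neq0//; exact: CG.
have f1 x : lemniscate_component m r j x -> f x ^+ m = 1.
  move=> /CG Gx; rewrite /f !exprMn exprVn.
  rewrite (bpow_root (asum_bterm_le1 al01' (u1 x Gx)) alM) /u addrCA subrr addr0.
  rewrite -!exprM -exprD; have x0 := z_neq0 x Gx.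
  have -> : (s * m + m * (m.-1 - s) = (m - 1) * m)%N.
    by rewrite [(m * _)%N]mulnC -mulnDl subnKC -?subn1.
  by rewrite divff// expf_neq0.
move=> /(_ cf f1 z w Cz Cw) e.
have zn : z ^+ (m - 1) != 0 by rewrite expf_neq0// z_neq0//; exact: CG.
have -> : z ^+ s * bpow al (u z) = f z * z ^+ (m - 1) by rewrite /f divfK.
have Gw : G w by exact: CG.
rewrite e -wS; congr (_ * _); rewrite /f /u wm subrr bpow_at0 mulr1.
have wn : w ^+ (m - 1) != 0 by rewrite expf_neq0// z_neq0.
apply: (mulIf wn); rewrite divfK// -exprD.
have -> : (s.+1 + (m - 1) = m + s)%N by move: m_gt0; clear; lia.
by rewrite exprD wm mul1r.
Qed.

Let L (A : R) (i : nat) : R[i] := \sum_(l < i.+1) bterm al rho%:C (i - l) *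
  (l.+1%:R * (- rho%:C^-1) ^+ l * (A%:C *
     tsum (fun j : nat => bterm (- al) rho%:C j * (- rho%:C) ^+ j))).

(** Up to constants, [L] comes from the Cauchy product of the series of (1 + u / rho^2)^-2 and of (1
    + u)^al. The first converges for |u| < rho^2, and 1 + u / rho^2 = (u + rho^2) / rho^2 is the
    origin of rho^4. *)
Let inner_series (A : R) z : cnorm (u z) < rho ^+ 2 ->
  asum (fun i => L A i * (u z / rho%:C) ^+ i) /\
  tsum (fun i => L A i * (u z / rho%:C) ^+ i) =
    bpow al (u z) * ((rho ^+ 4)%:C / (u z + (rho ^+ 2)%:C) ^+ 2) *
    (A / (1 - rho ^+ 2) `^ al)%:C.
Proof.
pose x := u z / rho%:C; rewrite -/x => uz; have rC : rho%:C != 0 :> R[i] by rewrite -cnorm_eq0 cnorm_real normr_eq0 gt_eqF.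
have r21 : rho ^+ 2 < 1 by rewrite exprn_ilt1// ltW.
have u1 : cnorm (u z) < 1 by exact: lt_trans uz r21.
pose h := tsum (fun j : nat => bterm (- al) rho%:C j * (- rho%:C) ^+ j).
have hE : h = (((1 - rho ^+ 2) `^ al)^-1)%:C.
  have -> : h = bpow (- al) (- (rho ^+ 2)%:C).
    apply: eq_tsum => i; rewrite /bterm -mulrA -exprMn; congr (_ * _ ^+ _).
    by rewrite mulrN -rmorphM -expr2.
  have c1 : cnorm (- (rho ^+ 2)%:C : R[i]) < 1.
    by rewrite cnormN cnorm_real ger0_norm ?sqr_ge0.
  have := bpowN (asum_bterm_le1 al01' (ltW c1)) (asum_bterm_lt1 _ c1).
  rewrite normrN ger0_norm; last by case/andP: al01.
  move=> /(_ (ltW (andP al01).2)); rewrite (bpow_real al01' m_gt0 alM) ?sqr_ge0//.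
  have p0 : 0 < (1 - rho ^+ 2) `^ al by apply: powR_gt0; rewrite subr_gt0.
  move=> e; have pC : ((1 - rho ^+ 2) `^ al)%:C != 0 :> R[i].
    by rewrite -cnorm_eq0 cnorm_real normr_eq0 gt_eqF.
  by rewrite fmorphV; apply: (mulfI pC); rewrite e divff.
pose y := u z / (rho ^+ 2)%:C.
have r2C : (rho ^+ 2)%:C != 0 :> R[i].
  by rewrite -cnorm_eq0 cnorm_real normr_eq0 gt_eqF// exprn_gt0.
have y1 : cnorm y < 1.
  rewrite /y cnormM cnormV cnorm_real ger0_norm ?sqr_ge0// ltr_pdivrMr ?mul1r//.
  by rewrite exprn_gt0.
have [sy yE] := bpow_m2 y1.
have ux : u z = rho%:C * x by rewrite /x mulrCA divff ?mulr1.
have yx : y = rho%:C^-1 * x.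
  by rewrite /y /x rmorphXn /= expr2; field; exact: rC.
have LE i : L A i * x ^+ i = A%:C * h * cprod (bterm (- 2) y) (bterm al (u z)) i.
  rewrite /L /cprod mulr_suml mulr_sumr; apply: eq_bigr => l _; rewrite -/h.
  have li : (l <= i)%N by rewrite -ltnS.
  have -> : x ^+ i = x ^+ (i - l) * x ^+ l by rewrite -exprD subnK.
  have ch2C : (ch (- 2) l)%:C = (-1) ^+ l * l.+1%:R :> R[i].
    by rewrite ch_m2 rmorphM rmorphXn /= rmorphN rmorph1 rmorph_nat.
  rewrite /bterm ch2C.
  rewrite ux yx !exprMn [(- rho%:C^-1) ^+ l]exprNn.
  move: (rho%:C ^+ (i - l)) (x ^+ (i - l)) (rho%:C^-1 ^+ l) (x ^+ l) ((-1) ^+ l : R[i]).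
  by move=> a b d e f; ring.
have sal : asum (bterm al (u z)) by apply: asum_bterm_le1 => //; exact: ltW.
have sc := asum_cprod sy sal.
have fE : (fun i => L A i * x ^+ i) = (fun i => A%:C * h * cprod (bterm (- 2) y) (bterm al (u z)) i).
  by apply/funext => i; exact: LE.
rewrite fE; split; first exact: asumZ.
rewrite tsumZ// -tsum_cprod// -/(bpow _ _) -/(bpow _ _) yE hE.
have uy : u z + (rho ^+ 2)%:C = (rho ^+ 2)%:C * (1 + y).
  by rewrite mulrDr mulr1 /y mulrCA divff// mulr1 addrC.
have y0 : 1 + y != 0.
  apply/eqP => /eqP; rewrite addr_eq0 => /eqP e.
  by move: y1; rewrite -[y]opprK -e cnormN cnorm1 ltxx.
have r4 : (rho ^+ 4)%:C = (rho ^+ 2)%:C ^+ 2 :> R[i] by rewrite (exprM rho 2 2 : rho ^+ 4 = _) rmorphXn.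
rewrite uy exprMn r4 [(A / _)%:C]rmorphM /=.
move: (bpow al _) (((1 - rho ^+ 2) `^ al)^-1%:C : R[i]) ((rho ^+ 2)%:C : R[i]) r2C y0 => B C D D0.
by move: (1 + y) => Y Y0; field; rewrite D0 Y0.
Qed.

Theorem inner_limit : cvg_uniformly_on_compacts (inner_domain m r j)
  (fun k z =>
     ((-1) ^+ k.+1 * k%:R `^ (2 + tau R m s / 2)
      / r ^+ (m * (2 * k + 4)))%:C * (monic_part (P (k * m + s)%N)).[z])
  (fun z =>
     cexp ((2 * pi * j%:R * (s.+1)%:R / m%:R) *i) * z ^+ (m - 1)
     * (tau R m s * Gamma (tau R m s / 2) * sin (tau R m s * pi / 2))%:C
     / ((2 * pi * (1 - r ^+ (2 * m)) `^ (tau R m s / 2))%:C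
        * (z ^+ m - 1 + (r ^+ (2 * m))%:C) ^+ 2)).
Proof.
move=> K cK KD; have [c [c_gt c_monic c_orth _ pE]] := bergman_class hm hr0 hr1 hP hs1.
have [K0|/set0P Kn0] := eqVneq K set0.
  by apply: uniform_cvgC => e e0; exists 0%N => k _ z; rewrite K0.
have alE : tau R m s / 2 = al by exact: tau_half.
have r2m : r ^+ (2 * m) = rho ^+ 2 by rewrite mulnC exprM.
have KP z : K z -> lemniscate_component m r j z /\ cnorm (u z) < rho ^+ 2.
  by move=> /KD[Cz]; rewrite r2m cnormE ltcR.
have KG z : K z -> G z by move=> /KP[Cz _]; exact: connected_component_sub Cz.
have ucont : {within K, continuous (fun z : R[i] => cnorm (u z))}.
  apply: continuous_in_subspaceT => z _; apply: econt_continuousR; apply: econt_cnorm.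
  exact: econtD (econtX m (@econt_id _ z)) (econt_cst _ _ _).
(* Compactness enters here: |u| attains its maximum on [K], which is thus strictly below rho^2, and
   this gives a radius [q] < rho. *)
have [z0 /set_mem Kz0 z0max] := compact_EVT_max Kn0 cK ucont.
pose q := cnorm (u z0) / rho.
have q01 : 0 <= q < rho.
  rewrite divr_ge0 ?cnorm_ge0 ?(ltW rho_gt0)//= ltr_pdivrMr// -expr2.
  by have [] := KP z0 Kz0.
have rC : rho%:C != 0 :> R[i] by rewrite -cnorm_eq0 cnorm_real normr_eq0 gt_eqF.
have xq z : K z -> cnorm (u z / rho%:C) <= q.
  move=> Kz; rewrite cnormM cnormV cnorm_real (gtr0_norm rho_gt0).
  by apply: ler_wpM2r; [rewrite invr_ge0 ltW|apply: z0max; exact/mem_set].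
have [M hM] := lemniscate_horner_bounded hm hr0 hr1 ('X^s).
have zs z : K z -> cnorm (z ^+ s) <= `|M|.
  by move=> /KG/hM; rewrite hornerXn => /le_trans; apply; exact: ler_norm.
pose A : R := al * Gamma al * sin (pi * al) / pi.
pose w (k : nat) : R := k%:R `^ (1 + al).
have wlim : w k * ((-1) ^+ k.+1 * ch al k) @[k --> \oo] --> A.
  by apply: ch_asymptotics; rewrite al_gt0; case/andP: al01.
have r4 : 0 < rho ^+ 4 by rewrite exprn_gt0.
apply: uniform_cvgC => e e0.
(* The coefficient error will be multiplied by rho^-4 |z^s|; the added 1 avoids dividing by 0 when M
   = 0. *)
have e1 : 0 < e * rho ^+ 4 / (`|M| + 1) by rewrite divr_gt0 ?mulr_gt0// ltr_wpDl.
have [N hN] := inner_coeffs rho01 al01 c_gt c_monic c_orth al_gt0 wlim q01 e1.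
exists N => k Nk z Kz; have [Cz uz] := KP z Kz.
have [] := inner_series A uz; set x := u z / rho%:C => sL LE.
pose nu : R[i] := (w k * k%:R * (-1) ^+ k.+1 / rho ^+ k)%:C.
pose b i := nu * c k i * x ^+ i.
have bfin i : (k.+1 <= i)%N -> b i = 0 by move=> ki; rewrite /b c_gt// mulr0 mul0r.
have sb : asum b by exact: asum_fin bfin.
have lhsE : ((-1) ^+ k.+1 * k%:R `^ (2 + tau R m s / 2) / r ^+ (m * (2 * k + 4)))%:C *
    (monic_part (P (k * m + s)%N)).[z] = ((rho ^+ 4)^-1)%:C * z ^+ s * tsum b.
  rewrite pE (tsum_fin bfin) /b alE.
  have -> : \sum_(i < k.+1) nu * c k i * x ^+ i = nu * \sum_(i < k.+1) c k i * x ^+ i.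
    by rewrite mulr_sumr; apply: eq_bigr => i _; rewrite mulrA.
  rewrite -/rho -/(u z) -/x.
  (* In r^(m (2 k + 4)) = rho^(2 k) rho^4, one factor rho^k cancels against the one in the formula
     for p, and the other belongs to [nu]. *)
  have rE : (-1) ^+ k.+1 * k%:R `^ (2 + al) / r ^+ (m * (2 * k + 4)) * rho ^+ k =
      (rho ^+ 4)^-1 * (w k * k%:R * (-1) ^+ k.+1 / rho ^+ k).
    have -> : k%:R `^ (2 + al) = w k * k%:R.
      (* At k = 0 the left side is a power of 0 with positive exponent, hence 0, as is the right
         side. *)
      rewrite /w; case: (posnP k) => [->|k0].
        by rewrite mulr0 powR0// gt_eqF// addr_gt0.
      have -> : 2 + al = (1 + al) + 1 by ring.
      by rewrite powRD ?powRr1// pnatr_eq0 -lt0n k0 implybT.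
    rewrite exprM -/rho mul2n -addnn !exprD.
    have k0 : rho ^+ k != 0 by rewrite gt_eqF// exprn_gt0.
    have k4 : rho ^+ 4 != 0 by rewrite gt_eqF.
    by move: (rho ^+ k) (rho ^+ 4) k0 k4 (w k) => p p4 h1 h2 W; field; rewrite h1 h2.
  have rCE : ((-1) ^+ k.+1 * k%:R `^ (2 + al) / r ^+ (m * (2 * k + 4)))%:C * (rho ^+ k)%:C =
      ((rho ^+ 4)^-1)%:C * nu by rewrite /nu -!rmorphM rE.
  move: rCE; move: (_%:C) ((rho ^+ k)%:C : R[i]) (((rho ^+ 4)^-1)%:C : R[i]) (\sum_(i < k.+1) _).
  move=> X Y Z S XY; transitivity (X * Y * (z ^+ s * S)); first by ring.
  by rewrite XY; ring.
have rhsE : cexp ((2 * pi * j%:R * (s.+1)%:R / m%:R) *i) * z ^+ (m - 1)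
     * (tau R m s * Gamma (tau R m s / 2) * sin (tau R m s * pi / 2))%:C
     / ((2 * pi * (1 - r ^+ (2 * m)) `^ (tau R m s / 2))%:C
        * (z ^+ m - 1 + (r ^+ (2 * m))%:C) ^+ 2) =
    ((rho ^+ 4)^-1)%:C * z ^+ s * tsum (fun i => L A i * x ^+ i).
  rewrite LE alE r2m -/(u z) -(class_factor_component Cz).
  have tauE : tau R m s = 2 * al by rewrite -alE; field.
  have p0 : pi != 0 :> R by rewrite gt_eqF ?pi_gt0.
  have -> : tau R m s * Gamma al * sin (tau R m s * pi / 2) = (2 * pi) * A.
    have -> : tau R m s * pi / 2 = pi * al by rewrite tauE; field.
    by rewrite tauE /A; move: (Gamma al) (sin (pi * al)) (pi : R) p0 => g S p p0; field.
  have B0 : 0 < (1 - rho ^+ 2) `^ al.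
    by apply: powR_gt0; rewrite subr_gt0 exprn_ilt1// ltW.
  have rC0 (y : R) : y != 0 -> y%:C != 0 :> R[i].
    by move=> y0; rewrite -cnorm_eq0 cnorm_real normr_eq0.
  have W0 : u z + (rho ^+ 2)%:C != 0.
    rewrite addr_eq0; apply/eqP => uE; move: uz.
    by rewrite uE cnormN cnorm_real ger0_norm ?sqr_ge0// ltxx.
  rewrite [(2 * pi * A)%:C]rmorphM [(2 * pi * _)%:C]rmorphM [(A / _)%:C]rmorphM /= !fmorphV /=.
  have h1 := rC0 _ (lt0r_neq0 B0); have h2 := rC0 _ (lt0r_neq0 r4).
  have h3 : (2 * pi)%:C != 0 :> R[i] by apply: rC0; rewrite mulf_neq0.
  move: (bpow al (u z)) (A%:C : R[i]) => b1 a1.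
  move: ((2 * pi)%:C : R[i]) (((1 - rho ^+ 2) `^ al)%:C : R[i]) ((rho ^+ 4)%:C : R[i]) h1 h2 h3.
  move: (u z + (rho ^+ 2)%:C) W0 => W W0 x1 x2 x3 h1 h2 h3.
  by field; rewrite W0 h1 h2 h3.
rewrite lhsE rhsE -mulrBr !cnormM -tsumB// cnorm_real gtr0_norm ?invr_gt0//.
have h : cnorm (tsum (fun i => b i - L A i * x ^+ i)) <= e * rho ^+ 4 / (`|M| + 1).
  apply: tsum_le => n; apply: le_trans (hN k Nk n); apply: ler_sum => i _.
  rewrite /b -mulrBl !cnormM; apply: ler_wpM2l; first exact: cnorm_ge0.
  rewrite !cnormX cnorm_real ger0_norm; last by case/andP: q01.
  by apply: lerXn2r; rewrite ?nnegrE ?cnorm_ge0 ?xq//; case/andP: q01.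
apply: (@le_trans _ _ ((rho ^+ 4)^-1 * `|M| * (e * rho ^+ 4 / (`|M| + 1)))).
  apply: ler_pM => //; rewrite ?mulr_ge0 ?invr_ge0 ?cnorm_ge0 ?(ltW r4)//.
  by apply: ler_wpM2l; [rewrite invr_ge0 ltW|exact: zs].
have M1 : 0 < `|M| + 1 by rewrite ltr_wpDl.
have -> : (rho ^+ 4)^-1 * `|M| * (e * rho ^+ 4 / (`|M| + 1)) = e * (`|M| / (`|M| + 1)).
  by move: (rho ^+ 4) r4 => y y0; field; rewrite !gt_eqF.
by rewrite ler_piMr ?(ltW e0)// ler_pdivrMr// mul1r lerDl.
Qed.

End InnerLimit.

Theorem proposition7p3 (R : realType) (m : nat) (r : R)
    (hm : (2 <= m)%N) (hr0 : 0 < r) (hr1 : r < 1)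
    (P : nat -> {poly R[i]})
    (hP : bergman_polynomials (lemniscate m r) P) :
  let p := fun n => monic_part (P n) in
  (forall s : nat, (s <= m - 1)%N ->
    exists F : R[i] -> R[i],
      [/\ power_branch (outer_domain m r)
            (fun z => (z ^+ m - 1 + (r ^+ (2 * m))%:C) / (z ^+ m - 1))
            (tau R m s / 2) F,
          tends_to_at_infinity F 1 &
          cvg_uniformly_on_compacts (outer_domain m r)
            (fun k z => (p (k * m + s)%N %/ 'X^s).[z] / (z ^+ m - 1) ^+ k)
            F])
  /\
  (forall s j : nat, (s <= m - 2)%N -> (1 <= j <= m)%N ->
    cvg_uniformly_on_compacts (inner_domain m r j)
      (fun k z =>
         ((-1) ^+ k.+1 * k%:R `^ (2 + tau R m s / 2)
          / r ^+ (m * (2 * k + 4)))%:C * (p (k * m + s)%N).[z])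
      (fun z =>
         cexp ((2 * pi * j%:R * (s.+1)%:R / m%:R) *i) * z ^+ (m - 1)
         * (tau R m s * Gamma (tau R m s / 2) * sin (tau R m s * pi / 2))%:C
         / ((2 * pi * (1 - r ^+ (2 * m)) `^ (tau R m s / 2))%:C
            * (z ^+ m - 1 + (r ^+ (2 * m))%:C) ^+ 2))).
Proof.
move=> p; split=> [s hs|s j hs _]; first exact: outer_limit.
exact: inner_limit.
Qed.
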